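(* Under the standing assumptions of the context, as $l\to\infty$, $$|\Delta^2_{\varphi_l^{\bot}}-\Delta^2_{\varphi^M}|=O\Big(\max\big\{\mu(l),\,l\,C_0^{-l+2\log_2\frac{1+\varepsilon(l)}{c}}\big\}\Big),\qquad C_0:=\frac{32\pi^2e^{2\omega_0}}{27}.$$
   Context: Fourier transform: $\widehat f(\omega)=\int_{\mathbb{R}}f(t)e^{-it\omega}\,dt$. Let $\theta$ be odd, non-decreasing, $C^2$, with $\theta(\omega)=\pi/4$ for $\omega>\pi/3$; fix $\pi/3\le\omega_0<\pi/2$. Meyer scaling function: $\widehat{\varphi^M}(\omega)=1$ for $|\omega|\le2\omega_0$, $=\cos(\frac\pi4+\theta(\frac{\pi}{3(\pi-2\omega_0)}(|\omega|-\pi)))$ for $2\omega_0<|\omega|\le2\pi-2\omega_0$, $=0$ otherwise. Meyer mask: $2\pi$-periodic $m^M$ with $m^M(\omega)=\widehat{\varphi^M}(2\omega)$ on $[-\pi,\pi]$. $\|\cdot\|_C$: sup norm on $[-\pi,\pi]$. A linear method of summation $(\lambda_{n,k})$ maps $f$ with Fourier coefficients $a_k,b_k$ to $u_n(f,\omega)=\frac{a_0}2+\sum_{k=1}^n\lambda_{n,k}(a_k\cos k\omega+b_k\sin k\omega)$. $m^M_l:=m^M/(\cos\frac\omega2)^{2l}$. Standing assumptions: a method and a sequence $n(l)$ are fixed with $u_l:=u_{n(l)}(m^M_l,\cdot)$, $u_{1,l}:=u_{n(l)}((m^M_l)',\cdot)$ satisfying $\alpha(l):=\|u_l-m^M_l\|_C=o(l^{-1})$,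 $\gamma(l):=\|u_{1,l}-(m^M_l)'\|_C=o(1)$, $u_l(\pi)\ne0$; $l_0$ is fixed with $c:=\inf_{l\ge l_0}|u_l(0)|>0$ and $l\ge l_0$. $\varepsilon(l):=\alpha(l)/\|m^M_l\|_C$, $\mu(l):=l\alpha(l)+\gamma(l)$. $m_l(\omega):=(\cos\frac\omega2)^{2l}u_l(\omega)/u_l(0)$, $\widehat{\varphi_l}(\omega):=\prod_{j\ge1}m_l(\omega2^{-j})$, $\Phi_l(\omega):=\sum_{k}|\widehat{\varphi_l}(\omega+2\pi k)|^2$, $\widehat{\varphi_l^{\bot}}:=\widehat{\varphi_l}\Phi_l^{-1/2}$. Time radius: $\Delta_f^2=\|f\|_{L^2}^{-2}\int(t-t_{0f})^2|f(t)|^2dt$ with $t_{0f}=\|f\|_{L^2}^{-2}\int t|f(t)|^2dt$. *)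

(* Defs.v *)
From Stdlib Require Import Reals.
From Coquelicot Require Import Coquelicot.
Open Scope R_scope.

Definition meyer_hat (theta : R -> R) (w0 : R) (w : R) : R :=
  if Rle_dec (Rabs w) (2 * w0) then 1
  else if Rle_dec (Rabs w) (2 * PI - 2 * w0) then
    cos (PI / 4 + theta (PI / (3 * (PI - 2 * w0)) * (Rabs w - PI)))
  else 0.

(* reduction of w modulo 2*pi into [-pi, pi) *)
Definition red2pi (w : R) : R :=
  w - 2 * PI * IZR (up ((w + PI) / (2 * PI)) - 1).

Definition meyer_mask (theta : R -> R) (w0 : R) (w : R) : R :=
  meyer_hat theta w0 (2 * red2pi w).

Definition meyer_mask_l (theta : R -> R) (w0 : R) (l : nat) (w : R) : R :=
  meyer_mask theta w0 w / (cos (w / 2)) ^ (2 * l).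

Definition four_a (f : R -> R) (k : nat) : R :=
  / PI * RInt (fun x => f x * cos (INR k * x)) (- PI) PI.
Definition four_b (f : R -> R) (k : nat) : R :=
  / PI * RInt (fun x => f x * sin (INR k * x)) (- PI) PI.

Definition lin_sum (lam : nat -> nat -> R) (n : nat) (f : R -> R) (w : R) : R :=
  four_a f 0 / 2 +
  sum_n_m (fun k => lam n k * (four_a f k * cos (INR k * w)
                               + four_b f k * sin (INR k * w))) 1 n.

Definition supC (g : R -> R) : R :=
  real (Lub_Rbar (fun y => exists x, - PI <= x <= PI /\ y = Rabs (g x))).

Section Method.
Variables (theta : R -> R) (w0 : R) (lam : nat -> nat -> R) (nl : nat -> nat).

Definition u_l (l : nat) : R -> R :=
  lin_sum lam (nl l) (meyer_mask_l theta w0 l).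
Definition u1_l (l : nat) : R -> R :=
  lin_sum lam (nl l) (Derive (meyer_mask_l theta w0 l)).

Definition alpha (l : nat) : R := supC (fun w => u_l l w - meyer_mask_l theta w0 l w).
Definition gamma (l : nat) : R :=
  supC (fun w => u1_l l w - Derive (meyer_mask_l theta w0 l) w).

Definition c_inf (l0 : nat) : R :=
  real (Glb_Rbar (fun y => exists l, (l0 <= l)%nat /\ y = Rabs (u_l l 0))).

Definition eps_l (l : nat) : R := alpha l / supC (meyer_mask_l theta w0 l).
Definition mu_l (l : nat) : R := INR l * alpha l + gamma l.

Definition m_l (l : nat) (w : R) : R := (cos (w / 2)) ^ (2 * l) * u_l l w / u_l l 0.

End Method.

Fixpoint part_prod (m : R -> R) (w : R) (N : nat) : R :=
  match N with
  | O => 1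
  | S N' => part_prod m w N' * m (w / 2 ^ N)
  end.

Definition inf_prod (m : R -> R) (w : R) : R := real (Lim_seq (part_prod m w)).

Definition periodization (g : R -> R) (w : R) : R :=
  Series (fun n => match n with
                   | O => (g w) ^ 2
                   | S _ => (g (w + 2 * PI * INR n)) ^ 2 + (g (w - 2 * PI * INR n)) ^ 2
                   end).

Definition orthonormalize (g : R -> R) (w : R) : R := g w / sqrt (periodization g w).

Definition RInt_R (f : R -> R) : R :=
  RInt_gen f (Rbar_locally m_infty) (Rbar_locally p_infty).

(* For a real-valued Fourier transform g, f(t) = (1/2pi) int g(w) e^{itw} dw;
   real and imaginary parts: *)
Definition invFT_re (g : R -> R) (t : R) : R := / (2 * PI) * RInt_R (fun w => g w * cos (t * w)).
Definition invFT_im (g : R -> R) (t : R) : R := / (2 * PI) * RInt_R (fun w => g w * sin (t * w)).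

Definition abs2_invFT (g : R -> R) (t : R) : R := (invFT_re g t) ^ 2 + (invFT_im g t) ^ 2.

(* Delta_f^2 for the function f whose Fourier transform is g *)
Definition time_radius2 (g : R -> R) : R :=
  let N2 := RInt_R (abs2_invFT g) in
  let t0 := / N2 * RInt_R (fun t => t * abs2_invFT g t) in
  / N2 * RInt_R (fun t => (t - t0) ^ 2 * abs2_invFT g t).

Definition C0 (w0 : R) : R := 32 * PI ^ 2 * exp (2 * w0) / 27.
Definition log2 (x : R) : R := ln x / ln 2.

(* Main.v *)
(* The error is in fact O(mu(l)), so the exponential term of the maximum is never needed.

   Write m0 for the Meyer mask and phi0 for its scaling function. Since u_1l is the derivative of u_l, the hypotheses give |m_l - m0| + |m_l' - m0'| <= d with d = O(mu(l)), and moreover |m_l| + |m_l'| = O(d) cos(x/2)^6 wherever cos x <= -1/2, because m0 vanishes there. Near 0 the refinement equation phi_l(w) = m_l(w/2) phi_l(w/2) transports this to phi_l and phi_l'. Far from 0 two steps of the equation are used at once: m_l(x) m_l(2x) is at most 256 cos(x/2)^6 cos(x)^6, since of x and 2x one lies in the gap of the mask unless cos x >= 1/2. This is the factor by which sin(w/2)^6 / w^2 grows from w to 4w, so phi_l and phi_l' are O(d / w^2) off the support of phi0. Hence phi_l - phi0 and its derivative are O(d / (1 + w^2)), and orthonormalization preserves this because the periodization of phi0^2 is 1.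

   Finally t^2 |f|^2 is the squared modulus of the transform of g', so the two radii are compared through |a^2 - b^2| <= (|a - b|^2 / d + d |a + b|^2) / 2 and the bound of the integral of |f|^2 by a multiple of c^2 when |g| <= c / (1 + w^2); an inequality is enough here, Plancherel's identity is not needed. *)
Require Import Defs.
From Stdlib Require Import Reals Lra Lia ZArith FunctionalExtensionality.
From Coquelicot Require Import Coquelicot.
Open Scope R_scope.

(** * Improper integrals over the real line *)

(** Closeness of m_l to m0 in C^1 says nothing by itself about the tail of the infinite product:
    each factor is bounded only by 1 + d, and about log2 |w| of them could make the product grow.
    The decay has to come from the zero of order 2l at pi. Only six of its orders are kept, so that
    the constants do not depend on l; l >= 4 lets six survive the differentiation of cos(x/2)^(2l),
    which also costs the factor l in mu(l). One refinement step does not allow the comparison with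
    sin(w/2)^6 / w^2: at cos x = -1/2 it would ask for |m| <= 1/4, which the mask can exceed nearby.
    That u_1l is the derivative of u_l rests on the vanishing of m^M_l at pi: integration by parts
    has no boundary terms there, and a multiplier method commutes with differentiation. On the time
    side an L^2 bound is needed without an inversion formula. It comes from duality, with kernels
    whose L^1 norm is bounded uniformly in the length of the time interval. *)

Definition cont (f : R -> R) : Prop := forall x, continuous f x.

Lemma cont_const c : cont (fun _ => c).
Proof. intro x; apply continuous_const. Qed.
Lemma cont_id : cont (fun x => x).
Proof. intro x; apply continuous_id. Qed.
Lemma cont_plus f g : cont f -> cont g -> cont (fun x => f x + g x).
Proof. intros Hf Hg x; apply (continuous_plus f g); auto. Qed.
Lemma cont_opp f : cont f -> cont (fun x => - f x).
Proof. intros Hf x; apply (continuous_opp f); auto. Qed.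
Lemma cont_minus f g : cont f -> cont g -> cont (fun x => f x - g x).
Proof. intros Hf Hg x; apply (continuous_minus f g); auto. Qed.
Lemma cont_mult f g : cont f -> cont g -> cont (fun x => f x * g x).
Proof. intros Hf Hg x; apply (continuous_mult f g); auto. Qed.
Lemma cont_comp f g : cont f -> cont g -> cont (fun x => f (g x)).
Proof. intros Hf Hg x; apply (continuous_comp g f); auto. Qed.
Lemma cont_abs f : cont f -> cont (fun x => Rabs (f x)).
Proof. intros Hf x; apply (continuous_comp f Rabs); auto using continuous_Rabs. Qed.
Lemma cont_cos : cont cos.
Proof. intro x; apply continuous_cos. Qed.
Lemma cont_sin : cont sin.
Proof. intro x; apply continuous_sin. Qed.
Lemma cont_cosc f : cont f -> cont (fun x => cos (f x)).
Proof. intros; apply cont_comp; auto using cont_cos. Qed.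
Lemma cont_sinc f : cont f -> cont (fun x => sin (f x)).
Proof. intros; apply cont_comp; auto using cont_sin. Qed.
Lemma cont_pow f n : cont f -> cont (fun x => f x ^ n).
Proof. intro Hf; induction n; simpl; [apply cont_const | apply cont_mult; auto]. Qed.
Lemma cont_div_const f c : cont f -> cont (fun x => f x / c).
Proof. intro Hf; apply cont_mult; auto using cont_const. Qed.
Lemma cont_inv f : cont f -> (forall x, f x <> 0) -> cont (fun x => / f x).
Proof.
  intros Hf H0 x.
  apply continuity_pt_filterlim; apply continuity_pt_inv; auto.
  apply continuity_pt_filterlim, Hf.
Qed.
Lemma is_derive_cont (f df : R -> R) : (forall x, is_derive f x (df x)) -> cont f.
Proof. intros H x; apply (ex_derive_continuous f); exists (df x); apply H. Qed.

#[global] Hint Resolve cont_const cont_id cont_plus cont_opp cont_minus cont_mult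
  cont_abs cont_cosc cont_sinc cont_pow cont_div_const : cont.

Lemma cont_ex_RInt (f : R -> R) a b : cont f -> ex_RInt f a b.
Proof. intro H; apply (ex_RInt_continuous (V := R_CompleteNormedModule)); auto. Qed.
#[global] Hint Resolve cont_ex_RInt : cont.

Lemma RInt_add (f g : R -> R) a b : cont f -> cont g ->
  RInt (fun x => f x + g x) a b = RInt f a b + RInt g a b.
Proof. intros; apply (RInt_plus f g); auto with cont. Qed.
Lemma RInt_sub (f g : R -> R) a b : cont f -> cont g ->
  RInt (fun x => f x - g x) a b = RInt f a b - RInt g a b.
Proof. intros; apply (RInt_minus f g); auto with cont. Qed.
Lemma RInt_mull c (f : R -> R) a b : cont f -> RInt (fun x => c * f x) a b = c * RInt f a b.
Proof. intros; apply (RInt_scal f); auto with cont. Qed.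
Lemma RInt_split (f : R -> R) a b c : cont f -> RInt f a b + RInt f b c = RInt f a c.
Proof. intros; apply (RInt_Chasles f); auto with cont. Qed.
Lemma RInt_nonneg (f : R -> R) a b : cont f -> a <= b -> (forall x, 0 <= f x) -> 0 <= RInt f a b.
Proof. intros; apply RInt_ge_0; auto with cont. Qed.
Lemma RInt_mono (f g : R -> R) a b : cont f -> cont g -> a <= b -> (forall x, f x <= g x) ->
  RInt f a b <= RInt g a b.
Proof. intros; apply RInt_le; auto with cont. Qed.
Lemma RInt_abs_mono (f g : R -> R) a b : cont f -> cont g -> a <= b ->
  (forall x, Rabs (f x) <= g x) -> Rabs (RInt f a b) <= RInt g a b.
Proof.
  intros Hf Hg ab H.
  apply Rle_trans with (RInt (fun x => Rabs (f x)) a b).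
  - apply abs_RInt_le; auto with cont.
  - apply RInt_mono; auto with cont.
Qed.
Lemma RInt_FTC (f df : R -> R) a b : (forall x, is_derive f x (df x)) -> cont df ->
  RInt df a b = f b - f a.
Proof.
  intros H Hc; apply is_RInt_unique, (is_RInt_derive f df); auto.
Qed.
Lemma RInt_eq (f g : R -> R) a b : (forall x, f x = g x) -> RInt f a b = RInt g a b.
Proof. intros; apply RInt_ext; auto. Qed.

Definition is_RInt_R (f : R -> R) (l : R) : Prop :=
  is_RInt_gen (V := R_NormedModule) f (Rbar_locally m_infty) (Rbar_locally p_infty) l.

Lemma is_RInt_R_eps f l : cont f ->
  (is_RInt_R f l <-> forall eps, 0 < eps -> exists M, forall a b, a < - M -> M < b ->
     Rabs (RInt f a b - l) < eps).
Proof.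
  intro Hf; split.
  - intros H eps He.
    destruct (H (fun y : R => Rabs (y - l) < eps)) as [Q P [MQ HQ] [MP HP] HH].
    { exists (mkposreal eps He); intros y Hy; exact Hy. }
    exists (Rmax (- MQ) MP); intros a b Ha Hb.
    destruct (HH a b) as [y [Hy1 Hy2]].
    + apply HQ. pose proof (Rmax_l (- MQ) MP); lra.
    + apply HP. pose proof (Rmax_r (- MQ) MP); lra.
    + simpl in Hy1. now rewrite (is_RInt_unique _ _ _ _ Hy1).
  - intros H P HP.
    change (@locally R_UniformSpace l P) in HP; destruct HP as [e He].
    destruct (H e (cond_pos e)) as [M HM].
    apply Filter_prod with (fun a => a < - M) (fun b => M < b).
    + now exists (- M).
    + now exists M.
    + intros a b Ha Hb; exists (RInt f a b); split.
      * simpl; apply (RInt_correct f); auto with cont.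
      * apply He, HM; auto.
Qed.

Lemma is_RInt_R_unique f l : is_RInt_R f l -> RInt_R f = l.
Proof. intro H; apply (is_RInt_gen_unique (V := R_CompleteNormedModule) f l H). Qed.

Lemma is_RInt_R_lim f l : cont f -> is_RInt_R f l ->
  is_lim_seq (fun n => RInt f (- INR n) (INR n)) l.
Proof.
  intros Hf H; apply is_lim_seq_spec; intros eps.
  destruct (proj1 (is_RInt_R_eps f l Hf) H eps (cond_pos eps)) as [M HM].
  destruct (nfloor_ex (Rmax 0 M)) as [n [_ Hn]]; [apply Rmax_l|].
  exists (S n); intros k Hk; apply le_INR in Hk; rewrite S_INR in Hk.
  pose proof (Rmax_r 0 M). apply HM; lra.
Qed.

Lemma is_RInt_R_le f l C : cont f -> is_RInt_R f l ->
  (forall n, RInt f (- INR n) (INR n) <= C) -> l <= C.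
Proof.
  intros Hf H HC.
  apply (is_lim_seq_le _ _ (Finite l) (Finite C) HC (is_RInt_R_lim f l Hf H)).
  apply is_lim_seq_const.
Qed.

Lemma is_RInt_R_ge f l n : cont f -> (forall x, 0 <= f x) -> is_RInt_R f l ->
  RInt f (- INR n) (INR n) <= l.
Proof.
  intros Hf H0 H.
  apply (is_lim_seq_le_loc (fun _ => RInt f (- INR n) (INR n))
     (fun k => RInt f (- INR k) (INR k)) (RInt f (- INR n) (INR n)) l).
  - exists n; intros k Hk; apply le_INR in Hk. pose proof (pos_INR n).
    rewrite <- (RInt_split f (- INR k) (- INR n) (INR k)), <- (RInt_split f (- INR n) (INR n) (INR k)) by auto.
    assert (0 <= RInt f (- INR k) (- INR n)) by (apply RInt_nonneg; auto; lra).
    assert (0 <= RInt f (INR n) (INR k)) by (apply RInt_nonneg; auto; lra).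
    lra.
  - apply is_lim_seq_const.
  - now apply is_RInt_R_lim.
Qed.

(** The limit is the supremum over n of the integrals over [-n, n]. By positivity every large
    interval lies between two such symmetric ones, so its endpoints may tend to infinity
    independently. *)
Lemma is_RInt_R_nonneg_bounded f C : cont f -> (forall x, 0 <= f x) ->
  (forall n, RInt f (- INR n) (INR n) <= C) -> exists l, is_RInt_R f l.
Proof.
  intros Hf H0 HC.
  assert (mono : forall a b a' b', a' <= a -> a <= b -> b <= b' -> RInt f a b <= RInt f a' b').
  { intros a b a' b' H1 H2 H3.
    rewrite <- (RInt_split f a' a b'), <- (RInt_split f a b b') by auto.
    assert (0 <= RInt f a' a) by (apply RInt_nonneg; auto; lra).
    assert (0 <= RInt f b b') by (apply RInt_nonneg; auto; lra). lra. }
  destruct (completeness (fun y => exists n, y = RInt f (- INR n) (INR n))) as [l [Hl1 Hl2]].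
  - exists C; intros y [n ->]; auto.
  - exists (RInt f (- INR 0) (INR 0)); now exists 0%nat.
  - exists l; apply is_RInt_R_eps; auto; intros eps He.
    destruct (Classical_Prop.classic (exists n, l - eps < RInt f (- INR n) (INR n))) as [[n Hn]|Hn].
    + exists (INR n); intros a b Ha Hb. pose proof (pos_INR n).
      assert (RInt f (- INR n) (INR n) <= RInt f a b) by (apply mono; lra).
      destruct (nfloor_ex (Rmax (- a) b)) as [k [_ Hk]].
      { pose proof (Rmax_r (- a) b); lra. }
      assert (RInt f a b <= RInt f (- INR (S k)) (INR (S k))).
      { rewrite S_INR. pose proof (Rmax_l (- a) b). pose proof (Rmax_r (- a) b). apply mono; lra. }
      assert (RInt f (- INR (S k)) (INR (S k)) <= l) by (apply Hl1; eauto).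
      apply Rabs_def1; lra.
    + exfalso. assert (l <= l - eps); [|lra].
      apply Hl2; intros y [n ->]. apply Rnot_lt_le; intro; apply Hn; eauto.
Qed.

Lemma is_RInt_R_plus f g lf lg : is_RInt_R f lf -> is_RInt_R g lg ->
  is_RInt_R (fun x => f x + g x) (lf + lg).
Proof. intros; apply (is_RInt_gen_plus f g); auto. Qed.
Lemma is_RInt_R_scal f k lf : is_RInt_R f lf -> is_RInt_R (fun x => k * f x) (k * lf).
Proof. intros; apply (is_RInt_gen_scal f k); auto. Qed.
Lemma is_RInt_R_minus f g lf lg : is_RInt_R f lf -> is_RInt_R g lg ->
  is_RInt_R (fun x => f x - g x) (lf - lg).
Proof. intros; apply (is_RInt_gen_minus f g); auto. Qed.
Lemma is_RInt_R_ext f g l : (forall x, f x = g x) -> is_RInt_R f l -> is_RInt_R g l.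
Proof.
  intros H; apply (is_RInt_gen_ext (V := R_NormedModule) f g).
  apply Filter_prod with (fun _ => True) (fun _ => True); auto; exists 0; auto.
Qed.

(** f is the difference of f + g and g, both non-negative with bounded integrals, so the monotone
    case applies to each. *)
Lemma is_RInt_R_dominated f g C : cont f -> cont g -> (forall x, Rabs (f x) <= g x) ->
  (forall n, RInt g (- INR n) (INR n) <= C) ->
  is_RInt_R f (RInt_R f) /\ Rabs (RInt_R f) <= C.
Proof.
  intros Hf Hg H HC.
  assert (Hfg : forall x, 0 <= f x + g x <= 2 * g x).
  { intro x. specialize (H x). apply Rabs_le_between in H. lra. }
  assert (Hn : forall n, - INR n <= INR n) by (intro n; pose proof (pos_INR n); lra).
  destruct (is_RInt_R_nonneg_bounded g C) as [lg Hlg]; auto.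
  { intro x; specialize (H x); pose proof (Rabs_pos (f x)); lra. }
  destruct (is_RInt_R_nonneg_bounded (fun x => f x + g x) (2 * C)) as [l Hl]; auto with cont.
  { intro x; apply Hfg. }
  { intro n. apply Rle_trans with (RInt (fun x => 2 * g x) (- INR n) (INR n)).
    - apply RInt_mono; auto with cont. intro; apply Hfg.
    - rewrite RInt_mull by auto. specialize (HC n); lra. }
  assert (E : is_RInt_R f (l - lg)).
  { apply is_RInt_R_ext with (fun x => (f x + g x) - g x); [intro; ring|].
    now apply is_RInt_R_minus. }
  rewrite (is_RInt_R_unique _ _ E); split; auto.
  apply Rabs_le_between; split.
  - cut (- (l - lg) <= C); [lra|].
    apply (is_RInt_R_le (fun x => (-1) * f x)); auto with cont.
    { replace (- (l - lg)) with ((-1) * (l - lg)) by ring. now apply is_RInt_R_scal. }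
    intro n; apply Rle_trans with (2 := HC n). apply RInt_mono; auto with cont.
    intro x; specialize (Hfg x); lra.
  - apply (is_RInt_R_le f); auto.
    intro n; apply Rle_trans with (2 := HC n). apply RInt_mono; auto with cont.
    intro x; specialize (H x); apply Rabs_le_between in H; lra.
Qed.

(** The weight has the explicit primitive [atan] and total integral pi, and it is at most 1, so the
    class is stable under products. *)
Definition decays (c : R) (h : R -> R) : Prop := forall x, Rabs (h x) <= c * / (1 + x ^ 2).

Lemma one_plus_sqr_pos x : 0 < 1 + x ^ 2.
Proof. pose proof (pow2_ge_0 x); lra. Qed.
Lemma inv_one_plus_sqr x : 0 < / (1 + x ^ 2) <= 1.
Proof.
  pose proof (pow2_ge_0 x). split; [apply Rinv_0_lt_compat; lra|].
  rewrite <- Rinv_1; apply Rinv_le_contravar; lra.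
Qed.
Lemma cont_inv_one_plus_sqr : cont (fun x => / (1 + x ^ 2)).
Proof.
  apply cont_inv; auto with cont. intro x; pose proof (one_plus_sqr_pos x); lra.
Qed.
#[global] Hint Resolve cont_inv_one_plus_sqr : cont.

Lemma RInt_inv_one_plus_sqr a b : RInt (fun x => / (1 + x ^ 2)) a b = atan b - atan a.
Proof.
  apply RInt_FTC; auto with cont. intro x.
  apply is_derive_Reals, derivable_pt_lim_atan.
Qed.

Lemma RInt_inv_one_plus_sqr_le a b : RInt (fun x => / (1 + x ^ 2)) a b <= PI.
Proof.
  rewrite RInt_inv_one_plus_sqr. pose proof (atan_bound a); pose proof (atan_bound b); lra.
Qed.

Lemma decays_nonneg c h : decays c h -> 0 <= c.
Proof.
  intro H; specialize (H 0). pose proof (Rabs_pos (h 0)).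
  replace (1 + 0 ^ 2) with 1 in H by ring. lra.
Qed.

Lemma decays_le c c' h : c <= c' -> decays c h -> decays c' h.
Proof.
  intros Hc H x. apply Rle_trans with (1 := H x).
  apply Rmult_le_compat_r; auto. apply Rlt_le, inv_one_plus_sqr.
Qed.

Lemma decays_bound c h x : decays c h -> Rabs (h x) <= c.
Proof.
  intro H. pose proof (decays_nonneg _ _ H). apply Rle_trans with (1 := H x).
  pose proof (inv_one_plus_sqr x). nra.
Qed.

Lemma decays_plus a b f g : decays a f -> decays b g -> decays (a + b) (fun x => f x + g x).
Proof.
  intros Hf Hg x. apply Rle_trans with (1 := Rabs_triang _ _).
  specialize (Hf x); specialize (Hg x). lra.
Qed.
Lemma decays_mult_bounded c B h e : decays c h -> (forall x, Rabs (e x) <= B) ->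
  decays (c * B) (fun x => h x * e x).
Proof.
  intros Hh He x. rewrite Rabs_mult.
  replace (c * B * / (1 + x ^ 2)) with ((c * / (1 + x ^ 2)) * B) by ring.
  apply Rmult_le_compat; auto using Rabs_pos.
Qed.

Lemma decays_RInt_R c h : cont h -> decays c h ->
  is_RInt_R h (RInt_R h) /\ Rabs (RInt_R h) <= c * PI.
Proof.
  intros Hh Hd. apply (is_RInt_R_dominated h (fun x => c * / (1 + x ^ 2))); auto with cont.
  intro n; rewrite RInt_mull by auto with cont.
  apply Rmult_le_compat_l; [now apply decays_nonneg with h|].
  apply RInt_inv_one_plus_sqr_le.
Qed.

(** * A Bessel inequality for the Fourier transform *)

Definition cont2 (f : R -> R -> R) : Prop := forall x y, continuity_2d_pt f x y.

Lemma cont2_l f y : cont2 f -> cont (fun x => f x y).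
Proof.
  intros H x. apply filterlim_locally; intros eps.
  destruct (H x y eps) as [d Hd]. exists d; intros z Hz.
  apply Hd; [exact Hz|]. rewrite Rminus_eq_0, Rabs_R0; apply cond_pos.
Qed.
Lemma cont2_r f x : cont2 f -> cont (fun y => f x y).
Proof.
  intros H y. apply filterlim_locally; intros eps.
  destruct (H x y eps) as [d Hd]. exists d; intros z Hz.
  apply Hd; [|exact Hz]. rewrite Rminus_eq_0, Rabs_R0; apply cond_pos.
Qed.
Lemma cont2_swap f : cont2 f -> cont2 (fun x y => f y x).
Proof.
  intros H x y eps. destruct (H y x eps) as [d Hd]. exists d; intros u v Hu Hv; now apply Hd.
Qed.
Lemma cont2_mult f g : cont2 f -> cont2 g -> cont2 (fun x y => f x y * g x y).
Proof. intros Hf Hg x y; apply continuity_2d_pt_mult; auto. Qed.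
Lemma cont2_comp f g : cont f -> cont2 g -> cont2 (fun x y => f (g x y)).
Proof.
  intros Hf Hg x y; apply continuity_1d_2d_pt_comp; auto.
  apply continuity_pt_filterlim, Hf.
Qed.
Lemma cont2_fst f : cont f -> cont2 (fun x _ => f x).
Proof. intro; apply cont2_comp; auto. intros x y; apply continuity_2d_pt_id1. Qed.
Lemma cont2_snd f : cont f -> cont2 (fun _ y => f y).
Proof. intro; apply cont2_comp; auto. intros x y; apply continuity_2d_pt_id2. Qed.
Lemma cont2_prod : cont2 Rmult.
Proof. apply (cont2_mult (fun x _ => x) (fun _ y => y)); [apply cont2_fst|apply cont2_snd]; auto with cont. Qed.

#[global] Hint Resolve cont2_mult cont2_fst cont2_snd cont2_prod : cont.

Lemma cont_RInt_param f c d : cont2 f -> cont (fun x => RInt (f x) c d).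
Proof.
  intro Hf.
  assert (key : forall a b, a <= b -> cont (fun x => RInt (f x) a b)).
  { intros a b ab x. apply filterlim_locally; intros eps.
    assert (Hb : 0 < b - a + 1) by lra.
    assert (He : 0 < eps / (b - a + 1)) by (apply Rdiv_lt_0_compat; [apply cond_pos|lra]).
    destruct (uniform_continuity_2d_1d' f a b x (fun t _ => Hf x t) (mkposreal _ He)) as [dl Hd].
    exists dl; intros z Hz. change (Rabs (z - x) < dl) in Hz.
    change (Rabs (RInt (f z) a b - RInt (f x) a b) < eps).
    rewrite <- (RInt_sub (f z) (f x)) by (apply (cont2_r f); auto).
    apply Rle_lt_trans with ((b - a) * (eps / (b - a + 1))).
    - apply abs_RInt_le_const; auto.
      + apply cont_ex_RInt, cont_minus; apply (cont2_r f); auto.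
      + intros t Ht. apply Rlt_le. apply (Hd t x t z); auto; try lra.
        * destruct dl; simpl in *; lra.
        * apply Rabs_def2 in Hz; lra.
        * rewrite Rminus_eq_0, Rabs_R0; apply cond_pos.
    - pose proof (cond_pos eps). apply Rlt_le_trans with ((b - a + 1) * (eps / (b - a + 1))); [nra|].
      right; field; lra. }
  destruct (Rle_dec c d) as [H|H]; [now apply key|].
  assert (E : forall x, continuous (fun x => - RInt (f x) d c) x).
  { intro x; apply (cont_opp (fun x => RInt (f x) d c)), key; lra. }
  intro x; apply continuous_ext with (2 := E x).
  intro y; apply (opp_RInt_swap (f y)), cont_ex_RInt, cont2_r; auto.
Qed.

Lemma is_derive_RInt_upper (f : R -> R) a x : cont f -> is_derive (fun x => RInt f a x) x (f x).
Proof.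
  intro Hf. apply (is_derive_RInt f (RInt f a) a x); [|apply Hf].
  apply filter_forall; intro y. apply (RInt_correct f); auto with cont.
Qed.

(** As functions of the upper limit b both sides have the same derivative, by differentiation under
    the integral sign on the right, and both vanish at b = a. *)
Lemma RInt_Fubini f a b c d : cont2 f -> a <= b ->
  RInt (fun x => RInt (fun y => f x y) c d) a b = RInt (fun y => RInt (fun x => f x y) a b) c d.
Proof.
  intros Hf ab.
  set (F := fun z => RInt (fun x => RInt (fun y => f x y) c d) a z
                     - RInt (fun y => RInt (fun x => f x y) a z) c d).
  assert (DF : forall z, is_derive F z 0).
  { intro z. unfold F.
    replace 0 with (RInt (fun y => f z y) c d - RInt (fun y => f z y) c d) by ring.
    apply (is_derive_minus (V := R_NormedModule)).
    - apply (is_derive_RInt_upper (fun x => RInt (fun y => f x y) c d)).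
      apply cont_RInt_param; auto.
    - assert (D : forall u y, is_derive (fun z => RInt (fun x => f x y) a z) u (f u y)).
      { intros u y; apply (is_derive_RInt_upper (fun x => f x y)). apply cont2_l; auto. }
      replace (RInt (fun y => f z y) c d)
        with (RInt (fun y => Derive (fun z => RInt (fun x => f x y) a z) z) c d).
      2:{ apply RInt_ext; intros y _. apply is_derive_unique, D. }
      apply (is_derive_RInt_param (fun z y => RInt (fun x => f x y) a z)).
      + apply filter_forall; intros u t _; eexists; apply D.
      + intros t _. apply continuity_2d_pt_ext with f; auto.
        intros u v; symmetry; apply is_derive_unique, D.
      + apply filter_forall; intro u. apply cont_ex_RInt.
        apply (cont_RInt_param (fun y x => f x y)), cont2_swap, Hf. }
  destruct ab as [ab| ->].
  - assert (E : F a = F b) by (apply (eq_is_derive F a b); auto).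
    unfold F in E. rewrite (RInt_point a (fun x => RInt (fun y => f x y) c d)) in E.
    rewrite (RInt_eq (fun y => RInt (fun x => f x y) a a) (fun _ => 0)) in E.
    2:{ intro y; apply (RInt_point a (fun x => f x y)). }
    rewrite RInt_const in E. unfold zero, scal in E; simpl in E; unfold mult in E; simpl in E. lra.
  - rewrite (RInt_point b (fun x => RInt (fun y => f x y) c d)).
    rewrite (RInt_eq (fun y => RInt (fun x => f x y) b b) (fun _ => 0)).
    2:{ intro y; apply (RInt_point b (fun x => f x y)). }
    rewrite RInt_const. unfold zero, scal; simpl; unfold mult; simpl; ring.
Qed.

(** The continuous Fejér kernel (1 - cos(A s)) / (A s^2). A sharp cutoff in t would give sin(A s) /
    s, which is not absolutely integrable. *)
Definition fejer_kernel (A s : R) : R := RInt (fun t => (1 - t / A) * cos (t * s)) 0 A.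

Lemma cont_fejer A : cont (fejer_kernel A).
Proof.
  unfold fejer_kernel. apply (cont_RInt_param (fun s t => (1 - t / A) * cos (t * s))).
  apply (cont2_mult (fun _ t => 1 - t / A) (fun s t => cos (t * s))).
  - apply (cont2_snd (fun t => 1 - t / A)); auto with cont.
  - apply cont2_comp; auto using cont_cos. apply (cont2_swap Rmult); auto with cont.
Qed.

Lemma fejer_kernel_bound A s : 0 < A -> Rabs (fejer_kernel A s) <= A * / (1 + (A * s / 2) ^ 2).
Proof.
  intro HA.
  assert (E : s ^ 2 * A * fejer_kernel A s = 1 - cos (A * s)).
  { unfold fejer_kernel. rewrite <- RInt_mull by auto 10 with cont.
    rewrite (RInt_FTC (fun t => (A - t) * (s * sin (t * s)) - cos (t * s))).
    - rewrite Rmult_0_l, cos_0, sin_0. ring.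
    - intro t. auto_derive; auto. field; lra.
    - auto 10 with cont. }
  assert (B : Rabs (fejer_kernel A s) <= A / 2).
  { unfold fejer_kernel.
    apply Rle_trans with (RInt (fun t => Rabs ((1 - t / A) * cos (t * s))) 0 A).
    - apply abs_RInt_le; [lra|]. auto 10 with cont.
    - apply Rle_trans with (RInt (fun t => 1 - t / A) 0 A).
      + apply RInt_le; [lra| | |]; auto 10 with cont.
        intros t Ht. assert (0 <= 1 - t / A).
        { assert (t / A <= 1); [|lra]. apply Rmult_le_reg_r with A; [lra|]. unfold Rdiv. rewrite Rmult_assoc, Rinv_l; lra. }
        rewrite Rabs_mult, (Rabs_pos_eq (1 - t / A)) by auto.
        assert (Rabs (cos (t * s)) <= 1) by (apply Rabs_le, COS_bound). nra.
      + rewrite (RInt_FTC (fun t => t - t ^ 2 / (2 * A))).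
        * right; field; lra.
        * intro t; auto_derive; auto. field; lra.
        * auto 10 with cont. }
  assert (B2 : s ^ 2 * A * Rabs (fejer_kernel A s) <= 2).
  { rewrite <- (Rabs_pos_eq (s ^ 2 * A)), <- Rabs_mult, E.
    - apply Rabs_le. pose proof (COS_bound (A * s)); lra.
    - pose proof (pow2_ge_0 s); nra. }
  pose proof (one_plus_sqr_pos (A * s / 2)).
  apply Rmult_le_reg_r with (1 + (A * s / 2) ^ 2); auto.
  rewrite Rmult_assoc, Rinv_l, Rmult_1_r by lra.
  (* The bound near 0 and the bound at infinity contribute A / 2 each. *)
  replace (Rabs (fejer_kernel A s) * (1 + (A * s / 2) ^ 2))
    with (Rabs (fejer_kernel A s) + A / 4 * (s ^ 2 * A * Rabs (fejer_kernel A s))) by field.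
  nra.
Qed.

Lemma RInt_fejer_kernel_le A w a b : 0 < A ->
  RInt (fun v => A * / (1 + (A * (v - w) / 2) ^ 2)) a b <= 2 * PI.
Proof.
  intro HA. rewrite (RInt_FTC (fun v => 2 * atan (A * (v - w) / 2))).
  - pose proof (atan_bound (A * (b - w) / 2)); pose proof (atan_bound (A * (a - w) / 2)); lra.
  - intro v. auto_derive; auto. field. pose proof (one_plus_sqr_pos (A * (v - w) / 2)).
    intro K. unfold Rdiv in *. nra.
  - apply cont_mult; auto with cont.
    apply (cont_comp (fun x => / (1 + x ^ 2)) (fun v => A * (v - w) / 2)); auto with cont.
Qed.

(** The integral of 1 / (1 + x^2) over [n, oo). *)
Definition tail (n : nat) : R := PI / 2 - atan (INR n).

Lemma tail_pos n : 0 < tail n.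
Proof. unfold tail; pose proof (atan_bound (INR n)); lra. Qed.

Lemma tail_lim : is_lim_seq tail 0.
Proof.
  apply is_lim_seq_incr_1.
  apply is_lim_seq_ext with (fun n => atan (/ INR (S n))).
  { intro n; unfold tail; apply atan_inv, lt_0_INR; lia. }
  rewrite <- atan_0. apply (is_lim_seq_continuous atan (fun n => / INR (S n)) 0).
  - apply derivable_continuous_pt; eexists; apply derivable_pt_lim_atan.
  - apply (is_lim_seq_incr_1 (fun n => / INR n)).
    replace (Finite 0) with (Rbar_inv p_infty) by reflexivity.
    apply is_lim_seq_inv; [apply is_lim_seq_INR | discriminate].
Qed.

Lemma decays_tail h c n : cont h -> decays c h ->
  Rabs (RInt_R h - RInt h (- INR n) (INR n)) <= 2 * c * tail n.
Proof.
  intros Hh Hd. destruct (decays_RInt_R c h Hh Hd) as [Hi _].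
  pose proof (is_RInt_R_lim h _ Hh Hi) as L.
  set (q := RInt h (- INR n) (INR n)).
  assert (L2 : is_lim_seq (fun m => Rabs (RInt h (- INR m) (INR m) - q)) (Rabs (RInt_R h - q))).
  { apply (is_lim_seq_abs _ (Finite (RInt_R h - q))).
    apply is_lim_seq_minus'; auto. apply is_lim_seq_const. }
  apply (is_lim_seq_le_loc _ (fun _ => 2 * c * tail n) (Rabs (RInt_R h - q)) (2 * c * tail n)) in L2; auto.
  2: apply is_lim_seq_const.
  exists n; intros m Hm. apply le_INR in Hm. pose proof (pos_INR n).
  unfold q. rewrite <- (RInt_split h (- INR m) (- INR n) (INR m)), <- (RInt_split h (- INR n) (INR n) (INR m)) by auto.
  replace (RInt h (- INR m) (- INR n) + (RInt h (- INR n) (INR n) + RInt h (INR n) (INR m)) - RInt h (- INR n) (INR n))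
    with (RInt h (- INR m) (- INR n) + RInt h (INR n) (INR m)) by ring.
  apply Rle_trans with (1 := Rabs_triang _ _).
  assert (B : forall a b, a <= b -> Rabs (RInt h a b) <= c * (atan b - atan a)).
  { intros a b ab. rewrite <- RInt_inv_one_plus_sqr, <- RInt_mull by auto with cont.
    apply RInt_abs_mono; auto with cont. }
  assert (B1 := B (- INR m) (- INR n) ltac:(lra)). assert (B2 := B (INR n) (INR m) Hm).
  rewrite !atan_opp in B1. pose proof (decays_nonneg _ _ Hd). unfold tail.
  pose proof (atan_bound (INR m)). nra.
Qed.

Lemma cont_uniform_limit (Fn : nat -> R -> R) (F : R -> R) (e : nat -> R) :
  (forall n, cont (Fn n)) -> (forall n x, Rabs (F x - Fn n x) <= e n) -> is_lim_seq e 0 -> cont F.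
Proof.
  intros Hc Hu He x. apply filterlim_locally; intros eps.
  apply is_lim_seq_spec in He. destruct (He (mkposreal (eps / 3) ltac:(pose proof (cond_pos eps); lra))) as [n Hn].
  specialize (Hn n (le_n n)); simpl in Hn. rewrite Rminus_0_r in Hn.
  assert (Hn' := Rle_lt_trans _ _ _ (Rle_abs _) Hn).
  assert (Hx := Hc n x). apply (proj1 (filterlim_locally _ _)) with (eps := mkposreal (eps / 3) ltac:(pose proof (cond_pos eps); lra)) in Hx.
  destruct Hx as [d Hd]. exists d; intros y Hy. specialize (Hd y Hy).
  change (Rabs (Fn n y - Fn n x) < eps / 3) in Hd. change (Rabs (F y - F x) < eps).
  replace (F y - F x) with ((F y - Fn n y) + (Fn n y - Fn n x) - (F x - Fn n x)) by ring.
  apply Rle_lt_trans with (1 := Rabs_triang _ _). rewrite Rabs_Ropp.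
  assert (Z := Rabs_triang (F y - Fn n y) (Fn n y - Fn n x)).
  pose proof (Hu n y); pose proof (Hu n x). lra.
Qed.

(** * Square-integrability of cosine and sine transforms *)

Section Bessel.
Variables (C : R -> R) (sg : R).
(* C is cos with sg = 1 or sin with sg = -1. *)
Hypothesis C_cont : cont C.
Hypothesis C_bound : forall x, Rabs (C x) <= 1.
Hypothesis sg_bound : Rabs sg <= 1.
Hypothesis C_mult : forall x y, C x * C y = (cos (x - y) + sg * cos (x + y)) / 2.

Let ck : forall w, cont (fun t => C (t * w)).
Proof. intro; apply cont_comp; auto with cont. Qed.
Let ck' : forall t, cont (fun w => C (t * w)).
Proof. intro; apply cont_comp; auto with cont. Qed.
Let ck2 : cont2 (fun t w => C (t * w)).
Proof. apply cont2_comp; auto with cont. Qed.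

Lemma cont_finite_transform h a b : cont h -> cont (fun t => RInt (fun w => h w * C (t * w)) a b).
Proof.
  intro Hh. apply (cont_RInt_param (fun t w => h w * C (t * w))).
  apply (cont2_mult (fun _ w => h w)); auto. now apply (cont2_snd h).
Qed.

(* The weight 1 - t / (2T) is at least 1/2 on [0, T], and the L^1 norm of its kernel does not depend on T. *)
Lemma finite_bessel h c a b T : cont h -> decays c h -> a <= b -> 0 < T ->
  RInt (fun t => (RInt (fun w => h w * C (t * w)) a b) ^ 2) 0 T <= 4 * PI ^ 2 * c ^ 2.
Proof.
  intros Hh Hd ab HT. set (A := 2 * T). assert (HA : 0 < A) by (unfold A; lra).
  pose proof (decays_nonneg _ _ Hd) as Hc.
  set (F := fun t => RInt (fun w => h w * C (t * w)) a b).
  assert (cF : cont F) by now apply cont_finite_transform.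
  set (om := fun t => 1 - t / A).
  assert (com : cont om) by (unfold om; auto with cont).
  (* Duality: by Fubini the weighted integral of F^2 equals the integral of h * J, so a uniform
     bound on J suffices. *)
  set (J := fun w => RInt (fun t => om t * C (t * w) * F t) 0 A).
  assert (cJ : cont J).
  { apply (cont_RInt_param (fun w t => om t * C (t * w) * F t)).
    apply (cont2_swap (fun t w => om t * C (t * w) * F t)). apply cont2_mult; [apply cont2_mult|].
    - now apply (cont2_fst om). - apply ck2. - now apply (cont2_fst F). }
  assert (BJ : forall w, Rabs (J w) <= 2 * PI * c).
  { intro w.
    (* The product formula for C turns the kernel of J into a mean of Fejér kernels at v - w and v +
       w; the latter is written [v - - w] so that both are translates. Each integrates to at most 2
       pi, whence |J| <= 2 pi c. *)
    set (k := fun v => c / 2 * (A * / (1 + (A * (v - w) / 2) ^ 2) + A * / (1 + (A * (v - - w) / 2) ^ 2))).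
    assert (ckk : forall u, cont (fun v => A * / (1 + (A * (v - u) / 2) ^ 2))).
    { intro u. apply cont_mult; auto with cont.
      apply (cont_comp (fun x => / (1 + x ^ 2)) (fun v => A * (v - u) / 2)); auto with cont. }
    assert (EJ : J w = RInt (fun v => h v * ((fejer_kernel A (v - w) + sg * fejer_kernel A (v - - w)) / 2)) a b).
    { unfold J. transitivity (RInt (fun t => RInt (fun v => om t * C (t * w) * (h v * C (t * v))) a b) 0 A).
      - apply RInt_eq; intro t. rewrite RInt_mull by auto with cont. reflexivity.
      - rewrite (RInt_Fubini (fun t v => om t * C (t * w) * (h v * C (t * v)))).
        2:{ apply (cont2_mult (fun t _ => om t * C (t * w)) (fun t v => h v * C (t * v))).
            - apply (cont2_fst (fun t => om t * C (t * w))); auto with cont.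
            - apply cont2_mult; auto. now apply (cont2_snd h). }
        2: lra.
        apply RInt_eq; intro v.
        rewrite (RInt_eq _ (fun t => h v * (/ 2 * (om t * cos (t * (v - w)) + sg * (om t * cos (t * (v - - w))))))).
        2:{ intro t. replace (om t * C (t * w) * (h v * C (t * v))) with (h v * om t * (C (t * v) * C (t * w))) by ring.
            rewrite C_mult. replace (t * v - t * w) with (t * (v - w)) by ring.
            replace (t * v + t * w) with (t * (v - - w)) by ring. field. }
        rewrite RInt_mull, RInt_mull, RInt_add, RInt_mull by auto 10 with cont.
        unfold fejer_kernel, om. field. }
    rewrite EJ. apply Rle_trans with (RInt k a b).
    - apply RInt_abs_mono; auto.
      + apply cont_mult; auto. apply cont_div_const, cont_plus; [|apply cont_mult; auto with cont];
        apply (cont_comp (fejer_kernel A)); auto using cont_fejer with cont.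
      + unfold k. apply cont_mult; auto with cont.
      + intro v. unfold k.
        pose proof (fejer_kernel_bound A (v - w) HA) as B1. pose proof (fejer_kernel_bound A (v - - w) HA) as B2.
        set (x := A * / (1 + (A * (v - w) / 2) ^ 2)) in *. set (y := A * / (1 + (A * (v - - w) / 2) ^ 2)) in *.
        rewrite Rabs_mult. unfold Rdiv at 2. rewrite Rmult_assoc.
        apply Rmult_le_compat; auto using Rabs_pos.
        * now apply decays_bound.
        * unfold Rdiv. rewrite Rabs_mult, (Rabs_pos_eq (/ 2)), Rmult_comm by lra.
          apply Rmult_le_compat_l; [lra|]. apply Rle_trans with (1 := Rabs_triang _ _).
          rewrite Rabs_mult. assert (Rabs sg * Rabs (fejer_kernel A (v - - w)) <= 1 * y) by (apply Rmult_le_compat; auto using Rabs_pos). lra.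
    - unfold k. rewrite RInt_mull, RInt_add by auto with cont.
      pose proof (RInt_fejer_kernel_le A w a b HA). pose proof (RInt_fejer_kernel_le A (- w) a b HA).
      nra. }
  assert (EI : RInt (fun t => om t * F t ^ 2) 0 A = RInt (fun w => h w * J w) a b).
  { rewrite (RInt_eq _ (fun t => RInt (fun w => (om t * F t) * (h w * C (t * w))) a b)).
    2:{ intro t. rewrite RInt_mull by auto with cont. fold (F t). ring. }
    rewrite (RInt_Fubini (fun t w => (om t * F t) * (h w * C (t * w)))).
    - apply RInt_eq; intro w. unfold J. rewrite <- RInt_mull by auto with cont.
      apply RInt_eq; intro t; ring.
    - apply (cont2_mult (fun t _ => om t * F t) (fun t w => h w * C (t * w))).
      + apply (cont2_fst (fun t => om t * F t)); auto with cont.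
      + apply cont2_mult; auto. now apply (cont2_snd h).
    - lra. }
  assert (BI : RInt (fun t => om t * F t ^ 2) 0 A <= 2 * PI ^ 2 * c ^ 2).
  { rewrite EI. apply Rle_trans with (1 := Rle_abs _).
    apply Rle_trans with (RInt (fun w => (2 * PI * c * c) * / (1 + w ^ 2)) a b).
    - apply RInt_abs_mono; auto with cont. intro w. rewrite Rabs_mult.
      replace (2 * PI * c * c * / (1 + w ^ 2)) with ((c * / (1 + w ^ 2)) * (2 * PI * c)) by ring.
      apply Rmult_le_compat; auto using Rabs_pos.
    - rewrite RInt_mull by auto with cont. pose proof (RInt_inv_one_plus_sqr_le a b). pose proof PI_RGT_0.
      assert (0 <= 2 * PI * c * c) by (apply Rmult_le_pos, Hc; apply Rmult_le_pos, Hc; lra).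
      replace (2 * PI ^ 2 * c ^ 2) with (2 * PI * c * c * PI) by ring. apply Rmult_le_compat_l; auto. }
  assert (om_pos : forall t, t <= A -> 0 <= om t).
  { intros t Ht. unfold om. assert (t / A <= 1); [|lra].
    apply Rmult_le_reg_r with A; [lra|]. unfold Rdiv. rewrite Rmult_assoc, Rinv_l; lra. }
  assert (S1 : RInt (fun t => F t ^ 2) 0 T <= RInt (fun t => 2 * (om t * F t ^ 2)) 0 T).
  { apply RInt_le; try lra; auto with cont. intros t Ht.
    assert (1 / 2 <= om t); [|pose proof (pow2_ge_0 (F t)); nra].
    unfold om, A. assert (t / (2 * T) <= 1 / 2); [|lra].
    apply Rmult_le_reg_r with (2 * T); [lra|]. unfold Rdiv. rewrite Rmult_assoc, Rinv_l; lra. }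
  rewrite RInt_mull in S1 by auto with cont.
  assert (S2 : RInt (fun t => om t * F t ^ 2) 0 T <= RInt (fun t => om t * F t ^ 2) 0 A).
  { rewrite <- (RInt_split _ 0 T A) by auto with cont.
    assert (0 <= RInt (fun t => om t * F t ^ 2) T A); [|lra].
    apply RInt_ge_0; auto with cont; [unfold A; lra|].
    intros t Ht. apply Rmult_le_pos; [apply om_pos; lra | apply pow2_ge_0]. }
  change (RInt (fun t => F t ^ 2) 0 T <= 4 * PI ^ 2 * c ^ 2). lra.
Qed.

Definition transform (h : R -> R) (t : R) : R := RInt_R (fun w => h w * C (t * w)).

Lemma transform_is h c t : cont h -> decays c h ->
  is_RInt_R (fun w => h w * C (t * w)) (transform h t) /\ Rabs (transform h t) <= c * PI.
Proof.
  intros Hh Hd. rewrite <- (Rmult_1_r c).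
  apply decays_RInt_R; auto with cont. apply decays_mult_bounded; auto.
Qed.

Lemma transform_tail h c t n : cont h -> decays c h ->
  Rabs (transform h t - RInt (fun w => h w * C (t * w)) (- INR n) (INR n)) <= 2 * c * tail n.
Proof.
  intros Hh Hd. apply decays_tail; auto with cont.
  rewrite <- (Rmult_1_r c). apply decays_mult_bounded; auto.
Qed.

Lemma transform_cont h c : cont h -> decays c h -> cont (transform h).
Proof.
  intros Hh Hd.
  apply (cont_uniform_limit (fun n t => RInt (fun w => h w * C (t * w)) (- INR n) (INR n)) _ (fun n => 2 * c * tail n)).
  - intro n; now apply cont_finite_transform.
  - intros n t; now apply transform_tail.
  - replace (Finite 0) with (Rbar_mult (2 * c) 0) by (simpl; f_equal; ring).
    apply is_lim_seq_scal_l, tail_lim.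
Qed.

Lemma transform_bessel h c T : cont h -> decays c h -> 0 < T ->
  RInt (fun t => transform h t ^ 2) 0 T <= 4 * PI ^ 2 * c ^ 2.
Proof.
  intros Hh Hd HT. pose proof (decays_nonneg _ _ Hd) as Hc. pose proof PI_RGT_0 as HPI.
  assert (cF := transform_cont h c Hh Hd).
  (* Bessel bound for the transform truncated to [-n, n], plus the error of the squares: x^2 - y^2
     <= 2 |x| |x - y| with |x| <= c pi and |x - y| <= 2 c [tail n], integrated over [0, T]. The
     error vanishes as n grows because T is fixed. *)
  set (E := fun n => 4 * PI ^ 2 * c ^ 2 + (T * (4 * c * PI * c)) * tail n).
  apply (is_lim_seq_le (fun _ => RInt (fun t => transform h t ^ 2) 0 T) E
     (RInt (fun t => transform h t ^ 2) 0 T) (4 * PI ^ 2 * c ^ 2)).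
  2: apply is_lim_seq_const.
  2:{ rewrite <- (Rplus_0_r (4 * PI ^ 2 * c ^ 2)). unfold E.
      apply is_lim_seq_plus'; [apply is_lim_seq_const|].
      replace (Finite 0) with (Rbar_mult (T * (4 * c * PI * c)) 0) by (simpl; f_equal; ring).
      apply is_lim_seq_scal_l, tail_lim. }
  intro n. set (Fn := fun t => RInt (fun w => h w * C (t * w)) (- INR n) (INR n)).
  assert (cFn : cont Fn) by now apply cont_finite_transform.
  assert (BF := finite_bessel h c (- INR n) (INR n) T Hh Hd ltac:(pose proof (pos_INR n); lra) HT).
  fold Fn in BF.
  apply Rle_trans with (RInt (fun t => Fn t ^ 2 + (4 * c * PI * c) * tail n) 0 T).
  - apply RInt_mono; auto with cont; [lra|]. intro t.
    destruct (transform_is h c t Hh Hd) as [_ B]. assert (B2 := transform_tail h c t n Hh Hd). fold (Fn t) in B2.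
    pose proof (tail_pos n). set (x := transform h t) in *. set (y := Fn t) in *.
    assert (x ^ 2 - y ^ 2 <= 2 * x * (x - y)) by (pose proof (pow2_ge_0 (x - y)); nra).
    assert (2 * x * (x - y) <= 2 * (Rabs x * Rabs (x - y))).
    { rewrite <- Rabs_mult. pose proof (Rle_abs (x * (x - y))). lra. }
    assert (Rabs x * Rabs (x - y) <= (c * PI) * (2 * c * tail n)).
    { apply Rmult_le_compat; auto using Rabs_pos. }
    lra.
  - rewrite (RInt_add (fun t => Fn t ^ 2)) by auto with cont. rewrite RInt_const.
    change (RInt (fun t => Fn t ^ 2) 0 T + (T - 0) * (4 * c * PI * c * tail n) <= E n).
    change (RInt (fun t => Fn t ^ 2) 0 T <= 4 * PI ^ 2 * c ^ 2) in BF. unfold E. lra.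
Qed.
End Bessel.

(** * Stability of the time radius *)

Lemma cos_bound1 x : Rabs (cos x) <= 1.
Proof. apply Rabs_le, COS_bound. Qed.
Lemma sin_bound1 x : Rabs (sin x) <= 1.
Proof. apply Rabs_le, SIN_bound. Qed.
Lemma cos_mult_cos x y : cos x * cos y = (cos (x - y) + 1 * cos (x + y)) / 2.
Proof. rewrite cos_minus, cos_plus; field. Qed.
Lemma sin_mult_sin x y : sin x * sin y = (cos (x - y) + -1 * cos (x + y)) / 2.
Proof. rewrite cos_minus, cos_plus; field. Qed.
Lemma Rabs_1_le : Rabs 1 <= 1.
Proof. rewrite Rabs_R1; lra. Qed.
Lemma Rabs_m1_le : Rabs (-1) <= 1.
Proof. rewrite Rabs_left; lra. Qed.

(** * Parity, and the squared modulus of the inverse transform *)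

Lemma RInt_even (f : R -> R) T : cont f -> (forall x, f (- x) = f x) ->
  RInt f (- T) T = 2 * RInt f 0 T.
Proof.
  intros Hf He. rewrite <- (RInt_split f (- T) 0 T) by auto.
  cut (RInt f (- T) 0 = RInt f 0 T); [lra|].
  rewrite <- (opp_RInt_swap f) by auto with cont.
  assert (E := RInt_comp_lin f (-1) 0 0 T).
  replace (-1 * 0 + 0) with 0 in E by ring. replace (-1 * T + 0) with (- T) in E by ring.
  rewrite <- E by auto with cont.
  rewrite (RInt_eq _ (fun y => (-1) * f y)).
  - rewrite RInt_mull by auto. unfold opp; simpl. ring.
  - intro x. unfold scal; simpl; unfold mult; simpl. replace (-1 * x + 0) with (- x) by ring. now rewrite He.
Qed.

Lemma RInt_odd (f : R -> R) T : cont f -> (forall x, f (- x) = - f x) -> RInt f (- T) T = 0.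
Proof.
  intros Hf He. rewrite <- (RInt_split f (- T) 0 T) by auto.
  cut (RInt f (- T) 0 = - RInt f 0 T); [lra|].
  rewrite <- (opp_RInt_swap f) by auto with cont.
  assert (E := RInt_comp_lin f (-1) 0 0 T).
  replace (-1 * 0 + 0) with 0 in E by ring. replace (-1 * T + 0) with (- T) in E by ring.
  rewrite <- E by auto with cont. unfold opp; simpl.
  rewrite (RInt_eq _ f); auto.
  intro x. unfold scal; simpl; unfold mult; simpl. replace (-1 * x + 0) with (- x) by ring. rewrite He. ring.
Qed.

Lemma cos_transform_even h t : transform cos h (- t) = transform cos h t.
Proof.
  unfold transform. f_equal. apply functional_extensionality; intro w.
  replace (- t * w) with (- (t * w)) by ring. now rewrite cos_neg.
Qed.
Lemma sin_transform_odd h c t : cont h -> decays c h ->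
  transform sin h (- t) = - transform sin h t.
Proof.
  intros Hh Hd. apply is_RInt_R_unique.
  destruct (transform_is sin cont_sin sin_bound1 h c t Hh Hd) as [H _].
  replace (- transform sin h t) with (-1 * transform sin h t) by ring.
  apply is_RInt_R_ext with (2 := is_RInt_R_scal _ (-1) _ H).
  intro w. replace (- t * w) with (- (t * w)) by ring. rewrite sin_neg; ring.
Qed.

Section Abs2.
Variables (c : R) (h : R -> R).
Hypotheses (Hh : cont h) (Hd : decays c h).

Lemma abs2_transform t :
  abs2_invFT h t = (/ (2 * PI)) ^ 2 * (transform cos h t ^ 2 + transform sin h t ^ 2).
Proof. unfold abs2_invFT, invFT_re, invFT_im, transform. ring. Qed.

Lemma abs2_nonneg t : 0 <= abs2_invFT h t.
Proof.
  unfold abs2_invFT. pose proof (pow2_ge_0 (invFT_re h t)). pose proof (pow2_ge_0 (invFT_im h t)). lra.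
Qed.

Lemma cos_transform_cont : cont (transform cos h).
Proof. apply (transform_cont cos cont_cos cos_bound1 h c); auto. Qed.
Lemma sin_transform_cont : cont (transform sin h).
Proof. apply (transform_cont sin cont_sin sin_bound1 h c); auto. Qed.

Lemma abs2_cont : cont (abs2_invFT h).
Proof.
  pose proof cos_transform_cont. pose proof sin_transform_cont.
  apply cont_plus; apply cont_pow.
  - change (cont (fun t => / (2 * PI) * transform cos h t)). auto with cont.
  - change (cont (fun t => / (2 * PI) * transform sin h t)). auto with cont.
Qed.

Lemma abs2_even t : abs2_invFT h (- t) = abs2_invFT h t.
Proof.
  rewrite !abs2_transform, cos_transform_even, (sin_transform_odd h c) by auto. ring.
Qed.

(** The Bessel bounds live on [0, T]; evenness doubles them, and 2 / (2 pi)^2 times the two bounds 4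
    pi^2 c^2 gives 4 c^2. *)
Lemma abs2_bessel n : RInt (abs2_invFT h) (- INR n) (INR n) <= 4 * c ^ 2.
Proof.
  pose proof PI_RGT_0 as HPI.
  rewrite RInt_even by (auto using abs2_cont, abs2_even).
  destruct n as [|n].
  - simpl INR. rewrite RInt_point. change (@zero R_CompleteNormedModule) with 0. pose proof (pow2_ge_0 c). lra.
  - assert (HT : 0 < INR (S n)) by (apply lt_0_INR; lia). set (T := INR (S n)) in *.
    rewrite (RInt_eq _ (fun t => (/ (2 * PI)) ^ 2 * (transform cos h t ^ 2 + transform sin h t ^ 2)))
      by apply abs2_transform.
    pose proof cos_transform_cont. pose proof sin_transform_cont.
    rewrite RInt_mull, RInt_add by auto with cont.
    assert (B1 := transform_bessel cos 1 cont_cos cos_bound1 Rabs_1_le cos_mult_cos h c T Hh Hd HT).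
    assert (B2 := transform_bessel sin (-1) cont_sin sin_bound1 Rabs_m1_le sin_mult_sin h c T Hh Hd HT).
    apply Rle_trans with (2 * ((/ (2 * PI)) ^ 2 * (4 * PI ^ 2 * c ^ 2 + 4 * PI ^ 2 * c ^ 2))).
    + apply Rmult_le_compat_l; [lra|]. apply Rmult_le_compat_l; [apply pow2_ge_0|]. lra.
    + right; field; lra.
Qed.

Lemma abs2_integrable : is_RInt_R (abs2_invFT h) (RInt_R (abs2_invFT h)).
Proof.
  apply (is_RInt_R_dominated _ (abs2_invFT h) (4 * c ^ 2)); auto using abs2_cont, abs2_bessel.
  intro x; rewrite Rabs_pos_eq; [lra | apply abs2_nonneg].
Qed.
End Abs2.

Lemma transform_linear C a b f g k t : cont C -> (forall x, Rabs (C x) <= 1) ->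
  cont f -> cont g -> decays a f -> decays b g ->
  transform C (fun w => f w + k * g w) t = transform C f t + k * transform C g t.
Proof.
  intros HC HB Hf Hg Df Dg. apply is_RInt_R_unique.
  destruct (transform_is C HC HB f a t Hf Df) as [H1 _].
  destruct (transform_is C HC HB g b t Hg Dg) as [H2 _].
  apply is_RInt_R_ext with (2 := is_RInt_R_plus _ _ _ _ H1 (is_RInt_R_scal _ k _ H2)).
  intro x; ring.
Qed.

Lemma decays_lin a b k f g : decays a f -> decays b g -> decays (a + Rabs k * b) (fun x => f x + k * g x).
Proof.
  intros Hf Hg. apply decays_plus; auto. intro x. rewrite Rabs_mult, Rmult_assoc.
  apply Rmult_le_compat_l; auto using Rabs_pos.
Qed.

Lemma abs2_close c d a b : cont a -> cont b -> decays c a -> decays c b -> 0 < d ->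
  decays d (fun w => a w - b w) ->
  Rabs (RInt_R (abs2_invFT a) - RInt_R (abs2_invFT b)) <= 2 * d * (1 + 4 * c ^ 2).
Proof.
  intros Ha Hb Da Db Hd Dab.
  (* The squares differ by the transform of a - b times that of a + b. The weight d balances the
     energies 4 d^2 of m and 16 c^2 of p: both terms become of order d. *)
  set (m := fun w => a w + -1 * b w). set (p := fun w => a w + 1 * b w).
  assert (cm : cont m) by (unfold m; auto with cont). assert (cp : cont p) by (unfold p; auto with cont).
  assert (Dm : decays d m).
  { intro x; unfold m. replace (a x + -1 * b x) with (a x - b x) by ring. apply Dab. }
  assert (Dp : decays (2 * c) p).
  { replace (2 * c) with (c + Rabs 1 * c) by (rewrite Rabs_R1; ring). now apply decays_lin. }
  assert (E := is_RInt_R_minus _ _ _ _ (abs2_integrable c a Ha Da) (abs2_integrable c b Hb Db)).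
  rewrite <- (is_RInt_R_unique _ _ E).
  pose proof (abs2_cont c a Ha Da). pose proof (abs2_cont c b Hb Db).
  pose proof (abs2_cont d m cm Dm). pose proof (abs2_cont _ p cp Dp).
  apply (is_RInt_R_dominated _ (fun t => / 2 * (/ d * abs2_invFT m t + d * abs2_invFT p t))); auto with cont.
  - intro t. rewrite !abs2_transform. unfold m, p.
    rewrite !(transform_linear _ c c) by auto using cont_cos, cont_sin, cos_bound1, sin_bound1.
    set (x := transform cos a t); set (y := transform cos b t);
    set (u := transform sin a t); set (v := transform sin b t).
    set (k := (/ (2 * PI)) ^ 2). assert (Hk : 0 <= k) by apply pow2_ge_0.
    (* AM-GM with weight d *)
    assert (AG : forall s q, Rabs (s * q) <= / 2 * (/ d * s ^ 2 + d * q ^ 2)).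
    { intros s q. assert (Hi := Rinv_0_lt_compat d Hd).
      assert (0 <= / d * (s - d * q) ^ 2) by (apply Rmult_le_pos; [lra|apply pow2_ge_0]).
      assert (0 <= / d * (s + d * q) ^ 2) by (apply Rmult_le_pos; [lra|apply pow2_ge_0]).
      replace (/ d * (s - d * q) ^ 2) with (/ d * s ^ 2 + d * q ^ 2 - 2 * (s * q)) in * by (field; lra).
      replace (/ d * (s + d * q) ^ 2) with (/ d * s ^ 2 + d * q ^ 2 + 2 * (s * q)) in * by (field; lra).
      apply Rabs_le; lra. }
    replace (k * (x ^ 2 + u ^ 2) - k * (y ^ 2 + v ^ 2)) with
      (k * ((x - y) * (x + y) + (u - v) * (u + v))) by ring.
    rewrite Rabs_mult, (Rabs_pos_eq k) by auto.
    apply Rle_trans with (k * (/ 2 * (/ d * (x - y) ^ 2 + d * (x + y) ^ 2) + / 2 * (/ d * (u - v) ^ 2 + d * (u + v) ^ 2))).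
    + apply Rmult_le_compat_l; auto. apply Rle_trans with (1 := Rabs_triang _ _).
      apply Rplus_le_compat; apply AG.
    + right; ring.
  - intro n. rewrite RInt_mull, RInt_add, !RInt_mull by auto with cont.
    assert (B1 := abs2_bessel d m cm Dm n). assert (B2 := abs2_bessel _ p cp Dp n).
    assert (/ d * RInt (abs2_invFT m) (- INR n) (INR n) <= / d * (4 * d ^ 2)).
    { apply Rmult_le_compat_l; auto. apply Rlt_le, Rinv_0_lt_compat; auto. }
    replace (/ d * (4 * d ^ 2)) with (4 * d) in * by (field; lra).
    assert (d * RInt (abs2_invFT p) (- INR n) (INR n) <= d * (4 * (2 * c) ^ 2)) by (apply Rmult_le_compat_l; auto; lra).
    lra.
Qed.

(** * The time radius as a quotient of two energies *)

Definition nice (c : R) (g dg : R -> R) : Prop :=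
  (forall x, is_derive g x (dg x)) /\ cont dg /\ decays c g /\ decays c dg.

Lemma nice_cont c g dg : nice c g dg -> cont g.
Proof. intros [H _]; now apply is_derive_cont with dg. Qed.

Lemma decays_lim c h : decays c h ->
  is_lim_seq (fun n => h (INR n)) 0 /\ is_lim_seq (fun n => h (- INR n)) 0.
Proof.
  intro Hd. pose proof (decays_nonneg _ _ Hd).
  assert (L : is_lim_seq (fun n => c * / INR n) 0).
  { replace (Finite 0) with (Rbar_mult c 0) by (simpl; f_equal; ring).
    apply is_lim_seq_scal_l. replace (Finite 0) with (Rbar_inv p_infty) by reflexivity.
    apply is_lim_seq_inv; [apply is_lim_seq_INR | discriminate]. }
  assert (B : forall n, (1 <= n)%nat -> forall x, x = INR n \/ x = - INR n -> Rabs (h x) <= c * / INR n).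
  { intros n Hn x Hx. apply le_INR in Hn; simpl in Hn.
    apply Rle_trans with (1 := Hd x). apply Rmult_le_compat_l; auto.
    apply Rinv_le_contravar; [lra|]. destruct Hx as [-> | ->]; nra. }
  split; apply is_lim_seq_abs_0;
    apply (is_lim_seq_le_le_loc (fun _ => 0) _ (fun n => c * / INR n)); auto using is_lim_seq_const;
    exists 1%nat; intros n Hn; (split; [apply Rabs_pos | apply B with (n := n); auto]).
Qed.

(** Integration by parts on [-n, n]; the boundary terms tend to 0 because g decays and C is
    bounded. *)
Lemma RInt_parts_lim c g dg C dC t : nice c g dg ->
  (forall x, is_derive C x (dC x)) -> cont dC ->
  (forall x, Rabs (C x) <= 1) -> (forall x, Rabs (dC x) <= 1) ->
  transform C dg t = - (t * transform dC g t).
Proof.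
  intros Hn HC cdC B1 B2. pose proof (nice_cont _ _ _ Hn) as cg.
  destruct Hn as [Dg [cdg [D1 D2]]].
  assert (cC : cont C) by (now apply is_derive_cont with dC).
  assert (cC' : cont (fun w => C (t * w))) by (apply cont_comp; auto with cont).
  assert (cdC' : cont (fun w => dC (t * w))) by (apply cont_comp; auto with cont).
  destruct (transform_is C cC B1 dg c t cdg D2) as [H1 _].
  destruct (transform_is dC cdC B2 g c t cg D1) as [H2 _].
  assert (H3 := is_RInt_R_plus _ _ _ _ H1 (is_RInt_R_scal _ t _ H2)).
  apply is_RInt_R_lim in H3; auto with cont.
  destruct (decays_lim _ _ (decays_mult_bounded c 1 g (fun w => C (t * w)) D1 (fun x => B1 _))) as [L1 L2].
  assert (L3 := is_lim_seq_minus' _ _ _ _ L1 L2).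
  apply is_lim_seq_ext with (v := fun n => RInt (fun x => dg x * C (t * x) + t * (g x * dC (t * x))) (- INR n) (INR n)) in L3.
  - apply is_lim_seq_unique in L3. apply is_lim_seq_unique in H3. rewrite L3 in H3. injection H3. lra.
  - intro n. symmetry. apply (RInt_FTC (fun w => g w * C (t * w))); auto with cont.
    intro x. replace (dg x * C (t * x) + t * (g x * dC (t * x))) with (dg x * C (t * x) + g x * (t * dC (t * x))) by ring.
    apply (is_derive_mult g (fun w => C (t * w))); auto; [|intros; apply Rmult_comm].
    apply (is_derive_comp C (fun w => t * w)); auto.
    auto_derive; auto; ring.
Qed.

Lemma abs2_derive c g dg t : nice c g dg -> abs2_invFT dg t = t ^ 2 * abs2_invFT g t.
Proof.
  intro Hn. rewrite !abs2_transform.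
  rewrite (RInt_parts_lim c g dg sin cos) by
    (auto using cos_bound1, sin_bound1, cont_cos; intro; apply is_derive_sin).
  assert (E : transform cos dg t = t * transform sin g t).
  { assert (E1 : transform cos dg t = - (t * transform (fun x => - sin x) g t)).
    { apply RInt_parts_lim with c; auto using cos_bound1.
      - intro; apply is_derive_cos.
      - auto with cont.
      - intro; rewrite Rabs_Ropp; apply sin_bound1. }
    assert (E2 : transform (fun x => - sin x) g t = -1 * transform sin g t).
    { pose proof (nice_cont _ _ _ Hn). destruct Hn as [_ [_ [D _]]].
      destruct (transform_is sin cont_sin sin_bound1 g c t H D) as [H1 _].
      apply is_RInt_R_unique, is_RInt_R_ext with (2 := is_RInt_R_scal _ (-1) _ H1). intro; ring. }
    rewrite E1, E2; ring. }
  rewrite E. ring.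
Qed.

Lemma time_radius2_nice c g dg : nice c g dg ->
  time_radius2 g = / RInt_R (abs2_invFT g) * RInt_R (abs2_invFT dg).
Proof.
  intro Hn. pose proof (nice_cont _ _ _ Hn) as cg. pose proof Hn as [_ [cdg [D1 D2]]].
  pose proof (abs2_cont c g cg D1) as c1. pose proof (abs2_cont c dg cdg D2) as c2.
  (* g is real, so |f|^2 is even and the centre t0 is 0. Convergence follows from |t| <= 1 + t^2,
     the dominating function being |f|^2 + t^2 |f|^2. *)
  assert (E0 : RInt_R (fun t => t * abs2_invFT g t) = 0).
  { assert (cf : cont (fun t => t * abs2_invFT g t)) by auto with cont.
    destruct (is_RInt_R_dominated (fun t => t * abs2_invFT g t)
       (fun t => abs2_invFT g t + abs2_invFT dg t) (4 * c ^ 2 + 4 * c ^ 2)) as [H _]; auto with cont.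
    - intro t. rewrite (abs2_derive c g dg t Hn), Rabs_mult, (Rabs_pos_eq (abs2_invFT g t)) by apply abs2_nonneg.
      pose proof (abs2_nonneg g t). assert (Rabs t <= 1 + t ^ 2); [|nra].
      apply Rabs_le. pose proof (pow2_ge_0 (t - 1)). pose proof (pow2_ge_0 (t + 1)). nra.
    - intro n. rewrite RInt_add by auto. pose proof (abs2_bessel c g cg D1 n). pose proof (abs2_bessel c dg cdg D2 n). lra.
    - apply is_RInt_R_lim in H; auto.
      apply (is_lim_seq_ext _ (fun _ => 0)) in H.
      + apply is_lim_seq_unique in H. rewrite Lim_seq_const in H. now injection H.
      + intro n. apply (RInt_odd (fun t => t * abs2_invFT g t)); auto.
        intro x; rewrite (abs2_even c) by auto; ring. }
  unfold time_radius2. rewrite E0, Rmult_0_r.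
  f_equal. apply is_RInt_R_unique. apply is_RInt_R_ext with (abs2_invFT dg).
  - intro x. rewrite (abs2_derive c g dg x Hn), Rminus_0_r. reflexivity.
  - now apply abs2_integrable with c.
Qed.

Lemma time_radius2_stable c g0 dg0 : nice c g0 dg0 -> 0 < RInt_R (abs2_invFT g0) ->
  exists K eta, 0 <= K /\ 0 < eta /\ forall d g dg, 0 < d <= eta ->
    (forall x, is_derive g x (dg x)) -> cont dg ->
    decays d (fun w => g w - g0 w) -> decays d (fun w => dg w - dg0 w) ->
    Rabs (time_radius2 g - time_radius2 g0) <= K * d.
Proof.
  intros Hn HN. set (N0 := RInt_R (abs2_invFT g0)) in *. set (D0 := RInt_R (abs2_invFT dg0)).
  pose proof (nice_cont _ _ _ Hn) as cg0. pose proof Hn as [_ [cdg0 [d1 d2]]].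
  set (A := 2 * (1 + 4 * (c + 1) ^ 2)).
  assert (HA : 0 < A) by (unfold A; pose proof (pow2_ge_0 (c + 1)); lra).
  (* A bound d <= 1 puts g and dg in the class [decays (c + 1)]; d <= N0 / (2 A) keeps N >= N0 / 2,
     so that the quotient D / N is Lipschitz in both energies. *)
  exists (2 * / N0 * (A + A * Rabs (/ N0 * D0))), (Rmin 1 (N0 / (2 * A))).
  assert (Hi := Rinv_0_lt_compat _ HN).
  split; [|split].
  - pose proof (Rabs_pos (/ N0 * D0)). apply Rmult_le_pos; [lra|]. apply Rplus_le_le_0_compat; [lra|]. apply Rmult_le_pos; lra.
  - apply Rmin_pos; [lra|]. apply Rdiv_lt_0_compat; lra.
  - intros d g dg [Hd He] Dg cdg D1 D2.
    pose proof (Rle_trans _ _ _ He (Rmin_l _ _)) as He1. pose proof (Rle_trans _ _ _ He (Rmin_r _ _)) as He2.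
    assert (cg : cont g) by now apply is_derive_cont with dg.
    assert (W : forall a b, decays c b -> decays d (fun w => a w - b w) -> decays (c + 1) a).
    { intros a b Hb Hab x. specialize (Hb x). specialize (Hab x). pose proof (inv_one_plus_sqr x).
      replace (a x) with (b x + (a x - b x)) by ring. apply Rle_trans with (1 := Rabs_triang _ _). nra. }
    assert (G1 := W _ _ d1 D1). assert (G2 := W _ _ d2 D2).
    assert (Z1 : decays (c + 1) g0) by (apply decays_le with c; auto; lra).
    assert (Z2 : decays (c + 1) dg0) by (apply decays_le with c; auto; lra).
    rewrite (time_radius2_nice (c + 1) g dg) by (split; [|split; [|split]]; auto).
    rewrite (time_radius2_nice c g0 dg0) by auto.
    assert (B1 := abs2_close (c + 1) d g g0 cg cg0 G1 Z1 Hd D1).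
    assert (B2 := abs2_close (c + 1) d dg dg0 cdg cdg0 G2 Z2 Hd D2).
    set (N := RInt_R (abs2_invFT g)) in *. set (D := RInt_R (abs2_invFT dg)) in *.
    fold N0 in B1 |- *. fold D0 in B2 |- *. replace (2 * d * (1 + 4 * (c + 1) ^ 2)) with (A * d) in B1, B2 by (unfold A; ring).
    assert (Ad : A * d <= N0 / 2).
    { apply Rle_trans with (A * (N0 / (2 * A))); [apply Rmult_le_compat_l; lra|]. right; field; lra. }
    assert (HN2 : N0 / 2 <= N) by (apply Rabs_le_between in B1; lra).
    replace (/ N * D - / N0 * D0) with (/ N * ((D - D0) - (N - N0) * (/ N0 * D0))) by (field; lra).
    rewrite Rabs_mult, (Rabs_pos_eq (/ N)) by (apply Rlt_le, Rinv_0_lt_compat; lra).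
    replace (2 * / N0 * (A + A * Rabs (/ N0 * D0)) * d) with
      (2 * / N0 * (A * d + A * d * Rabs (/ N0 * D0))) by ring.
    apply Rmult_le_compat.
    + apply Rlt_le, Rinv_0_lt_compat; lra.
    + apply Rabs_pos.
    + replace (2 * / N0) with (/ (N0 / 2)) by (field; lra). apply Rinv_le_contravar; lra.
    + apply Rle_trans with (1 := Rabs_triang _ _). rewrite Rabs_Ropp, Rabs_mult.
      apply Rplus_le_compat; auto. apply Rmult_le_compat_r; auto using Rabs_pos.
Qed.

(** f(0) is the integral of g divided by 2 pi, hence nonzero, and continuity keeps |f|^2 positive
    near 0. *)
Lemma RInt_abs2_pos c g : cont g -> decays c g -> RInt_R g <> 0 -> 0 < RInt_R (abs2_invFT g).
Proof.
  intros Hg Hd H0. pose proof PI_RGT_0 as HPI.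
  pose proof (abs2_cont c g Hg Hd) as ca.
  assert (P0 : 0 < abs2_invFT g 0).
  { rewrite abs2_transform.
    assert (E : transform cos g 0 = RInt_R g).
    { unfold transform. f_equal. apply functional_extensionality; intro w.
      rewrite Rmult_0_l, cos_0; ring. }
    rewrite E. apply Rmult_lt_0_compat; [apply pow_lt, Rinv_0_lt_compat; lra|].
    pose proof (pow2_ge_0 (transform sin g 0)). assert (0 < RInt_R g ^ 2) by (apply pow2_gt_0; auto). lra. }
  apply Rlt_le_trans with (RInt (abs2_invFT g) (- INR 1) (INR 1)).
  2:{ apply is_RInt_R_ge; auto using abs2_nonneg. now apply abs2_integrable with c. }
  simpl INR.
  specialize (ca 0). pose proof ca as ca0. apply (proj1 (filterlim_locally _ _)) with (eps := mkposreal _ P0) in ca0.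
  destruct ca0 as [d Hdl]. clear ca.
  pose proof (abs2_cont c g Hg Hd) as ca.
  set (e := Rmin 1 (d / 2)). assert (He : 0 < e) by (apply Rmin_pos; [lra| pose proof (cond_pos d); lra]).
  assert (e <= 1) by apply Rmin_l. assert (e <= d / 2) by apply Rmin_r.
  rewrite <- (RInt_split _ (-1) 0 1), <- (RInt_split _ 0 e 1) by auto.
  assert (0 <= RInt (abs2_invFT g) (-1) 0) by (apply RInt_nonneg; auto using abs2_nonneg; lra).
  assert (0 <= RInt (abs2_invFT g) e 1) by (apply RInt_nonneg; auto using abs2_nonneg; lra).
  assert (0 < RInt (abs2_invFT g) 0 e); [|lra].
  apply RInt_gt_0; auto. intros x Hx.
  assert (B : Rabs (abs2_invFT g x - abs2_invFT g 0) < abs2_invFT g 0).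
  { apply Hdl. change (Rabs (x - 0) < d). rewrite Rminus_0_r, Rabs_pos_eq; lra. }
  apply Rabs_def2 in B; lra.
Qed.

(** * Infinite products *)

(** Increments dominated by those of a convergent sequence satisfy a uniform Cauchy criterion.
    Differences of [tau] instead of a series serve both the infinite products ([tau] of order 2^-n)
    and the periodizations ([tau] of order 1 / n). *)
Lemma CVU_telescope (F : nat -> R -> R) (A : R) (tau : nat -> R) (l : R) (n0 : nat) :
  (forall n x, (n0 <= n)%nat -> Rabs x < A -> Rabs (F (S n) x - F n x) <= tau n - tau (S n)) ->
  is_lim_seq tau l -> CVU_dom F (fun x => Rabs x < A).
Proof.
  intros H L. apply CVU_dom_cauchy. intro eps.
  assert (key : forall n k x, (n0 <= n)%nat -> Rabs x < A -> Rabs (F (n + k)%nat x - F n x) <= tau n - tau (n + k)%nat).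
  { intros n k x Hn Hx; induction k.
    - rewrite Nat.add_0_r, !Rminus_eq_0, Rabs_R0; lra.
    - rewrite Nat.add_succ_r. specialize (H (n + k)%nat x ltac:(lia) Hx).
      replace (F (S (n + k)) x - F n x) with ((F (S (n + k)) x - F (n + k)%nat x) + (F (n + k)%nat x - F n x)) by ring.
      apply Rle_trans with (1 := Rabs_triang _ _); lra. }
  apply is_lim_seq_spec in L.
  destruct (L (mkposreal (eps / 2) ltac:(pose proof (cond_pos eps); lra))) as [N HN]; simpl in HN.
  exists (max n0 N); intros n m x Hx Hn Hm.
  assert (sym : forall n m, (max n0 N <= n)%nat -> (n <= m)%nat -> Rabs (F m x - F n x) < eps).
  { clear n m Hn Hm; intros n m Hn Hm. replace m with (n + (m - n))%nat by lia.
    apply Rle_lt_trans with (1 := key n (m - n)%nat x ltac:(lia) Hx).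
    assert (B1 := HN n ltac:(lia)). assert (B2 := HN (n + (m - n))%nat ltac:(lia)).
    apply Rabs_def2 in B1; apply Rabs_def2 in B2. lra. }
  destruct (Nat.le_ge_cases n m).
  - rewrite Rabs_minus_sym. now apply sym.
  - now apply sym.
Qed.

Lemma C1_limit (F dF : nat -> R -> R) (A : R) (tau : nat -> R) (l : R) (n0 : nat) :
  (forall n x, is_derive (F n) x (dF n x)) -> (forall n, cont (dF n)) ->
  (forall n x, (n0 <= n)%nat -> Rabs x < A -> Rabs (F (S n) x - F n x) <= tau n - tau (S n)) ->
  (forall n x, (n0 <= n)%nat -> Rabs x < A -> Rabs (dF (S n) x - dF n x) <= tau n - tau (S n)) ->
  is_lim_seq tau l ->
  forall x, Rabs x < A ->
    is_lim_seq (fun n => F n x) (real (Lim_seq (fun n => F n x))) /\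
    is_lim_seq (fun n => dF n x) (real (Lim_seq (fun n => dF n x))) /\
    is_derive (fun y => real (Lim_seq (fun n => F n y))) x (real (Lim_seq (fun n => dF n x))) /\
    continuous (fun y => real (Lim_seq (fun n => dF n y))) x.
Proof.
  intros D C H1 H2 L x Hx.
  assert (U1 := CVU_telescope F A tau l n0 H1 L). assert (U2 := CVU_telescope dF A tau l n0 H2 L).
  assert (op : open (fun x => Rabs x < A)).
  { apply (open_comp Rabs (fun y => y < A)); [|apply open_lt]. intros; apply (continuous_Rabs x0). }
  assert (pt : forall G, CVU_dom G (fun x => Rabs x < A) ->
     is_lim_seq (fun n => G n x) (real (Lim_seq (fun n => G n x)))).
  { intros G U. apply is_lim_seq_spec. intro eps. destruct (U eps) as [N HN].
    exists N; intros n Hn; now apply HN. }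
  split; [now apply pt|]. split; [now apply pt|].
  assert (ED : forall n y, Derive (F n) y = dF n y) by (intros; now apply is_derive_unique).
  split.
  - rewrite (Lim_seq_ext (fun n => dF n x) (fun n => Derive (F n) x)) by (intro; now rewrite ED).
    apply (CVU_Derive F (fun x => Rabs x < A)); auto.
    + intros a b y Ha Hb Hy. apply Rabs_def2 in Ha; apply Rabs_def2 in Hb. apply Rabs_def1; lra.
    + intros n y _; eexists; apply D.
    + intros n y _. apply continuity_pt_filterlim.
      apply (continuous_ext (dF n)); [intro; now rewrite ED|]. apply C.
    + intros eps. destruct (U2 eps) as [N HN]. exists N; intros n Hn y Hy.
      rewrite ED, (Lim_seq_ext _ (fun n => dF n y)) by (intro; apply ED). now apply HN.
  - apply continuity_pt_filterlim. apply (CVU_cont_open dF (fun x => Rabs x < A)); auto.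
    intros n y _. apply continuity_pt_filterlim, C.
Qed.

Fixpoint dpart_prod (m dm : R -> R) (w : R) (N : nat) : R :=
  match N with
  | O => 0
  | S N' => dpart_prod m dm w N' * m (w / 2 ^ N) + part_prod m w N' * (dm (w / 2 ^ N) / 2 ^ N)
  end.

Lemma pow2_pos n : 0 < 2 ^ n.
Proof. apply pow_lt; lra. Qed.

Lemma inv_pow2_succ n : / 2 ^ S n = / 2 ^ n / 2.
Proof. simpl. pose proof (pow2_pos n). field. lra. Qed.

Lemma is_lim_seq_inv_pow2 k : is_lim_seq (fun n => k * / 2 ^ n) 0.
Proof.
  replace (Finite 0) with (Rbar_mult k 0) by (simpl; f_equal; ring).
  apply is_lim_seq_scal_l. apply is_lim_seq_ext with (fun n => (/ 2) ^ n).
  - intro n. now rewrite pow_inv.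
  - apply is_lim_seq_geom. rewrite Rabs_pos_eq; lra.
Qed.

(** * The infinite product of a C^1 mask with value 1 at 0 *)

Section Product.
Variables (m dm : R -> R) (M : R).
Hypothesis Dm : forall x, is_derive m x (dm x).
Hypothesis Cdm : cont dm.
Hypothesis Bdm : forall x, Rabs (dm x) <= M.
Hypothesis m0 : m 0 = 1.

Let M_pos : 0 <= M.
Proof. pose proof (Bdm 0); pose proof (Rabs_pos (dm 0)); lra. Qed.

Let Cm : cont m.
Proof. now apply is_derive_cont with dm. Qed.

Lemma lipschitz_at_0 x : Rabs (m x - 1) <= M * Rabs x.
Proof.
  destruct (MVT_gen m 0 x dm) as [c [_ Hc]].
  - intros; apply Dm.
  - intros; apply continuity_pt_filterlim, Cm.
  - rewrite <- m0, Hc, Rminus_0_r, Rabs_mult. apply Rmult_le_compat_r; auto using Rabs_pos.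
Qed.

Lemma dpart_prod_derive N w : is_derive (fun w => part_prod m w N) w (dpart_prod m dm w N).
Proof.
  induction N.
  - apply (is_derive_const (V := R_NormedModule) 1 w).
  - cbn [part_prod dpart_prod].
    apply (is_derive_mult (fun w => part_prod m w N) (fun w => m (w / 2 ^ S N))); auto; [|intros; apply Rmult_comm].
    replace (dm (w / 2 ^ S N) / 2 ^ S N) with (/ 2 ^ S N * dm (w / 2 ^ S N)) by (unfold Rdiv; ring).
    apply (is_derive_comp m (fun w => w / 2 ^ S N)); auto.
    auto_derive; auto. apply Rmult_1_l.
Qed.

Lemma dpart_prod_cont N : cont (fun w => dpart_prod m dm w N).
Proof.
  induction N; [apply (cont_const 0)|]. cbn [dpart_prod].
  assert (cP : cont (fun w => part_prod m w N)) by (apply (is_derive_cont _ _ (dpart_prod_derive N))).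
  assert (cont (fun w => w / 2 ^ S N)) by auto with cont.
  apply cont_plus; apply cont_mult; auto.
  - now apply (cont_comp m).
  - apply cont_div_const. now apply (cont_comp dm).
Qed.

Section Bounds.
Variable A : R.
Hypothesis A_pos : 0 <= A.

(** The product over j = 1..N of exp(M A / 2^j), which bounds the factors one by one through |m(w /
    2^j)| <= 1 + M A / 2^j. *)
Let E N := exp (M * A * (1 - / 2 ^ N)).

Lemma part_prod_step_bound N w : Rabs w <= A ->
  Rabs (m (w / 2 ^ S N) - 1) <= M * A * / 2 ^ S N /\
  Rabs (m (w / 2 ^ S N)) <= exp (M * A * / 2 ^ S N).
Proof.
  intro Hw. assert (Hp := Rinv_0_lt_compat _ (pow2_pos (S N))).
  assert (B1 : Rabs (m (w / 2 ^ S N) - 1) <= M * A * / 2 ^ S N).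
  { apply Rle_trans with (1 := lipschitz_at_0 _). unfold Rdiv.
    rewrite Rabs_mult, (Rabs_pos_eq (/ _)) by lra. rewrite <- Rmult_assoc.
    apply Rmult_le_compat_r; [lra|]. now apply Rmult_le_compat_l. }
  split; auto.
  apply Rle_trans with (1 + M * A * / 2 ^ S N); [|apply exp_ineq1_le].
  replace (m (w / 2 ^ S N)) with (1 + (m (w / 2 ^ S N) - 1)) by ring.
  apply Rle_trans with (1 := Rabs_triang _ _). rewrite Rabs_R1. lra.
Qed.

Lemma E_step N : E N * exp (M * A * / 2 ^ S N) = E (S N).
Proof. unfold E. rewrite <- exp_plus. f_equal. rewrite inv_pow2_succ. field. pose proof (pow2_pos N); lra. Qed.

Lemma E_le N : 0 < E N <= exp (M * A).
Proof.
  split; [apply exp_pos|]. unfold E.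
  assert (Hp := Rinv_0_lt_compat _ (pow2_pos N)).
  assert (0 <= M * A) by (apply Rmult_le_pos; auto).
  destruct (Rle_lt_or_eq_dec (M * A * (1 - / 2 ^ N)) (M * A)) as [H1|H1]; [nra| |].
  - now apply Rlt_le, exp_increasing.
  - rewrite H1; lra.
Qed.

Lemma part_prod_bound N w : Rabs w <= A -> Rabs (part_prod m w N) <= E N.
Proof.
  intro Hw; induction N.
  - cbn [part_prod]. unfold E. simpl. rewrite Rinv_1, Rminus_eq_0, Rmult_0_r, exp_0, Rabs_R1; lra.
  - cbn [part_prod]. rewrite Rabs_mult, <- E_step.
    apply Rmult_le_compat; auto using Rabs_pos. now apply part_prod_step_bound.
Qed.

(** In the Leibniz rule, differentiating the factor at scale j costs M / 2^j, and these costs add up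
    to M (1 - 2^-N). *)
Lemma dpart_prod_bound N w : Rabs w <= A -> Rabs (dpart_prod m dm w N) <= M * (1 - / 2 ^ N) * E N.
Proof.
  intro Hw; induction N.
  - cbn [dpart_prod]. rewrite Rabs_R0. simpl. rewrite Rinv_1. lra.
  - cbn [dpart_prod]. assert (Hp := Rinv_0_lt_compat _ (pow2_pos (S N))).
    apply Rle_trans with (1 := Rabs_triang _ _). rewrite !Rabs_mult.
    destruct (part_prod_step_bound N w Hw) as [_ B2].
    assert (S1 : Rabs (dpart_prod m dm w N) * Rabs (m (w / 2 ^ S N)) <= (M * (1 - / 2 ^ N) * E N) * exp (M * A * / 2 ^ S N))
      by (apply Rmult_le_compat; auto using Rabs_pos).
    assert (S2 : Rabs (part_prod m w N) * Rabs (dm (w / 2 ^ S N) / 2 ^ S N) <= E (S N) * (M * / 2 ^ S N)).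
    { apply Rmult_le_compat; auto using Rabs_pos.
      - apply Rle_trans with (1 := part_prod_bound N w Hw). rewrite <- E_step.
        pose proof (E_le N). assert (1 <= exp (M * A * / 2 ^ S N)); [|nra].
        apply Rle_trans with (1 + M * A * / 2 ^ S N); [|apply exp_ineq1_le].
        assert (0 <= M * A) by (apply Rmult_le_pos; auto). nra.
      - unfold Rdiv. rewrite Rabs_mult, (Rabs_pos_eq (/ _)) by lra. apply Rmult_le_compat_r; auto; lra. }
    rewrite Rmult_assoc, E_step in S1.
    apply Rle_trans with (1 := Rplus_le_compat _ _ _ _ S1 S2). right. rewrite inv_pow2_succ. field.
    pose proof (pow2_pos N); lra.
Qed.

(** Large enough for both increments: up to the factor exp(M A) / 2^(N+1), that of the product is at
    most M A and that of its derivative at most M (M A) + M. *)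
Let B := exp (M * A) * (M * (M * A) + M + M * A).

Lemma part_prod_increment N w : Rabs w <= A ->
  Rabs (part_prod m w (S N) - part_prod m w N) <= B * / 2 ^ N - B * / 2 ^ S N /\
  Rabs (dpart_prod m dm w (S N) - dpart_prod m dm w N) <= B * / 2 ^ N - B * / 2 ^ S N.
Proof.
  intro Hw. replace (B * / 2 ^ N - B * / 2 ^ S N) with (B * / 2 ^ S N) by (rewrite inv_pow2_succ; field; pose proof (pow2_pos N); lra).
  cbn [dpart_prod part_prod].
  destruct (part_prod_step_bound N w Hw) as [B1 _].
  assert (B2 := part_prod_bound N w Hw). assert (B3 := dpart_prod_bound N w Hw).
  assert (HE := E_le N). assert (MA : 0 <= M * A) by (apply Rmult_le_pos; auto).
  assert (Hp := Rinv_0_lt_compat _ (pow2_pos (S N))).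
  assert (Hp0 := Rinv_0_lt_compat _ (pow2_pos N)).
  assert (C2 : Rabs (part_prod m w N) <= exp (M * A)) by lra.
  assert (C3 : Rabs (dpart_prod m dm w N) <= exp (M * A) * M).
  { apply Rle_trans with (1 := B3). rewrite Rmult_comm.
    apply Rmult_le_compat; try lra; [|nra]. apply Rmult_le_pos; auto.
    assert (/ 2 ^ N <= 1); [|lra]. rewrite <- Rinv_1. apply Rinv_le_contravar; [lra|]. apply pow_R1_Rle; lra. }
  assert (HX := exp_pos (M * A)). set (X := exp (M * A)) in *. set (p := / 2 ^ S N) in *.
  split.
  - replace (part_prod m w N * m (w / 2 ^ S N) - part_prod m w N) with (part_prod m w N * (m (w / 2 ^ S N) - 1)) by ring.
    rewrite Rabs_mult. apply Rle_trans with (X * (M * A * p)); [apply Rmult_le_compat; auto using Rabs_pos|].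
    rewrite <- Rmult_assoc. apply Rmult_le_compat_r; [lra|]. unfold B. apply Rmult_le_compat_l; [lra|].
    assert (0 <= M * (M * A)) by (apply Rmult_le_pos; auto). lra.
  - replace (dpart_prod m dm w N * m (w / 2 ^ S N) + part_prod m w N * (dm (w / 2 ^ S N) / 2 ^ S N) - dpart_prod m dm w N)
      with (dpart_prod m dm w N * (m (w / 2 ^ S N) - 1) + part_prod m w N * (dm (w / 2 ^ S N) * p)) by (unfold p, Rdiv; ring).
    apply Rle_trans with (1 := Rabs_triang _ _). rewrite !Rabs_mult, (Rabs_pos_eq p) by lra.
    apply Rle_trans with (X * M * (M * A * p) + X * (M * p)).
    + apply Rplus_le_compat; apply Rmult_le_compat; auto using Rabs_pos.
      * apply Rmult_le_pos; [apply Rabs_pos|lra].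
      * apply Rmult_le_compat_r; [lra|apply Bdm].
    + replace (X * M * (M * A * p) + X * (M * p)) with (X * (M * (M * A) + M) * p) by ring.
      apply Rmult_le_compat_r; [lra|]. unfold B. apply Rmult_le_compat_l; lra.
Qed.
End Bounds.

Definition dinf_prod (w : R) : R := real (Lim_seq (dpart_prod m dm w)).

Lemma inf_prod_C1 w :
  is_lim_seq (part_prod m w) (inf_prod m w) /\ is_derive (inf_prod m) w (dinf_prod w) /\ continuous dinf_prod w.
Proof.
  assert (HA : 0 <= Rabs w + 1) by (pose proof (Rabs_pos w); lra).
  destruct (C1_limit (fun N w => part_prod m w N) (fun N w => dpart_prod m dm w N) (Rabs w + 1)
    (fun N => exp (M * (Rabs w + 1)) * (M * (M * (Rabs w + 1)) + M + M * (Rabs w + 1)) * / 2 ^ N) 0 0)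
    with (x := w) as [L1 [_ [L2 L3]]].
  - intros; apply dpart_prod_derive.
  - apply dpart_prod_cont.
  - intros n x _ Hx. apply part_prod_increment; auto; lra.
  - intros n x _ Hx. apply part_prod_increment; auto; lra.
  - apply is_lim_seq_inv_pow2.
  - lra.
  - split; [exact L1|split; [exact L2|exact L3]].
Qed.

(** [part_prod] grows at the finest scale; here the coarsest factor is split off, and the limit is
    the refinement equation. *)
Lemma part_prod_succ N w : part_prod m w (S N) = m (w / 2) * part_prod m (w / 2) N.
Proof.
  induction N.
  - cbn [part_prod]. simpl. rewrite Rmult_1_r. ring.
  - change (part_prod m w (S (S N))) with (part_prod m w (S N) * m (w / 2 ^ S (S N))).
    rewrite IHN. cbn [part_prod]. rewrite Rmult_assoc. do 3 f_equal.
    simpl. pose proof (pow2_pos N). field. lra.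
Qed.

Lemma inf_prod_refinement w : inf_prod m w = m (w / 2) * inf_prod m (w / 2).
Proof.
  destruct (inf_prod_C1 w) as [L1 _]. destruct (inf_prod_C1 (w / 2)) as [L2 _].
  apply is_lim_seq_incr_1 in L1.
  apply (is_lim_seq_ext _ _ _ (fun N => part_prod_succ N w)) in L1.
  apply (is_lim_seq_scal_l _ (m (w / 2))) in L2.
  apply is_lim_seq_unique in L1. apply is_lim_seq_unique in L2. rewrite L1 in L2. now injection L2.
Qed.

Lemma dinf_prod_refinement w :
  dinf_prod w = / 2 * (dm (w / 2) * inf_prod m (w / 2) + m (w / 2) * dinf_prod (w / 2)).
Proof.
  assert (H1 := proj1 (proj2 (inf_prod_C1 w))).
  assert (H2 := proj1 (proj2 (inf_prod_C1 (w / 2)))).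
  assert (Dh : is_derive (fun w => w / 2) w (/ 2)) by (auto_derive; auto; lra).
  assert (H3 := is_derive_comp (inf_prod m) (fun w => w / 2) w _ _ H2 Dh).
  assert (H4 := is_derive_comp m (fun w => w / 2) w _ _ (Dm (w / 2)) Dh).
  assert (H5 := is_derive_mult (fun w => m (w / 2)) (fun w => inf_prod m (w / 2)) w _ _ H4 H3 (fun _ _ => Rmult_comm _ _)).
  apply (is_derive_ext _ (inf_prod m)) in H5; [|intro; symmetry; apply inf_prod_refinement].
  apply is_derive_unique in H1. apply is_derive_unique in H5. rewrite <- H1, H5.
  unfold plus, scal, mult; simpl; unfold mult; simpl. ring.
Qed.

Lemma inf_prod_0 : inf_prod m 0 = 1.
Proof.
  unfold inf_prod. rewrite (Lim_seq_ext _ (fun _ => 1)); [now rewrite Lim_seq_const|].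
  induction n; auto. cbn [part_prod]. rewrite IHn. unfold Rdiv. rewrite Rmult_0_l, m0. ring.
Qed.
End Product.

(** * Decay of a perturbed refinable function *)

Lemma cos_Rabs x : cos (Rabs x) = cos x.
Proof. unfold Rabs; destruct Rcase_abs; auto using cos_neg. Qed.

Lemma cos_ge_half x : Rabs x <= PI / 3 -> 1 / 2 <= cos x.
Proof.
  intro H. pose proof PI_RGT_0.
  rewrite <- cos_PI3. rewrite <- (cos_Rabs x).
  pose proof (Rabs_pos x). apply cos_decr_1; lra.
Qed.

Lemma cos_le_mhalf x : 2 * PI / 3 <= Rabs x <= 4 * PI / 3 -> cos x <= - (1 / 2).
Proof.
  intro H. rewrite <- (cos_Rabs x).
  assert (E : cos (Rabs x) = - cos (Rabs x - PI)).
  { rewrite cos_minus, cos_PI, sin_PI; ring. }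
  rewrite E. apply Ropp_le_contravar, cos_ge_half, Rabs_le. lra.
Qed.

Lemma cos_le_half x : PI / 3 <= Rabs x <= 4 * PI / 3 -> cos x <= 1 / 2.
Proof.
  intro H. pose proof PI_RGT_0. destruct (Rle_dec (Rabs x) PI).
  - rewrite <- cos_PI3. rewrite <- (cos_Rabs x).
    apply cos_decr_1; lra.
  - apply Rle_trans with (- (1 / 2)); [|lra]. apply cos_le_mhalf; lra.
Qed.

(** This is cos(x/2)^6, and [envelope] is sin(w/2)^6 / w^2. Six is the least even exponent that
    works: with exponent 2k the two-step growth factor at cos x = 1/2 is (16^k / 16) (3/4)^k (1/4)^k
    = 3^k / 16, which must exceed 1 because m0 = 1 at both x and 2x can occur on cos x >= 1/2. *)
Definition sixth (x : R) : R := ((1 + cos x) / 2) ^ 3.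
Definition envelope (w : R) : R := ((1 - cos w) / 2) ^ 3 * / w ^ 2.

Lemma sixth_pos x : 0 <= sixth x.
Proof. apply pow_le. pose proof (COS_bound x); lra. Qed.

(** Sixth power of sin(w/2) = 4 sin(w/8) cos(w/8) cos(w/4), divided by w^2 = 16 (w/4)^2; 4^6 / 16 =
    256. *)
Lemma envelope_step w : w <> 0 -> envelope w = 256 * envelope (w / 4) * (sixth (w / 4) * sixth (w / 2)).
Proof.
  intro Hw. unfold envelope, sixth.
  set (x := w / 4). replace w with (2 * (2 * x)) by (unfold x; field).
  replace (2 * (2 * x) / 2) with (2 * x) by field.
  assert (x <> 0) by (unfold x; lra).
  rewrite !cos_2a_cos. field. auto.
Qed.

Lemma envelope_le w : 1 <= Rabs w -> 0 <= envelope w <= 2 * / (1 + w ^ 2).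
Proof.
  intro Hw. unfold envelope.
  assert (1 <= w ^ 2) by (rewrite <- (pow2_abs w); nra).
  assert (0 < / w ^ 2) by (apply Rinv_0_lt_compat; lra).
  pose proof (COS_bound w). set (q := (1 - cos w) / 2).
  assert (0 <= q <= 1) by (unfold q; lra).
  assert (0 <= q ^ 3) by (apply pow_le; lra).
  assert (q ^ 3 <= 1) by (rewrite <- (pow1 3); apply pow_incr; lra).
  split; [nra|].
  apply Rle_trans with (1 * / w ^ 2); [apply Rmult_le_compat_r; lra|].
  rewrite Rmult_1_l. replace (2 * / (1 + w ^ 2)) with (/ ((1 + w ^ 2) / 2)) by (field; lra).
  apply Rinv_le_contravar; lra.
Qed.

Section Decay.
Variables (phM dphM m0 dm0 : R -> R) (M0 : R).
(* [cos x >= 1/2] and [cos x <= -1/2] say that x is within pi/3 of 0, resp. of pi, modulo 2 pi. *)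
Hypothesis m0_hi : forall x, 1 / 2 <= cos x -> m0 x = 1 /\ dm0 x = 0.
Hypothesis m0_lo : forall x, cos x <= - (1 / 2) -> m0 x = 0 /\ dm0 x = 0.
Hypothesis m0_bound : forall x, Rabs (m0 x) <= 1.
Hypothesis dm0_bound : forall x, Rabs (dm0 x) <= M0.
Hypothesis phM_in : forall w, Rabs w <= 4 * PI / 3 -> phM w = m0 (w / 2) /\ dphM w = / 2 * dm0 (w / 2).
Hypothesis phM_out : forall w, 4 * PI / 3 <= Rabs w -> phM w = 0 /\ dphM w = 0.

Let M0_pos : 0 <= M0.
Proof. pose proof (dm0_bound 0); pose proof (Rabs_pos (dm0 0)); lra. Qed.

(** Outside cos x <= -1/2 one has [sixth x] >= (1/4)^3 = 1/64, so M2 * [sixth x] dominates the crude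
    bound M0 + 2 of m and dm there. The range imposed on d is exactly M2 * d <= 1. *)
Let M2 := 64 * (M0 + 2).

Variables (m dm ph dph : R -> R) (d : R).
Hypothesis d_range : 0 < d <= / (64 * (M0 + 2)).
Hypothesis m_close : forall x, Rabs (m x - m0 x) <= d.
Hypothesis dm_close : forall x, Rabs (dm x - dm0 x) <= d.
Hypothesis m_lo : forall x, cos x <= - (1 / 2) -> Rabs (m x) <= d * sixth x.
Hypothesis dm_lo : forall x, cos x <= - (1 / 2) -> Rabs (dm x) <= d * sixth x.
Hypothesis Dph : forall w, is_derive ph w (dph w).
Hypothesis Cdph : cont dph.
Hypothesis ph0 : ph 0 = 1.
Hypothesis ph_ref : forall w, ph w = m (w / 2) * ph (w / 2).
Hypothesis dph_ref : forall w, dph w = / 2 * (dm (w / 2) * ph (w / 2) + m (w / 2) * dph (w / 2)).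

Let d_small : d <= / 128.
Proof.
  apply Rle_trans with (1 := proj2 d_range). apply Rinv_le_contravar; lra.
Qed.
Let M2d : M2 * d <= 1.
Proof.
  unfold M2. apply Rle_trans with (64 * (M0 + 2) * / (64 * (M0 + 2))).
  - apply Rmult_le_compat_l; lra.
  - rewrite Rinv_r; lra.
Qed.

Lemma m_abs x : Rabs (m x) <= 1 + d.
Proof.
  replace (m x) with (m0 x + (m x - m0 x)) by ring. apply Rle_trans with (1 := Rabs_triang _ _).
  apply Rplus_le_compat; auto.
Qed.

Lemma dm_abs x : Rabs (dm x) <= M0 + d.
Proof.
  replace (dm x) with (dm0 x + (dm x - dm0 x)) by ring. apply Rle_trans with (1 := Rabs_triang _ _).
  apply Rplus_le_compat; auto.
Qed.

Lemma m_sixth x : Rabs (m x) <= M2 * sixth x /\ Rabs (dm x) <= M2 * sixth x.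
Proof.
  destruct (Rle_dec (cos x) (- (1 / 2))) as [H|H].
  - pose proof (sixth_pos x). split.
    + apply Rle_trans with (1 := m_lo x H). apply Rmult_le_compat_r; auto. unfold M2; lra.
    + apply Rle_trans with (1 := dm_lo x H). apply Rmult_le_compat_r; auto. unfold M2; lra.
  - assert (/ 64 <= sixth x).
    { unfold sixth. replace (/ 64) with ((1 / 4) ^ 3) by field. apply pow_incr; lra. }
    pose proof (m_abs x). pose proof (dm_abs x).
    assert (M0 + 2 <= M2 * sixth x); [|lra].
    replace (M0 + 2) with (M2 * / 64) by (unfold M2; field). apply Rmult_le_compat_l; auto. unfold M2; lra.
Qed.

(* Unless [cos x >= 1/2], one of x and 2x lies in the gap of the mask, and the factor d absorbs the constant; otherwise (1 + d)^2 <= 256 * 27/64 * 1/64. *)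
Lemma m_m_sixth x : Rabs (m x) * Rabs (m (2 * x)) <= 256 * (sixth x * sixth (2 * x)).
Proof.
  pose proof (sixth_pos x) as S1. pose proof (sixth_pos (2 * x)) as S2.
  assert (S12 := Rmult_le_pos _ _ S1 S2).
  destruct (Rle_dec (cos x) (- (1 / 2))) as [H|H].
  - apply Rle_trans with ((d * sixth x) * (M2 * sixth (2 * x))).
    + apply Rmult_le_compat; auto using Rabs_pos. apply m_sixth.
    + replace (d * sixth x * (M2 * sixth (2 * x))) with ((M2 * d) * (sixth x * sixth (2 * x))) by ring.
      apply Rmult_le_compat_r; lra.
  - destruct (Rle_dec (1 / 2) (cos x)) as [H1|H1].
    + assert (27 / 64 <= sixth x).
      { unfold sixth. replace (27 / 64) with ((3 / 4) ^ 3) by field. apply pow_incr; lra. }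
      assert (/ 64 <= sixth (2 * x)).
      { unfold sixth. rewrite cos_2a_cos. replace (/ 64) with ((1 / 4) ^ 3) by field. apply pow_incr; nra. }
      pose proof (m_abs x). pose proof (m_abs (2 * x)).
      pose proof (Rabs_pos (m x)). pose proof (Rabs_pos (m (2 * x))). nra.
    + assert (cos (2 * x) <= - (1 / 2)) by (rewrite cos_2a_cos; nra).
      apply Rle_trans with ((M2 * sixth x) * (d * sixth (2 * x))).
      * apply Rmult_le_compat; auto using Rabs_pos. apply m_sixth.
      * replace (M2 * sixth x * (d * sixth (2 * x))) with ((M2 * d) * (sixth x * sixth (2 * x))) by ring.
        apply Rmult_le_compat_r; lra.
Qed.

(* At a maximum of |ph'| on [|w| <= 2pi/3] the refinement equation reads B <= d A / 2 + (1 + d) B / 2 with A = sup |ph| <= 1 + 8 B / 3, since m0' vanishes there; this forces B = O(d). *)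
Lemma ph_near_0 w : Rabs w <= 2 * PI / 3 -> Rabs (dph w) <= 2 * d /\ Rabs (ph w - 1) <= 6 * d.
Proof.
  pose proof PI_RGT_0 as HPI. pose proof PI_4 as HPI4.
  destruct (continuity_ab_maj (fun w => Rabs (dph w)) (- (2 * PI / 3)) (2 * PI / 3)) as [wm [Hmax Hwm]].
  { lra. }
  { intros c _. apply continuity_pt_filterlim, (cont_abs dph Cdph). }
  set (B := Rabs (dph wm)) in *.
  assert (HB : forall v, Rabs v <= 2 * PI / 3 -> Rabs (dph v) <= B).
  { intros v Hv. apply Hmax. apply Rabs_le_between in Hv. lra. }
  assert (HB0 : 0 <= B) by apply Rabs_pos.
  (* The half-width 2 pi / 3 is at most 8 / 3 because pi <= 4. *)
  assert (HA : forall v, Rabs v <= 2 * PI / 3 -> Rabs (ph v - 1) <= 8 / 3 * B).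
  { intros v Hv. destruct (MVT_gen ph 0 v dph) as [c [Hc1 Hc2]].
    - intros; apply Dph.
    - intros; apply continuity_pt_filterlim, (is_derive_cont ph dph Dph).
    - rewrite <- ph0, Hc2, Rminus_0_r, Rabs_mult, Rmult_comm.
      apply Rmult_le_compat; auto using Rabs_pos.
      + lra.
      + apply HB. apply Rabs_le_between in Hv. apply Rabs_le.
        unfold Rmin, Rmax in Hc1; destruct (Rle_dec 0 v); lra. }
  assert (HBd : B <= 2 * d).
  { assert (Hh : Rabs (wm / 2) <= PI / 3) by (apply Rabs_le; lra).
    assert (E : B <= / 2 * (d * (1 + 8 / 3 * B) + (1 + d) * B)).
    { unfold B at 1. rewrite dph_ref, Rabs_mult, (Rabs_pos_eq (/ 2)) by lra.
      apply Rmult_le_compat_l; [lra|]. apply Rle_trans with (1 := Rabs_triang _ _). rewrite !Rabs_mult.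
      apply Rplus_le_compat; apply Rmult_le_compat; auto using Rabs_pos.
      - specialize (dm_close (wm / 2)). rewrite (proj2 (m0_hi _ (cos_ge_half _ Hh))), Rminus_0_r in dm_close. auto.
      - replace (ph (wm / 2)) with (1 + (ph (wm / 2) - 1)) by ring. apply Rle_trans with (1 := Rabs_triang _ _).
        rewrite Rabs_R1. apply Rplus_le_compat_l, HA. lra.
      - apply m_abs.
      - apply HB. lra. }
    nra. }
  intro Hw. split; [apply Rle_trans with B; auto|]. apply Rle_trans with (8 / 3 * B); auto. lra.
Qed.

(** A single refinement step: w / 2 lies in the range where ph is within 6 d of 1 and its derivative
    within 2 d of 0, so ph w is close to m0 (w / 2), which is phM w. *)
Lemma ph_middle w : Rabs w <= 4 * PI / 3 ->
  Rabs (ph w - phM w) <= 8 * d /\ Rabs (dph w - dphM w) <= (2 + 3 * M0) * d.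
Proof.
  intro Hw. pose proof PI_RGT_0.
  assert (Hh : Rabs (w / 2) <= 2 * PI / 3).
  { unfold Rdiv. rewrite Rabs_mult, (Rabs_pos_eq (/ 2)); lra. }
  destruct (ph_near_0 _ Hh) as [N1 N2]. destruct (phM_in _ Hw) as [E1 E2].
  assert (N3 : Rabs (ph (w / 2)) <= 3 / 2).
  { replace (ph (w / 2)) with (1 + (ph (w / 2) - 1)) by ring. apply Rle_trans with (1 := Rabs_triang _ _).
    rewrite Rabs_R1. lra. }
  split.
  - rewrite E1, ph_ref.
    replace (m (w / 2) * ph (w / 2) - m0 (w / 2)) with
      ((m (w / 2) - m0 (w / 2)) * ph (w / 2) + m0 (w / 2) * (ph (w / 2) - 1)) by ring.
    apply Rle_trans with (1 := Rabs_triang _ _). rewrite !Rabs_mult.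
    apply Rle_trans with (d * (3 / 2) + 1 * (6 * d)); [|lra].
    apply Rplus_le_compat; apply Rmult_le_compat; auto using Rabs_pos.
  - rewrite E2, dph_ref. rewrite <- Rmult_minus_distr_l, Rabs_mult, (Rabs_pos_eq (/ 2)) by lra.
    replace (dm (w / 2) * ph (w / 2) + m (w / 2) * dph (w / 2) - dm0 (w / 2)) with
      ((dm (w / 2) - dm0 (w / 2)) * ph (w / 2) + dm0 (w / 2) * (ph (w / 2) - 1) + m (w / 2) * dph (w / 2)) by ring.
    apply Rle_trans with (/ 2 * (d * (3 / 2) + M0 * (6 * d) + (1 + d) * (2 * d))); [|nra].
    apply Rmult_le_compat_l; [lra|].
    apply Rle_trans with (1 := Rabs_triang _ _). apply Rplus_le_compat.
    + apply Rle_trans with (1 := Rabs_triang _ _). rewrite !Rabs_mult.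
      apply Rplus_le_compat; apply Rmult_le_compat; auto using Rabs_pos.
    + rewrite Rabs_mult. apply Rmult_le_compat; auto using Rabs_pos, m_abs.
Qed.

Lemma ph_middle_abs w : Rabs w <= 4 * PI / 3 -> Rabs (ph w) <= 2 /\ Rabs (dph w) <= M2.
Proof.
  intro Hw. destruct (ph_middle _ Hw) as [H1 H2]. destruct (phM_in _ Hw) as [E1 E2].
  split.
  - replace (ph w) with (phM w + (ph w - phM w)) by ring. apply Rle_trans with (1 := Rabs_triang _ _).
    rewrite E1 at 1. specialize (m0_bound (w / 2)). lra.
  - replace (dph w) with (dphM w + (dph w - dphM w)) by ring. apply Rle_trans with (1 := Rabs_triang _ _).
    rewrite E2 at 1. rewrite Rabs_mult, (Rabs_pos_eq (/ 2)) by lra. specialize (dm0_bound (w / 2)).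
    assert ((2 + 3 * M0) * d <= (2 + 3 * M0) * / 128) by (apply Rmult_le_compat_l; lra).
    unfold M2. lra.
Qed.

(** Two refinement steps, from w / 4 to w. The bounds on the products of masks stay parameters: in
    the base case they are of size d, in the induction they are M2^2 and 256 times the sixth
    powers. *)
Lemma dph_step w (a b c : R) :
  Rabs (dm (w / 2)) * Rabs (m (w / 4)) <= a -> Rabs (m (w / 2)) * Rabs (dm (w / 4)) <= b ->
  Rabs (m (w / 2)) * Rabs (m (w / 4)) <= c ->
  Rabs (ph w) <= c * Rabs (ph (w / 4)) /\
  Rabs (dph w) <= (/ 2 * a + / 4 * b) * Rabs (ph (w / 4)) + / 4 * c * Rabs (dph (w / 4)).
Proof.
  intros Ha Hb Hc.
  assert (E4 : w / 2 / 2 = w / 4) by field.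
  split.
  - rewrite ph_ref, (ph_ref (w / 2)), E4, !Rabs_mult, <- Rmult_assoc.
    apply Rmult_le_compat_r; auto using Rabs_pos.
  - rewrite dph_ref, (dph_ref (w / 2)), (ph_ref (w / 2)), E4.
    replace (/ 2 * (dm (w / 2) * (m (w / 4) * ph (w / 4)) + m (w / 2) * (/ 2 * (dm (w / 4) * ph (w / 4) + m (w / 4) * dph (w / 4)))))
     with ((/ 2 * (dm (w / 2) * m (w / 4)) + / 4 * (m (w / 2) * dm (w / 4))) * ph (w / 4) + / 4 * (m (w / 2) * m (w / 4)) * dph (w / 4)) by field.
    apply Rle_trans with (1 := Rabs_triang _ _). rewrite (Rabs_mult _ (ph _)), (Rabs_mult _ (dph _)).
    apply Rplus_le_compat; apply Rmult_le_compat_r; auto using Rabs_pos.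
    + apply Rle_trans with (1 := Rabs_triang _ _). rewrite !Rabs_mult, (Rabs_pos_eq (/ 2)), (Rabs_pos_eq (/ 4)) by lra. lra.
    + rewrite !Rabs_mult, (Rabs_pos_eq (/ 4)) by lra. lra.
Qed.

(** Either |w| <= 8 pi / 3 and w / 2 is in the gap of the mask, or w / 4 is. One of the two factors
    therefore supplies d, and ph at w / 4 is only asked to be bounded. *)
Lemma ph_base w : 4 * PI / 3 <= Rabs w <= 16 * PI / 3 ->
  Rabs (ph w) <= 16 * M2 * d * envelope w /\ Rabs (dph w) <= 16 * M2 ^ 3 * d * envelope w.
Proof.
  pose proof PI_RGT_0 as HPI. pose proof PI_4 as HPI4. pose proof PI2_3_2 as HPI3.
  assert (HM2 : 128 <= M2) by (unfold M2; lra).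
  intro Hw.
  assert (Hw0 : w <> 0) by (intro E; rewrite E, Rabs_R0 in Hw; lra).
  assert (A4 : Rabs (w / 4) = Rabs w / 4) by (unfold Rdiv; rewrite Rabs_mult, (Rabs_pos_eq (/ 4)); lra).
  assert (A2 : Rabs (w / 2) = Rabs w / 2) by (unfold Rdiv; rewrite Rabs_mult, (Rabs_pos_eq (/ 2)); lra).
  set (s := sixth (w / 4) * sixth (w / 2)).
  assert (P4 := sixth_pos (w / 4)). assert (P2 := sixth_pos (w / 2)).
  assert (Hs : 0 <= s) by (apply Rmult_le_pos; auto).
  (* Here cos(w / 4) <= 1/2 and (w / 4)^2 <= (16 / 3)^2 <= 29, so [envelope (w / 4)] >= 1 / (64 *
     29) >= 1 / 2000, and 8 * 256 / 2000 >= 1. *)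
  assert (Hse : s <= 8 * envelope w).
  { rewrite envelope_step by auto. fold s.
    assert (/ 2000 <= envelope (w / 4)); [|nra].
    unfold envelope. assert (C := cos_le_half (w / 4) ltac:(lra)).
    assert (/ 64 <= ((1 - cos (w / 4)) / 2) ^ 3).
    { replace (/ 64) with ((1 / 4) ^ 3) by field. apply pow_incr; lra. }
    assert (Y : 0 < (w / 4) ^ 2 <= 29).
    { rewrite <- (pow2_abs (w / 4)), A4. split; [apply pow_lt; lra|]. nra. }
    assert (/ 29 <= / (w / 4) ^ 2) by (apply Rinv_le_contravar; lra).
    apply Rle_trans with (/ 64 * / 29); [lra|]. apply Rmult_le_compat; lra. }
  destruct (m_sixth (w / 2)) as [Q1 Q2]. destruct (m_sixth (w / 4)) as [Q3 Q4].
  assert (gap : forall p q, (p = Rabs (m (w / 2)) \/ p = Rabs (dm (w / 2))) ->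
     (q = Rabs (m (w / 4)) \/ q = Rabs (dm (w / 4))) -> p * q <= M2 * d * s).
  { intros p q Hp Hq.
    assert (Hp0 : 0 <= p) by (destruct Hp as [-> | ->]; apply Rabs_pos).
    assert (Hq0 : 0 <= q) by (destruct Hq as [-> | ->]; apply Rabs_pos).
    assert (Hp1 : p <= M2 * sixth (w / 2)) by (destruct Hp as [-> | ->]; auto).
    assert (Hq1 : q <= M2 * sixth (w / 4)) by (destruct Hq as [-> | ->]; auto).
    destruct (Rle_dec (Rabs w) (8 * PI / 3)).
    - assert (C := cos_le_mhalf (w / 2) ltac:(lra)).
      assert (Hp2 : p <= d * sixth (w / 2)) by (destruct Hp as [-> | ->]; auto).
      replace (M2 * d * s) with ((d * sixth (w / 2)) * (M2 * sixth (w / 4))) by (unfold s; ring).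
      apply Rmult_le_compat; auto.
    - assert (C := cos_le_mhalf (w / 4) ltac:(lra)).
      assert (Hq2 : q <= d * sixth (w / 4)) by (destruct Hq as [-> | ->]; auto).
      replace (M2 * d * s) with ((M2 * sixth (w / 2)) * (d * sixth (w / 4))) by (unfold s; ring).
      apply Rmult_le_compat; auto. }
  destruct (dph_step w (M2 * d * s) (M2 * d * s) (M2 * d * s)) as [R1 R2]; auto.
  destruct (ph_middle_abs (w / 4) ltac:(lra)) as [B1 B2].
  assert (Hmd : 0 <= M2 * d) by (apply Rmult_le_pos; lra).
  assert (Hmds : 0 <= M2 * d * s) by (apply Rmult_le_pos; auto).
  assert (Hmds2 : M2 * d * s <= M2 * d * (8 * envelope w)) by (apply Rmult_le_compat_l; auto).
  assert (Hen : 0 <= M2 * d * envelope w) by lra.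
  split.
  - apply Rle_trans with (1 := R1). apply Rle_trans with (M2 * d * s * 2); [apply Rmult_le_compat_l; auto|]. lra.
  - apply Rle_trans with (1 := R2).
    apply Rle_trans with ((/ 2 * (M2 * d * s) + / 4 * (M2 * d * s)) * 2 + / 4 * (M2 * d * s) * M2).
    + apply Rplus_le_compat; apply Rmult_le_compat_l; auto; lra.
    + replace ((/ 2 * (M2 * d * s) + / 4 * (M2 * d * s)) * 2 + / 4 * (M2 * d * s) * M2) with
        (M2 * d * s * (3 / 2 + M2 / 4)) by field.
      replace (16 * M2 ^ 3 * d * envelope w) with (M2 * d * (8 * envelope w) * (2 * M2 ^ 2)) by ring.
      apply Rmult_le_compat; auto; [lra|nra].
Qed.

(** Induction on the scale, from w / 4 to w. For ph the factor 256 s is exactly the growth of the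
    envelope, so the constant 16 M2 is preserved. Where the mask is differentiated only M2^2 s is
    available; the extra M2^2 in the constant for dph absorbs this, and the chain-rule factor 1/4
    leaves the room: 12 + 1024 <= 4096. *)
Lemma ph_tail n : forall w, 4 * PI / 3 <= Rabs w <= 4 ^ n * (16 * PI / 3) ->
  Rabs (ph w) <= 16 * M2 * d * envelope w /\ Rabs (dph w) <= 16 * M2 ^ 3 * d * envelope w.
Proof.
  pose proof PI_RGT_0 as HPI.
  assert (HM2 : 128 <= M2) by (unfold M2; lra).
  induction n; intros w Hw; (destruct (Rle_dec (Rabs w) (16 * PI / 3)) as [Hb|Hb]; [apply ph_base; lra|]).
  { simpl in Hw; lra. }
  assert (Hw0 : w <> 0) by (intro E; rewrite E, Rabs_R0 in Hb; lra).
  assert (A4 : Rabs (w / 4) = Rabs w / 4) by (unfold Rdiv; rewrite Rabs_mult, (Rabs_pos_eq (/ 4)); lra).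
  destruct (IHn (w / 4)) as [I1 I2]; [simpl in Hw; lra|].
  destruct (m_sixth (w / 2)) as [Q1 Q2]. destruct (m_sixth (w / 4)) as [Q3 Q4].
  assert (P4 := sixth_pos (w / 4)). assert (P2 := sixth_pos (w / 2)).
  set (s := sixth (w / 4) * sixth (w / 2)).
  assert (Hs : 0 <= s) by (apply Rmult_le_pos; auto).
  set (e := envelope (w / 4)) in *.
  assert (Ee : envelope w = 256 * e * s) by (apply envelope_step; auto).
  assert (prod : forall p q, 0 <= p -> 0 <= q -> p <= M2 * sixth (w / 2) -> q <= M2 * sixth (w / 4) ->
    p * q <= M2 ^ 2 * s).
  { intros p q Hp Hq Hp1 Hq1. replace (M2 ^ 2 * s) with ((M2 * sixth (w / 2)) * (M2 * sixth (w / 4))) by (unfold s; ring).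
    apply Rmult_le_compat; auto. }
  destruct (dph_step w (M2 ^ 2 * s) (M2 ^ 2 * s) (256 * s)) as [R1 R2].
  - apply prod; auto using Rabs_pos.
  - apply prod; auto using Rabs_pos.
  - assert (Q := m_m_sixth (w / 4)). replace (2 * (w / 4)) with (w / 2) in Q by field.
    rewrite Rmult_comm. exact Q.
  - split.
    + apply Rle_trans with (1 := R1). rewrite Ee.
      replace (16 * M2 * d * (256 * e * s)) with (256 * s * (16 * M2 * d * e)) by ring.
      apply Rmult_le_compat_l; auto; lra.
    + apply Rle_trans with (1 := R2). rewrite Ee.
      assert (HM2s : 0 <= M2 ^ 2 * s) by (apply Rmult_le_pos; auto; apply pow2_ge_0).
      apply Rle_trans with ((/ 2 * (M2 ^ 2 * s) + / 4 * (M2 ^ 2 * s)) * (16 * M2 * d * e) + / 4 * (256 * s) * (16 * M2 ^ 3 * d * e)).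
      * apply Rplus_le_compat; apply Rmult_le_compat_l; auto; lra.
      * assert (X : 0 <= M2 ^ 3 * d * e * s).
        { assert (0 <= 16 * M2 * d * e) by (apply Rle_trans with (2 := I1); apply Rabs_pos).
          replace (M2 ^ 3 * d * e * s) with (/ 16 * (M2 ^ 2 * s) * (16 * M2 * d * e)) by field.
          apply Rmult_le_pos; lra. }
        replace (16 * M2 ^ 3 * d * (256 * e * s)) with (4096 * (M2 ^ 3 * d * e * s)) by ring.
        replace ((/ 2 * (M2 ^ 2 * s) + / 4 * (M2 ^ 2 * s)) * (16 * M2 * d * e) + / 4 * (256 * s) * (16 * M2 ^ 3 * d * e))
          with (1036 * (M2 ^ 3 * d * e * s)) by field.
        lra.
Qed.

(** The constant 30 bounds 1 + w^2 on |w| <= 4 pi / 3, again through pi <= 4, and 32 is 16 times the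
    2 of [envelope_le]. *)
Lemma ph_close :
  decays ((30 * (8 + 3 * M0) + 32 * M2 ^ 3) * d) (fun w => ph w - phM w) /\
  decays ((30 * (8 + 3 * M0) + 32 * M2 ^ 3) * d) (fun w => dph w - dphM w).
Proof.
  pose proof PI_RGT_0 as HPI. pose proof PI_4 as HPI4. pose proof PI2_3_2 as HPI3.
  assert (HM2 : 128 <= M2) by (unfold M2; lra).
  assert (HM23 : M2 <= M2 ^ 3) by nra.
  assert (HM3d : 0 <= M2 ^ 3 * d) by (apply Rmult_le_pos; [apply pow_le|]; lra).
  assert (HM2d : 0 <= M2 * d <= M2 ^ 3 * d) by (split; [apply Rmult_le_pos|apply Rmult_le_compat_r]; lra).
  assert (HM0d : 0 <= M0 * d) by (apply Rmult_le_pos; lra).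
  assert (key : forall w, Rabs (ph w - phM w) <= (30 * (8 + 3 * M0) + 32 * M2 ^ 3) * d * / (1 + w ^ 2) /\
    Rabs (dph w - dphM w) <= (30 * (8 + 3 * M0) + 32 * M2 ^ 3) * d * / (1 + w ^ 2)).
  { intro w. pose proof (inv_one_plus_sqr w) as HI.
    destruct (Rle_dec (Rabs w) (4 * PI / 3)) as [Hw|Hw].
    - destruct (ph_middle w Hw) as [H1 H2].
      assert (Y : 1 <= 30 * / (1 + w ^ 2)).
      { apply Rmult_le_reg_r with (1 + w ^ 2); [pose proof (one_plus_sqr_pos w); lra|].
        rewrite Rmult_assoc, Rinv_l by (pose proof (one_plus_sqr_pos w); lra).
        rewrite <- (pow2_abs w). pose proof (Rabs_pos w). nra. }
      set (y := / (1 + w ^ 2)) in *.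
      assert (X : (8 + 3 * M0) * d <= (30 * (8 + 3 * M0) + 32 * M2 ^ 3) * d * y).
      { apply Rle_trans with ((8 + 3 * M0) * d * (30 * y)).
        - rewrite <- (Rmult_1_r ((8 + 3 * M0) * d)) at 1. apply Rmult_le_compat_l; lra.
        - replace ((8 + 3 * M0) * d * (30 * y)) with (30 * (8 + 3 * M0) * d * y) by ring.
          apply Rmult_le_compat_r; lra. }
      split; lra.
    - destruct (phM_out w ltac:(lra)) as [-> ->]. rewrite !Rminus_0_r.
      assert (N : exists n, Rabs w <= 4 ^ n * (16 * PI / 3)).
      { destruct (Pow_x_infinity 4 ltac:(rewrite Rabs_pos_eq; lra) (Rabs w)) as [n Hn].
        exists n. specialize (Hn n (le_n n)). rewrite Rabs_pos_eq in Hn by (apply pow_le; lra).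
        assert (0 < 4 ^ n) by (apply pow_lt; lra). nra. }
      destruct N as [n Hn]. destruct (ph_tail n w ltac:(lra)) as [H1 H2].
      destruct (envelope_le w ltac:(lra)) as [E1 E2].
      set (y := / (1 + w ^ 2)) in *. set (e := envelope w) in *.
      assert (X : 16 * M2 ^ 3 * d * e <= (30 * (8 + 3 * M0) + 32 * M2 ^ 3) * d * y).
      { apply Rle_trans with (16 * M2 ^ 3 * d * (2 * y)); [apply Rmult_le_compat_l; lra|].
        replace (16 * M2 ^ 3 * d * (2 * y)) with (32 * M2 ^ 3 * d * y) by ring.
        apply Rmult_le_compat_r; lra. }
      assert (16 * M2 * d * e <= 16 * M2 ^ 3 * d * e) by (apply Rmult_le_compat_r; lra).
      split; lra. }
  split; intro w; apply key.
Qed.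
End Decay.

(** * Periodization and orthonormalization *)

Lemma periodic_Z (f : R -> R) : (forall x, f (x + 2 * PI) = f x) ->
  forall (z : Z) x, f (x + 2 * PI * IZR z) = f x.
Proof.
  intros H.
  assert (N : forall n x, f (x + 2 * PI * INR n) = f x).
  { induction n; intro x.
    - change (INR 0) with 0. f_equal. ring.
    - rewrite <- (IHn x), <- (H (x + 2 * PI * INR n)), S_INR. f_equal. ring. }
  intros z x. destruct (Z.le_ge_cases 0 z) as [Hz|Hz].
  - rewrite <- (Z2Nat.id z Hz), <- INR_IZR_INZ. apply N.
  - rewrite <- (N (Z.to_nat (- z)) (x + 2 * PI * IZR z)). f_equal.
    rewrite INR_IZR_INZ, Z2Nat.id, opp_IZR by lia. ring.
Qed.

Lemma mod_2pi (a x : R) : exists z : Z, a <= x - 2 * PI * IZR z < a + 2 * PI.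
Proof.
  pose proof PI_RGT_0 as HPI. exists (up ((x - a) / (2 * PI)) - 1)%Z.
  destruct (archimed ((x - a) / (2 * PI))) as [H1 H2]. rewrite minus_IZR.
  set (u := IZR (up ((x - a) / (2 * PI)))) in *.
  assert (E : x - a = 2 * PI * ((x - a) / (2 * PI))) by (field; lra).
  set (q := (x - a) / (2 * PI)) in *. nra.
Qed.

(** The summand of [periodization] without the square, so that the derivative 2 q q' of a square can
    be summed as well. *)
Definition per_term (h : R -> R) (w : R) (n : nat) : R :=
  match n with
  | O => h w
  | S _ => h (w + 2 * PI * INR n) + h (w - 2 * PI * INR n)
  end.

Definition per (h : R -> R) (w : R) : R := Series (per_term h w).

Lemma sum_n_succ (a : nat -> R) n : sum_n a (S n) = sum_n a n + a (S n) :> R.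
Proof. apply (sum_Sn a n). Qed.

Lemma per_term_bound c h w n k : decays c h -> 0 < k -> k <= 2 * PI * INR (S n) - Rabs w ->
  Rabs (per_term h w (S n)) <= 2 * c * / (1 + k ^ 2).
Proof.
  intros Hd Hk H. cbn [per_term].
  apply Rle_trans with (1 := Rabs_triang _ _).
  pose proof (decays_nonneg _ _ Hd).
  assert (B : forall y, k <= Rabs y -> Rabs (h y) <= c * / (1 + k ^ 2)).
  { intros y Hy. apply Rle_trans with (1 := Hd y). apply Rmult_le_compat_l; auto.
    apply Rinv_le_contravar; [apply one_plus_sqr_pos|]. rewrite <- (pow2_abs y). nra. }
  pose proof (Rle_abs w). pose proof (Rle_abs (- w)). rewrite Rabs_Ropp in *.
  assert (B1 := B (w + 2 * PI * INR (S n)) ltac:(apply Rle_trans with (2 := Rle_abs _); lra)).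
  assert (B2 := B (w - 2 * PI * INR (S n)) ltac:(rewrite <- Rabs_Ropp; apply Rle_trans with (2 := Rle_abs _); lra)).
  lra.
Qed.

(** Since |w| < n, the translated points are at distance at least n + 1 from 0, and 1 / (1 +
    (n+1)^2) <= 1 / n - 1 / (n+1). *)
Lemma per_increment c h w A n : decays c h -> Rabs w < A -> (1 <= n)%nat -> A <= INR n ->
  Rabs (sum_n (per_term h w) (S n) - sum_n (per_term h w) n) <= 2 * c * / INR n - 2 * c * / INR (S n).
Proof.
  intros Hd Hw Hn HA. rewrite sum_n_succ.
  replace (sum_n (per_term h w) n + per_term h w (S n) - sum_n (per_term h w) n) with (per_term h w (S n)) by ring.
  pose proof PI2_3_2. apply le_INR in Hn; simpl in Hn. pose proof (decays_nonneg _ _ Hd).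
  apply Rle_trans with (2 * c * / (1 + INR (S n) ^ 2)).
  - apply per_term_bound; auto; rewrite S_INR in *; nra.
  - rewrite S_INR. rewrite <- Rmult_minus_distr_l. apply Rmult_le_compat_l; [lra|].
    replace (/ INR n - / (INR n + 1)) with (/ (INR n * (INR n + 1))) by (field; lra).
    apply Rinv_le_contravar; nra.
Qed.

Section Per.
Variables (c : R) (h dh : R -> R).
Hypothesis Dh : forall x, is_derive h x (dh x).
Hypothesis Cdh : cont dh.
Hypothesis Hd : decays c h.
Hypothesis Hdd : decays c dh.

Lemma sum_n_derive (N : nat) w : is_derive (fun w => sum_n (per_term h w) N) w (sum_n (per_term dh w) N).
Proof.
  assert (T : forall k, is_derive (fun w => h (w + k)) w (dh (w + k))).
  { intro k. replace (dh (w + k)) with (1 * dh (w + k)) by ring.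
    apply (is_derive_comp h (fun w => w + k)); auto. auto_derive; auto; ring. }
  apply (is_derive_sum_n (fun n w => per_term h w n) N w (fun n => per_term dh w n)).
  intros [|k] _; cbn [per_term]; [apply Dh|].
  apply (is_derive_plus (fun w => h (w + 2 * PI * INR (S k))) (fun w => h (w - 2 * PI * INR (S k)))); [apply T|apply (T (- _))].
Qed.

Lemma sum_n_cont (f : R -> R) N : cont f -> cont (fun w => sum_n (per_term f w) N).
Proof.
  intro Hf.
  assert (P : forall n, cont (fun w => per_term f w n)).
  { intros [|n]; cbn [per_term]; auto.
    apply cont_plus; [apply (cont_comp f (fun w => w + 2 * PI * INR (S n)))|apply (cont_comp f (fun w => w - 2 * PI * INR (S n)))]; auto with cont. }
  induction N; intro x.
  - apply continuous_ext with (fun w => per_term f w 0); [intro; now rewrite sum_O|apply P].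
  - apply continuous_ext with (fun w => sum_n (per_term f w) N + per_term f w (S N)); [intro; now rewrite sum_n_succ|].
    apply (cont_plus (fun w => sum_n (per_term f w) N) (fun w => per_term f w (S N))); auto.
Qed.

Lemma per_C1 x :
  is_lim_seq (sum_n (per_term h x)) (per h x) /\ is_lim_seq (sum_n (per_term dh x)) (per dh x) /\
  is_derive (per h) x (per dh x) /\ continuous (per dh) x.
Proof.
  set (A := Rabs x + 1).
  assert (HA : 0 <= A) by (unfold A; pose proof (Rabs_pos x); lra).
  destruct (nfloor_ex A HA) as [n0 [_ Hn0]].
  assert (HN : forall n, (S n0 <= n)%nat -> (1 <= n)%nat /\ A <= INR n).
  { intros n Hn. split; [lia|]. apply le_INR in Hn. rewrite S_INR in Hn. lra. }
  apply (C1_limit (fun N w => sum_n (per_term h w) N) (fun N w => sum_n (per_term dh w) N) A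
           (fun n => 2 * c * / INR n) 0 (S n0)).
  - intros; apply sum_n_derive.
  - intros; now apply sum_n_cont.
  - intros n y Hn Hy. destruct (HN n Hn). now apply per_increment with A.
  - intros n y Hn Hy. destruct (HN n Hn). now apply per_increment with A.
  - replace (Finite 0) with (Rbar_mult (2 * c) 0) by (simpl; f_equal; ring).
    apply is_lim_seq_scal_l. replace (Finite 0) with (Rbar_inv p_infty) by reflexivity.
    apply is_lim_seq_inv; [apply is_lim_seq_INR | discriminate].
  - unfold A; lra.
Qed.
End Per.

Section PerBound.
Variables (c : R) (h : R -> R).
Hypothesis Hd : decays c h.
Hypothesis Hconv : forall x, is_lim_seq (sum_n (per_term h x)) (per h x).

(** A shift by 2 pi changes the symmetric partial sum only by h(w + 2 pi (N+1)) - h(w - 2 pi N), and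
    both terms vanish in the limit by decay. *)
Lemma per_periodic w : per h (w + 2 * PI) = per h w.
Proof.
  pose proof PI_RGT_0 as HPI.
  assert (E : forall N, sum_n (per_term h (w + 2 * PI)) N =
    sum_n (per_term h w) N + (h (w + 2 * PI * INR (S N)) - h (w - 2 * PI * INR N)) :> R).
  { induction N.
    - rewrite !sum_O. cbn [per_term].
      change (h (w + 2 * PI) = h w + (h (w + 2 * PI * 1) - h (w - 2 * PI * 0))).
      rewrite Rmult_1_r, Rmult_0_r, Rminus_0_r. ring.
    - rewrite !sum_n_succ, IHN. cbn [per_term].
      replace (w + 2 * PI - 2 * PI * INR (S N)) with (w - 2 * PI * INR N) by (rewrite S_INR; ring).
      replace (w + 2 * PI + 2 * PI * INR (S N)) with (w + 2 * PI * INR (S (S N))) by (rewrite (S_INR (S N)); ring).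
      ring. }
  assert (Z : forall s, (s = 1 \/ s = -1) -> is_lim_seq (fun n => h (w + s * (2 * PI * INR n))) 0).
  { intros s Hs. apply is_lim_seq_abs_0. pose proof (decays_nonneg _ _ Hd).
    assert (HA : 0 <= Rabs w) by apply Rabs_pos.
    destruct (nfloor_ex (Rabs w) HA) as [n0 [_ Hn0]].
    apply (is_lim_seq_le_le_loc (fun _ => 0) _ (fun n => c * / INR n)); auto using is_lim_seq_const.
    - exists (S n0). intros n Hn. apply le_INR in Hn. rewrite S_INR in Hn. split; [apply Rabs_pos|].
      apply Rle_trans with (1 := Hd _). apply Rmult_le_compat_l; auto.
      pose proof (pos_INR n0). pose proof PI2_3_2.
      apply Rinv_le_contravar; [lra|].
      rewrite <- pow2_abs.
      assert (INR n <= Rabs (w + s * (2 * PI * INR n))).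
      { pose proof (Rle_abs w). pose proof (Rle_abs (- w)). rewrite Rabs_Ropp in *.
        destruct Hs as [-> | ->].
        - apply Rle_trans with (2 := Rle_abs _). nra.
        - rewrite <- Rabs_Ropp. apply Rle_trans with (2 := Rle_abs _). nra. }
      nra.
    - replace (Finite 0) with (Rbar_mult c 0) by (simpl; f_equal; ring).
      apply is_lim_seq_scal_l. replace (Finite 0) with (Rbar_inv p_infty) by reflexivity.
      apply is_lim_seq_inv; [apply is_lim_seq_INR | discriminate]. }
  assert (Z1 := Z 1 (or_introl eq_refl)). assert (Z2 := Z (-1) (or_intror eq_refl)).
  apply is_lim_seq_incr_1 in Z1.
  assert (L := is_lim_seq_plus' _ _ _ _ (Hconv w) (is_lim_seq_minus' _ _ _ _ Z1 Z2)).
  assert (L2 := Hconv (w + 2 * PI)).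
  apply is_lim_seq_unique in L2.
  rewrite (Lim_seq_ext _ _ (fun n => E n)) in L2.
  rewrite (Lim_seq_ext _ (fun n => sum_n (per_term h w) n + (h (w + 1 * (2 * PI * INR (S n))) - h (w + -1 * (2 * PI * INR n))))) in L2.
  2:{ intro n. do 2 f_equal; f_equal; ring. }
  apply is_lim_seq_unique in L. rewrite L in L2. injection L2. lra.
Qed.

(** By periodicity |w| <= pi may be assumed. Then the central term is at most c and the n-th pair at
    most 2 c / (1 + n^2) <= 4 c (1 / n - 1 / (n+1)), which telescopes to 4 c. *)
Lemma per_bound w : Rabs (per h w) <= 5 * c.
Proof.
  pose proof PI_RGT_0 as HPI. pose proof PI2_3_2. pose proof (decays_nonneg _ _ Hd) as Hc.
  destruct (mod_2pi (- PI) w) as [z Hz].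
  replace (per h w) with (per h (w - 2 * PI * IZR z)).
  2:{ rewrite <- (periodic_Z (per h) per_periodic z). f_equal; ring. }
  set (x := w - 2 * PI * IZR z) in *.
  assert (Hx : Rabs x <= PI) by (apply Rabs_le; lra).
  assert (S1 : forall N, Rabs (sum_n (per_term h x) N) <= c + 4 * c * (1 - / INR (S N))).
  { induction N.
    - rewrite sum_O. cbn [per_term]. simpl. rewrite Rinv_1.
      pose proof (decays_bound c h x Hd). lra.
    - rewrite sum_n_succ. apply Rle_trans with (1 := Rabs_triang _ _).
      assert (B : Rabs (per_term h x (S N)) <= 2 * c * / (1 + INR (S N) ^ 2)).
      { pose proof (pos_INR N). apply per_term_bound; auto; rewrite S_INR; nra. }
      apply Rle_trans with (1 := Rplus_le_compat _ _ _ _ IHN B).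
      pose proof (pos_INR N). rewrite (S_INR (S N)), S_INR. set (n := INR N) in *.
      assert (/ (1 + (n + 1) ^ 2) <= 2 * (/ (n + 1) - / (n + 1 + 1))).
      { replace (2 * (/ (n + 1) - / (n + 1 + 1))) with (/ ((n + 1) * (n + 1 + 1) / 2)) by (field; lra).
        apply Rinv_le_contravar; nra. }
      assert (2 * c * / (1 + (n + 1) ^ 2) <= 2 * c * (2 * (/ (n + 1) - / (n + 1 + 1)))) by (apply Rmult_le_compat_l; lra).
      lra. }
  apply (is_lim_seq_le (fun n => Rabs (sum_n (per_term h x) n)) (fun _ => 5 * c) (Rabs (per h x)) (5 * c)).
  - intro n. apply Rle_trans with (1 := S1 n).
    assert (0 < / INR (S n)) by (apply Rinv_0_lt_compat, lt_0_INR; lia). nra.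
  - apply (is_lim_seq_abs _ (Finite (per h x))), Hconv.
  - apply is_lim_seq_const.
Qed.
End PerBound.

Lemma per_minus f g x : is_lim_seq (sum_n (per_term f x)) (per f x) ->
  is_lim_seq (sum_n (per_term g x)) (per g x) ->
  is_lim_seq (sum_n (per_term (fun y => f y - g y) x)) (per f x - per g x).
Proof.
  intros Hf Hg. apply is_lim_seq_ext with (2 := is_lim_seq_minus' _ _ _ _ Hf Hg).
  induction n.
  - now rewrite !sum_O.
  - rewrite !sum_n_succ, <- IHn. cbn [per_term]. ring.
Qed.

Lemma per_minus_bound c f g x : decays c (fun y => f y - g y) ->
  (forall x, is_lim_seq (sum_n (per_term f x)) (per f x)) ->
  (forall x, is_lim_seq (sum_n (per_term g x)) (per g x)) ->
  Rabs (per f x - per g x) <= 5 * c.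
Proof.
  intros Hd Hf Hg.
  assert (E : forall x, per (fun y => f y - g y) x = per f x - per g x).
  { intro y. unfold per at 1, Series. now rewrite (is_lim_seq_unique _ _ (per_minus f g y (Hf y) (Hg y))). }
  rewrite <- E. apply per_bound; auto.
  intro y. rewrite E. now apply per_minus.
Qed.

Lemma decays_mult a b f g : decays a f -> decays b g -> decays (a * b) (fun x => f x * g x).
Proof.
  intros Hf Hg. apply decays_mult_bounded; auto. intro; now apply decays_bound.
Qed.

Lemma decays_ext c f g : (forall x, f x = g x) -> decays c f -> decays c g.
Proof. intros E H x. rewrite <- E. apply H. Qed.

(** * Orthonormalization of a small perturbation of an orthonormal generator *)

Section Orthonormalize.
Variables (c : R) (p dp : R -> R).
Hypothesis Np : nice c p dp.
Hypothesis per_p : forall w, per (fun x => p x ^ 2) w = 1.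

Variables (e : R) (q dq : R -> R).
(** This size gives |Phi - 1| <= 5 e (2 c + 1) <= 1 / 4, which keeps the periodization away from
    0. *)
Hypothesis He : 0 <= e <= / (20 * (2 * c + 1)).
Hypothesis Dq : forall x, is_derive q x (dq x).
Hypothesis Cdq : cont dq.
Hypothesis close : decays e (fun x => q x - p x).
Hypothesis dclose : decays e (fun x => dq x - dp x).

Let c_pos : 0 <= c.
Proof. destruct Np as [_ [_ [H _]]]. now apply decays_nonneg with p. Qed.
Let e_small : e <= / 20.
Proof. apply Rle_trans with (1 := proj2 He). apply Rinv_le_contravar; lra. Qed.
Let e_small2 : 5 * (e * (2 * c + 1)) <= / 4.
Proof.
  apply Rle_trans with (5 * (/ (20 * (2 * c + 1)) * (2 * c + 1))).
  - apply Rmult_le_compat_l; [lra|]. apply Rmult_le_compat_r; lra.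
  - right; field; lra.
Qed.

Lemma perturbed_nice : nice (c + 1) q dq.
Proof.
  destruct Np as [H1 [H2 [H3 H4]]].
  assert (W : forall a b, decays c b -> decays e (fun w => a w - b w) -> decays (c + 1) a).
  { intros a b Hb Hab x. specialize (Hb x). specialize (Hab x). pose proof (inv_one_plus_sqr x).
    replace (a x) with (b x + (a x - b x)) by ring. apply Rle_trans with (1 := Rabs_triang _ _). nra. }
  split; [|split; [|split]]; auto.
  - now apply W with p.
  - now apply W with dp.
Qed.

Lemma square_nice k g dg : nice k g dg ->
  (forall x, is_derive (fun x => g x ^ 2) x (2 * (g x * dg x))) /\
  cont (fun x => 2 * (g x * dg x)) /\ decays (2 * k ^ 2) (fun x => g x ^ 2) /\ decays (2 * k ^ 2) (fun x => 2 * (g x * dg x)).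
Proof.
  intro Hn. pose proof (nice_cont _ _ _ Hn). destruct Hn as [H1 [H2 [H3 H4]]].
  split; [|split; [|split]]; auto with cont.
  - intro x. apply (is_derive_ext (fun x => g x * g x)); [intro t; change (g t * g t = g t ^ 2); ring|].
    replace (2 * (g x * dg x)) with (dg x * g x + g x * dg x) by ring.
    apply (is_derive_mult g g); auto. intros; apply Rmult_comm.
  - apply decays_le with (k * k); [pose proof (pow2_ge_0 k); nra|].
    intro x. replace (g x ^ 2) with (g x * g x) by ring. now apply decays_mult.
  - intro x. rewrite Rabs_mult, (Rabs_pos_eq 2) by lra. replace (2 * k ^ 2 * / (1 + x ^ 2)) with (2 * (k * k * / (1 + x ^ 2))) by ring.
    apply Rmult_le_compat_l; [lra|]. now apply decays_mult.
Qed.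

Let Phi w := per (fun x => q x ^ 2) w.
Let dPhi w := per (fun x => 2 * (q x * dq x)) w.

Lemma Phi_C1 : (forall w, is_derive Phi w (dPhi w)) /\ cont dPhi.
Proof.
  destruct (square_nice _ _ _ perturbed_nice) as [H1 [H2 [H3 H4]]].
  split; intro w; destruct (per_C1 _ _ _ H1 H2 H3 H4 w) as [_ [_ [D C]]]; [exact D|exact C].
Qed.

Lemma Phi_close w : Rabs (Phi w - 1) <= 5 * (e * (2 * c + 1)).
Proof.
  destruct (square_nice _ _ _ perturbed_nice) as [H1 [H2 [H3 H4]]].
  destruct (square_nice _ _ _ Np) as [G1 [G2 [G3 G4]]].
  replace (Phi w - 1) with (Phi w - per (fun x => p x ^ 2) w) by (rewrite per_p; reflexivity).
  apply per_minus_bound.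
  - intro x. replace (q x ^ 2 - p x ^ 2) with ((q x - p x) * (q x + p x)) by ring.
    apply (decays_mult e (2 * c + 1) (fun x => q x - p x) (fun x => q x + p x)); auto.
    replace (2 * c + 1) with ((c + 1) + c) by ring. apply decays_plus; [apply perturbed_nice|apply Np].
  - intro x; exact (proj1 (per_C1 _ _ _ H1 H2 H3 H4 x)).
  - intro x; exact (proj1 (per_C1 _ _ _ G1 G2 G3 G4 x)).
Qed.

(** The periodization of p^2 is constant, so that of 2 p p' is 0; hence dPhi is itself a difference
    of two periodizations of close functions. *)
Lemma dPhi_small w : Rabs (dPhi w) <= 10 * (e * (2 * c + 1)).
Proof.
  destruct (square_nice _ _ _ perturbed_nice) as [H1 [H2 [H3 H4]]].
  destruct (square_nice _ _ _ Np) as [G1 [G2 [G3 G4]]].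
  assert (Z : per (fun x => 2 * (p x * dp x)) w = 0).
  { assert (D := proj1 (proj2 (proj2 (per_C1 _ _ _ G1 G2 G3 G4 w)))).
    apply is_derive_unique in D.
    transitivity (Derive (per (fun x => p x ^ 2)) w); [symmetry; exact D|].
    rewrite (Derive_ext _ (fun _ => 1)) by apply per_p. apply Derive_const. }
  rewrite <- (Rminus_0_r (dPhi w)), <- Z.
  replace (10 * (e * (2 * c + 1))) with (5 * (2 * (e * (2 * c + 1)))) by ring.
  apply per_minus_bound.
  - intro x. replace (2 * (q x * dq x) - 2 * (p x * dp x)) with (2 * ((q x - p x) * dq x + (dq x - dp x) * p x)) by ring.
    rewrite Rabs_mult, (Rabs_pos_eq 2), Rmult_assoc by lra. apply Rmult_le_compat_l; [lra|].
    replace (e * (2 * c + 1)) with (e * (c + 1) + e * c) by ring.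
    apply (decays_plus (e * (c + 1)) (e * c) (fun x => (q x - p x) * dq x) (fun x => (dq x - dp x) * p x)).
    + apply (decays_mult e (c + 1) (fun x => q x - p x) dq); auto. apply perturbed_nice.
    + apply (decays_mult e c (fun x => dq x - dp x) p); auto. apply Np.
  - intro x; exact (proj1 (proj2 (per_C1 _ _ _ H1 H2 H3 H4 x))).
  - intro x; exact (proj1 (proj2 (per_C1 _ _ _ G1 G2 G3 G4 x))).
Qed.

Let r w := / sqrt (Phi w).
Let dr w := - (dPhi w / (2 * sqrt (Phi w))) / (sqrt (Phi w)) ^ 2.

Lemma sqrt_Phi w : / 2 <= sqrt (Phi w) /\ 3 / 4 <= Phi w.
Proof.
  assert (H := Phi_close w). apply Rabs_le_between in H.
  assert (3 / 4 <= Phi w) by lra. split; auto.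
  rewrite <- (sqrt_Rsqr (/ 2)) by lra. apply sqrt_le_1_alt. unfold Rsqr; lra.
Qed.

Lemma r_derive w : is_derive r w (dr w).
Proof.
  destruct (sqrt_Phi w) as [H1 H2].
  apply (is_derive_inv (fun w => sqrt (Phi w)) w); [|lra].
  replace (dPhi w / (2 * sqrt (Phi w))) with (dPhi w * / (2 * sqrt (Phi w))) by reflexivity.
  apply (is_derive_comp sqrt Phi w (/ (2 * sqrt (Phi w)))); [|apply Phi_C1].
  apply is_derive_Reals, derivable_pt_lim_sqrt. lra.
Qed.

Lemma r_close w : Rabs (r w) <= 2 /\ Rabs (r w - 1) <= 10 * (e * (2 * c + 1)) /\ Rabs (dr w) <= 40 * (e * (2 * c + 1)).
Proof.
  destruct (sqrt_Phi w) as [H1 H2]. unfold r, dr.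
  assert (Hs := sqrt_sqrt (Phi w) ltac:(lra)). set (s := sqrt (Phi w)) in *.
  assert (Hi : 0 < / s <= 2).
  { split; [apply Rinv_0_lt_compat; lra|]. replace 2 with (/ / 2) by field. apply Rinv_le_contravar; lra. }
  assert (HP := Phi_close w). assert (HD := dPhi_small w).
  split; [|split].
  - rewrite Rabs_pos_eq; lra.
  - replace (/ s - 1) with (- (Phi w - 1) * (/ s * / (1 + s))) by (rewrite <- Hs; field; lra).
    rewrite Rabs_mult, Rabs_Ropp.
    replace (10 * (e * (2 * c + 1))) with (5 * (e * (2 * c + 1)) * 2) by ring.
    apply Rmult_le_compat; auto using Rabs_pos.
    assert (0 < / (1 + s) <= 1).
    { split; [apply Rinv_0_lt_compat; lra|]. rewrite <- Rinv_1 at 2. apply Rinv_le_contravar; lra. }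
    rewrite Rabs_pos_eq; nra.
  - replace (- (dPhi w / (2 * s)) / s ^ 2) with (- dPhi w * (/ s * (/ s * / s) * / 2)) by (field; lra).
    rewrite Rabs_mult, Rabs_Ropp.
    replace (40 * (e * (2 * c + 1))) with (10 * (e * (2 * c + 1)) * 4) by ring.
    apply Rmult_le_compat; auto using Rabs_pos.
    assert (0 <= / s * / s <= 4) by nra.
    rewrite Rabs_pos_eq; nra.
Qed.

Lemma orthonormalize_close :
  exists dg, (forall x, is_derive (orthonormalize q) x (dg x)) /\ cont dg /\
    decays (e * (2 + 100 * (c + 1) * (2 * c + 1))) (fun x => orthonormalize q x - p x) /\
    decays (e * (2 + 100 * (c + 1) * (2 * c + 1))) (fun x => dg x - dp x).
Proof.
  assert (cq := nice_cont _ _ _ perturbed_nice).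
  destruct perturbed_nice as [_ [_ [Q1 Q2]]]. pose proof Np as [_ [cdp [P1 P2]]].
  destruct Phi_C1 as [DP CP].
  assert (cP : cont Phi) by now apply is_derive_cont with dPhi.
  assert (sP : forall w, sqrt (Phi w) <> 0) by (intro w; destruct (sqrt_Phi w); lra).
  assert (cs : cont (fun w => sqrt (Phi w))) by (intro w; apply (continuous_comp Phi sqrt); auto using continuous_sqrt).
  assert (cr : cont r) by (apply cont_inv; auto).
  assert (cdr : cont dr).
  { unfold dr. apply cont_mult.
    - apply cont_opp, cont_mult; auto.
      apply cont_inv; [exact (cont_mult _ _ (cont_const 2) cs)|].
      intro w; destruct (sqrt_Phi w); lra.
    - apply cont_inv; [exact (cont_pow _ 2 cs)|]. intro w. apply pow_nonzero, sP. }
  assert (Ee : 0 <= e * (2 * c + 1)) by (apply Rmult_le_pos; lra).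
  exists (fun w => dq w * r w + q w * dr w). split; [|split; [|split]]; auto with cont.
  - intro x. apply (is_derive_ext (fun w => q w * r w)); [reflexivity|].
    apply (is_derive_mult q r); auto; [apply r_derive | intros; apply Rmult_comm].
  - apply (decays_ext _ (fun x => (q x - p x) * r x + p x * (r x - 1))).
    { intro x. change (orthonormalize q x) with (q x * r x). ring. }
    apply (decays_le (e * 2 + c * (10 * (e * (2 * c + 1))))).
    + replace (e * (2 + 100 * (c + 1) * (2 * c + 1))) with (e * 2 + 100 * (c + 1) * (e * (2 * c + 1))) by ring. nra.
    + apply (decays_plus (e * 2) (c * (10 * (e * (2 * c + 1)))) (fun x => (q x - p x) * r x) (fun x => p x * (r x - 1))).
      * apply (decays_mult_bounded e 2 (fun x => q x - p x)); auto. apply r_close.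
      * apply (decays_mult_bounded c _ p); auto. apply r_close.
  - apply (decays_ext _ (fun x => (dq x - dp x) * r x + dp x * (r x - 1) + q x * dr x)).
    { intro x. ring. }
    apply (decays_le (e * 2 + c * (10 * (e * (2 * c + 1))) + (c + 1) * (40 * (e * (2 * c + 1))))).
    + replace (e * (2 + 100 * (c + 1) * (2 * c + 1))) with (e * 2 + 100 * (c + 1) * (e * (2 * c + 1))) by ring. nra.
    + apply (decays_plus (e * 2 + c * (10 * (e * (2 * c + 1)))) ((c + 1) * (40 * (e * (2 * c + 1))))
          (fun x => (dq x - dp x) * r x + dp x * (r x - 1)) (fun x => q x * dr x)).
      * apply (decays_plus (e * 2) (c * (10 * (e * (2 * c + 1)))) (fun x => (dq x - dp x) * r x) (fun x => dp x * (r x - 1))).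
        -- apply (decays_mult_bounded e 2 (fun x => dq x - dp x)); auto. apply r_close.
        -- apply (decays_mult_bounded c _ dp); auto. apply r_close.
      * apply (decays_mult_bounded (c + 1) _ q); auto. apply r_close.
Qed.
End Orthonormalize.

(** For 0 <= x < 2 pi only the translates by 0 and -2 pi can meet the support |w| < 4 pi / 3, so the
    partial sums equal 1 from index 1 on. *)
Lemma per_compact_square p :
  (forall w, 4 * PI / 3 <= Rabs w -> p w = 0) ->
  (forall w, 0 <= w <= 2 * PI -> p w ^ 2 + p (w - 2 * PI) ^ 2 = 1) ->
  (forall w, per (fun x => p x ^ 2) (w + 2 * PI) = per (fun x => p x ^ 2) w) ->
  forall w, per (fun x => p x ^ 2) w = 1.
Proof.
  intros Ho Hs Hp w. pose proof PI_RGT_0 as HPI.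
  destruct (mod_2pi 0 w) as [z Hz].
  rewrite <- (periodic_Z _ Hp (- z) w), opp_IZR.
  replace (w + 2 * PI * - IZR z) with (w - 2 * PI * IZR z) by ring.
  set (x := w - 2 * PI * IZR z) in *. unfold per, Series.
  assert (L : is_lim_seq (sum_n (per_term (fun x => p x ^ 2) x)) 1).
  2: now rewrite (is_lim_seq_unique _ _ L).
  apply (is_lim_seq_ext_loc (fun _ => 1)); [|apply is_lim_seq_const].
  exists 1%nat. intros n Hn. symmetry.
  assert (Hr : forall n, p (x + 2 * PI * INR (S n)) = 0).
  { intro k. apply Ho. rewrite S_INR. pose proof (pos_INR k). rewrite Rabs_pos_eq; nra. }
  assert (Hl : forall n, p (x - 2 * PI * INR (S (S n))) = 0).
  { intro k. apply Ho. rewrite !S_INR. pose proof (pos_INR k). rewrite <- Rabs_Ropp, Rabs_pos_eq; nra. }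
  destruct n; [lia|]. clear Hn. induction n.
  - rewrite sum_n_succ, sum_O. cbn [per_term]. rewrite Hr. simpl INR. rewrite Rmult_1_r.
    rewrite <- (Hs x) by lra. ring.
  - rewrite sum_n_succ, IHn. cbn [per_term]. rewrite Hr, Hl. ring.
Qed.

(** * The Meyer mask and Fourier summation *)

Lemma locally_Rlt (f : R -> R) x a : continuous f x -> f x < a -> locally x (fun y => f y < a).
Proof.
  intros Hf H. apply (Hf (fun z => z < a)). now apply (open_lt a).
Qed.

(** Extends to the endpoint pi / 3 what is known of theta and its derivative only beyond it. *)
Lemma cont_constant_right (f : R -> R) a k : cont f -> (forall x, a < x -> f x = k) -> f a = k.
Proof.
  intros Hf H.
  assert (L : is_lim_seq (fun n => f (a + / INR (S n))) (f a)).
  { apply (is_lim_seq_continuous f (fun n => a + / INR (S n)) a).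
    - apply continuity_pt_filterlim, Hf.
    - replace (Finite a) with (Finite (a + 0)) by (f_equal; ring).
      apply is_lim_seq_plus'; [apply is_lim_seq_const|].
      apply (is_lim_seq_incr_1 (fun n => / INR n)).
      replace (Finite 0) with (Rbar_inv p_infty) by reflexivity.
      apply is_lim_seq_inv; [apply is_lim_seq_INR | discriminate]. }
  apply (is_lim_seq_ext _ (fun _ => k)) in L.
  - apply is_lim_seq_unique in L. rewrite Lim_seq_const in L. now injection L.
  - intro n. apply H. assert (0 < / INR (S n)) by (apply Rinv_0_lt_compat, lt_0_INR; lia). lra.
Qed.

(** * The Meyer scaling function *)

Section Meyer.
Variables (theta : R -> R) (w0 : R).
Hypothesis Hodd : forall x, theta (- x) = - theta x.
Hypothesis Hmono : forall x y, x <= y -> theta x <= theta y.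
Hypothesis Hd1 : forall x, ex_derive theta x.
Hypothesis Hd2 : forall x, ex_derive (Derive theta) x.
Hypothesis Hconst : forall x, PI / 3 < x -> theta x = PI / 4.
Hypothesis Hw0 : PI / 3 <= w0 < PI / 2.

Let kappa := PI / (3 * (PI - 2 * w0)).

Lemma theta_right x : PI / 3 <= x -> theta x = PI / 4.
Proof.
  intros [H|<-]; [now apply Hconst|].
  apply (cont_constant_right theta); auto. intro y; now apply (ex_derive_continuous theta).
Qed.

Lemma Derive_theta_even x : Derive theta (- x) = Derive theta x.
Proof.
  assert (H : is_derive theta x (Derive theta (- x))).
  { apply (is_derive_ext (fun y => - theta (- y))).
    - intro t. change (- theta (- t) = theta t). rewrite Hodd; ring.
    - replace (Derive theta (- x)) with (- (-1 * Derive theta (- x))) by ring.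
      apply (is_derive_opp (fun y => theta (- y))).
      apply (is_derive_comp theta Ropp); [now apply Derive_correct|].
      auto_derive; auto; ring. }
  symmetry. now apply is_derive_unique.
Qed.

Lemma Derive_theta_right x : PI / 3 <= x -> Derive theta x = 0.
Proof.
  assert (H : forall x, PI / 3 < x -> Derive theta x = 0).
  { intros y Hy. rewrite (Derive_ext_loc theta (fun _ => PI / 4)); [apply Derive_const|].
    apply (filter_imp (fun z => PI / 3 < z)); [apply Hconst|].
    now apply (open_gt (PI / 3)). }
  intros [Hx|<-]; [now apply H|].
  apply (cont_constant_right (Derive theta)); auto. intro y; now apply (ex_derive_continuous (Derive theta)).
Qed.

Lemma theta_bound x : - (PI / 4) <= theta x <= PI / 4.
Proof.
  pose proof (Rmax_l x (PI / 3)). pose proof (Rmax_r x (PI / 3)).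
  pose proof (Rmax_l (- x) (PI / 3)). pose proof (Rmax_r (- x) (PI / 3)).
  split.
  - cut (- theta x <= PI / 4); [lra|]. rewrite <- Hodd, <- (theta_right (Rmax (- x) (PI / 3))) by auto. now apply Hmono.
  - rewrite <- (theta_right (Rmax x (PI / 3))) by auto. now apply Hmono.
Qed.

(** The transition profile of [meyer_hat], without absolute value or case distinction: theta is
    -pi/4 to the left of the transition and pi/4 to its right, so the cosine is 1 and 0 there by
    itself. *)
Let ramp w := cos (PI / 4 + theta (kappa * (w - PI))).
Let dramp w := - sin (PI / 4 + theta (kappa * (w - PI))) * (Derive theta (kappa * (w - PI)) * kappa).

Lemma kappa_pos : 0 < kappa.
Proof. pose proof PI_RGT_0. apply Rdiv_lt_0_compat; lra. Qed.

Lemma kappa_arg : kappa * (2 * w0 - PI) = - (PI / 3).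
Proof. unfold kappa. pose proof PI_RGT_0. field. lra. Qed.

Lemma ramp_derive w : is_derive ramp w (dramp w).
Proof.
  unfold ramp, dramp.
  replace (- sin (PI / 4 + theta (kappa * (w - PI))) * (Derive theta (kappa * (w - PI)) * kappa))
    with (kappa * Derive theta (kappa * (w - PI)) * - sin (PI / 4 + theta (kappa * (w - PI)))) by ring.
  apply (is_derive_comp cos (fun w => PI / 4 + theta (kappa * (w - PI)))); [apply is_derive_cos|].
  replace (kappa * Derive theta (kappa * (w - PI))) with (0 + kappa * Derive theta (kappa * (w - PI))) by ring.
  apply (is_derive_plus (fun _ => PI / 4) (fun w => theta (kappa * (w - PI)))).
  - apply (is_derive_const (V := R_NormedModule)).
  - apply (is_derive_comp theta (fun w => kappa * (w - PI))); [now apply Derive_correct|].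
    auto_derive; auto; ring.
Qed.

Lemma dramp_cont : cont dramp.
Proof.
  assert (cont theta) by (intro; now apply (ex_derive_continuous theta)).
  assert (cont (Derive theta)) by (intro; now apply (ex_derive_continuous (Derive theta))).
  unfold dramp. apply cont_mult.
  - apply cont_opp, cont_sinc, cont_plus; auto with cont.
    apply (cont_comp theta (fun w => kappa * (w - PI))); auto with cont.
  - apply cont_mult; auto with cont.
    apply (cont_comp (Derive theta) (fun w => kappa * (w - PI))); auto with cont.
Qed.

Lemma ramp_left w : w <= 2 * w0 -> ramp w = 1 /\ dramp w = 0.
Proof.
  intro H. assert (E : kappa * (w - PI) <= - (PI / 3)).
  { rewrite <- kappa_arg. apply Rmult_le_compat_l; [apply Rlt_le, kappa_pos|lra]. }
  unfold ramp, dramp. split.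
  - replace (theta (kappa * (w - PI))) with (- (PI / 4)).
    + rewrite Rplus_opp_r. apply cos_0.
    + rewrite <- (Ropp_involutive (kappa * (w - PI))), Hodd, theta_right; lra.
  - rewrite <- (Ropp_involutive (kappa * (w - PI))), Derive_theta_even, Derive_theta_right by lra. ring.
Qed.

Lemma ramp_right w : 2 * PI - 2 * w0 <= w -> ramp w = 0 /\ dramp w = 0.
Proof.
  intro H. assert (E : PI / 3 <= kappa * (w - PI)).
  { replace (PI / 3) with (kappa * (PI - 2 * w0)) by (replace (PI / 3) with (- - (PI / 3)) by ring; rewrite <- kappa_arg; ring).
    apply Rmult_le_compat_l; [apply Rlt_le, kappa_pos|lra]. }
  unfold ramp, dramp. split.
  - rewrite theta_right by auto. replace (PI / 4 + PI / 4) with (PI / 2) by field. apply cos_PI2.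
  - rewrite Derive_theta_right by auto. ring.
Qed.

Lemma ramp_range w : 0 <= ramp w <= 1.
Proof.
  unfold ramp. pose proof (theta_bound (kappa * (w - PI))). pose proof PI_RGT_0. split; [|apply COS_bound].
  apply cos_ge_0; lra.
Qed.

(* Both factors are C^1 on the whole line, which settles the smoothness at 0, where |w| is not differentiable. *)
Lemma meyer_hat_ramp w : meyer_hat theta w0 w = ramp w * ramp (- w).
Proof.
  pose proof PI_RGT_0. unfold meyer_hat.
  destruct (Rle_dec (Rabs w) (2 * w0)) as [H1|H1].
  { apply Rabs_le_between in H1. rewrite (proj1 (ramp_left w ltac:(lra))), (proj1 (ramp_left (- w) ltac:(lra))). ring. }
  assert (C : (0 <= w /\ Rabs w = w) \/ (w <= 0 /\ Rabs w = - w)).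
  { unfold Rabs; destruct (Rcase_abs w); lra. }
  assert (E : ramp w * ramp (- w) = ramp (Rabs w)).
  { destruct C as [[C ->]|[C ->]].
    - rewrite (proj1 (ramp_left (- w) ltac:(lra))). ring.
    - rewrite (proj1 (ramp_left w ltac:(lra))). ring. }
  rewrite E. destruct (Rle_dec (Rabs w) (2 * PI - 2 * w0)) as [H2|H2]; [reflexivity|].
  now rewrite (proj1 (ramp_right (Rabs w) ltac:(lra))).
Qed.

Definition dmeyer_hat (w : R) : R := dramp w * ramp (- w) - ramp w * dramp (- w).

Lemma dmeyer_hat_derive w : is_derive (meyer_hat theta w0) w (dmeyer_hat w).
Proof.
  apply (is_derive_ext (fun w => ramp w * ramp (- w))).
  { intro t. symmetry. apply meyer_hat_ramp. }
  unfold dmeyer_hat. replace (dramp w * ramp (- w) - ramp w * dramp (- w)) with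
    (dramp w * ramp (- w) + ramp w * (-1 * dramp (- w))) by ring.
  apply (is_derive_mult ramp (fun w => ramp (- w))); [apply ramp_derive| |intros; apply Rmult_comm].
  apply (is_derive_comp ramp Ropp); [apply ramp_derive|]. auto_derive; auto; ring.
Qed.

Lemma dmeyer_hat_cont : cont dmeyer_hat.
Proof.
  pose proof dramp_cont as c1. assert (c2 : cont ramp) by (apply is_derive_cont with dramp, ramp_derive).
  unfold dmeyer_hat. apply cont_minus; apply cont_mult; auto.
  - apply (cont_comp ramp Ropp); auto with cont.
  - apply (cont_comp dramp Ropp); auto with cont.
Qed.

Lemma meyer_hat_inner w : Rabs w <= 2 * PI / 3 -> meyer_hat theta w0 w = 1 /\ dmeyer_hat w = 0.
Proof.
  intro H. apply Rabs_le_between in H. rewrite meyer_hat_ramp. unfold dmeyer_hat.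
  destruct (ramp_left w ltac:(lra)) as [-> ->]. destruct (ramp_left (- w) ltac:(lra)) as [-> ->]. lra.
Qed.

Lemma meyer_hat_outer w : 4 * PI / 3 <= Rabs w -> meyer_hat theta w0 w = 0 /\ dmeyer_hat w = 0.
Proof.
  intro H. rewrite meyer_hat_ramp. unfold dmeyer_hat.
  assert (C : 4 * PI / 3 <= w \/ 4 * PI / 3 <= - w) by (unfold Rabs in H; destruct (Rcase_abs w); lra).
  destruct C as [C|C].
  - destruct (ramp_right w ltac:(lra)) as [-> ->]. lra.
  - destruct (ramp_right (- w) ltac:(lra)) as [-> ->]. lra.
Qed.

Lemma meyer_hat_range w : 0 <= meyer_hat theta w0 w <= 1.
Proof.
  rewrite meyer_hat_ramp. pose proof (ramp_range w). pose proof (ramp_range (- w)). nra.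
Qed.

(** The reflection of w into 2 pi - w changes the sign of the argument of theta; as theta is odd,
    this turns the cosine into the sine of the same angle. *)
Lemma meyer_hat_squares w : 0 <= w <= 2 * PI ->
  meyer_hat theta w0 w ^ 2 + meyer_hat theta w0 (w - 2 * PI) ^ 2 = 1.
Proof.
  intro H. pose proof PI_RGT_0. rewrite !meyer_hat_ramp.
  rewrite (proj1 (ramp_left (- w) ltac:(lra))), (proj1 (ramp_left (w - 2 * PI) ltac:(lra))).
  unfold ramp. replace (kappa * (- (w - 2 * PI) - PI)) with (- (kappa * (w - PI))) by ring.
  rewrite Hodd. set (s := theta (kappa * (w - PI))).
  replace (PI / 4 + - s) with (PI / 2 - (PI / 4 + s)) by field. rewrite cos_shift.
  pose proof (sin2_cos2 (PI / 4 + s)) as E. unfold Rsqr in E. apply eq_trans with (2 := E). ring.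
Qed.
End Meyer.

(** * The periodic mask *)

Lemma red2pi_spec x : exists z : Z, red2pi x = x - 2 * PI * IZR z /\ Rabs (x - 2 * PI * IZR z) <= PI.
Proof.
  pose proof PI_RGT_0 as HPI. exists (up ((x + PI) / (2 * PI)) - 1)%Z. unfold red2pi. rewrite minus_IZR.
  split; [reflexivity|].
  destruct (archimed ((x + PI) / (2 * PI))) as [H1 H2].
  set (u := IZR (up ((x + PI) / (2 * PI)))) in *.
  assert (E : x + PI = 2 * PI * ((x + PI) / (2 * PI))) by (field; lra).
  set (q := (x + PI) / (2 * PI)) in *. apply Rabs_le. nra.
Qed.

(** Gives one smooth formula across the jumps of [red2pi] at odd multiples of pi. If two different
    reductions of x are of modulus at most pi and less than 4 pi / 3, each has modulus at least 2 pi
    / 3, and psi vanishes at the double of both. *)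
Lemma red2pi_local (psi : R -> R) x z : (forall w, 4 * PI / 3 <= Rabs w -> psi w = 0) ->
  Rabs (x - 2 * PI * IZR z) < 4 * PI / 3 -> psi (2 * red2pi x) = psi (2 * (x - 2 * PI * IZR z)).
Proof.
  intros Hpsi Hz. pose proof PI_RGT_0 as HPI.
  destruct (red2pi_spec x) as [j [-> Hj]].
  destruct (Z.eq_dec j z) as [->|Hne]; [reflexivity|].
  set (k := (j - z)%Z).
  assert (Ek : x - 2 * PI * IZR z = (x - 2 * PI * IZR j) + 2 * PI * IZR k) by (unfold k; rewrite minus_IZR; ring).
  assert (Hk : 1 <= IZR k \/ IZR k <= -1).
  { destruct (Z_lt_le_dec 0 k); [left; apply IZR_le; lia|right; apply IZR_le; unfold k in *; lia]. }
  rewrite Ek in Hz |- *. set (y := x - 2 * PI * IZR j) in *.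
  assert (Hy := Rabs_le_between y PI). apply Hy in Hj. clear Hy. apply Rabs_def2 in Hz.
  assert (A : forall v, 2 * PI / 3 <= v \/ v <= - (2 * PI / 3) -> 4 * PI / 3 <= Rabs (2 * v)).
  { intros v [Hv|Hv]; [apply Rle_trans with (2 := Rle_abs _)|rewrite <- Rabs_Ropp; apply Rle_trans with (2 := Rle_abs _)]; lra. }
  assert (Hk2 : 2 * PI <= 2 * PI * IZR k \/ 2 * PI * IZR k <= - (2 * PI)) by (destruct Hk; [left|right]; nra).
  rewrite (Hpsi (2 * y)), (Hpsi (2 * (y + 2 * PI * IZR k))); auto; apply A; lra.
Qed.

Lemma cos_add_2PI x : cos (x + 2 * PI) = cos x.
Proof. rewrite cos_plus, cos_2PI, sin_2PI; ring. Qed.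

Lemma cos_red x z : cos (x - 2 * PI * IZR z) = cos x.
Proof.
  rewrite <- (periodic_Z cos cos_add_2PI (- z) x), opp_IZR. f_equal. ring.
Qed.

Section Mask.
Variables (mh dmh : R -> R) (M1 : R).
Hypothesis Dmh : forall w, is_derive mh w (dmh w).
Hypothesis Cdmh : cont dmh.
Hypothesis mh_inner : forall w, Rabs w <= 2 * PI / 3 -> mh w = 1 /\ dmh w = 0.
Hypothesis mh_outer : forall w, 4 * PI / 3 <= Rabs w -> mh w = 0 /\ dmh w = 0.
Hypothesis mh_range : forall w, 0 <= mh w <= 1.
Hypothesis dmh_bound : forall w, Rabs (dmh w) <= M1.

Let m0 x := mh (2 * red2pi x).
Let dm0 x := 2 * dmh (2 * red2pi x).

Lemma mask_local x z : Rabs (x - 2 * PI * IZR z) < 4 * PI / 3 ->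
  m0 x = mh (2 * (x - 2 * PI * IZR z)) /\ dm0 x = 2 * dmh (2 * (x - 2 * PI * IZR z)).
Proof.
  intro H. unfold m0, dm0. split; [|f_equal]; apply red2pi_local; auto; apply mh_outer.
Qed.

Lemma mask_locally x : exists z, locally x (fun y => Rabs (y - 2 * PI * IZR z) < 4 * PI / 3).
Proof.
  pose proof PI_RGT_0. destruct (red2pi_spec x) as [z [_ Hz]]. exists z.
  apply (locally_Rlt (fun y => Rabs (y - 2 * PI * IZR z))); [|lra].
  apply (cont_abs (fun y => y - 2 * PI * IZR z)). auto with cont.
Qed.

Lemma mask_derive x : is_derive m0 x (dm0 x).
Proof.
  destruct (mask_locally x) as [z Hz].
  apply (is_derive_ext_loc (fun y => mh (2 * (y - 2 * PI * IZR z)))).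
  - apply (filter_imp (fun y => Rabs (y - 2 * PI * IZR z) < 4 * PI / 3)); auto.
    intros y Hy. symmetry. now apply mask_local.
  - rewrite (proj2 (mask_local x z (locally_singleton _ _ Hz))).
    apply (is_derive_comp mh (fun y => 2 * (y - 2 * PI * IZR z))); auto.
    auto_derive; auto; ring.
Qed.

Lemma dmask_cont : cont dm0.
Proof.
  intro x. destruct (mask_locally x) as [z Hz].
  apply (continuous_ext_loc _ (fun y => 2 * dmh (2 * (y - 2 * PI * IZR z)))).
  - apply (filter_imp (fun y => Rabs (y - 2 * PI * IZR z) < 4 * PI / 3)); auto.
    intros y Hy. symmetry. now apply mask_local.
  - apply (cont_mult (fun _ => 2) (fun y => dmh (2 * (y - 2 * PI * IZR z)))); auto with cont.
    apply (cont_comp dmh (fun y => 2 * (y - 2 * PI * IZR z))); auto with cont.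
Qed.

Lemma mask_periodic x : m0 (x + 2 * PI) = m0 x.
Proof.
  destruct (mask_locally x) as [z Hz]. apply locally_singleton in Hz.
  rewrite (proj1 (mask_local x z Hz)), (proj1 (mask_local (x + 2 * PI) (z + 1) ltac:(rewrite plus_IZR; replace (x + 2 * PI - 2 * PI * (IZR z + 1)) with (x - 2 * PI * IZR z) by ring; exact Hz))).
  f_equal. rewrite plus_IZR. ring.
Qed.

Lemma mask_hi x : 1 / 2 <= cos x -> m0 x = 1 /\ dm0 x = 0.
Proof.
  intro H. pose proof PI_RGT_0. unfold m0, dm0. destruct (red2pi_spec x) as [z [-> Hz]].
  rewrite <- (cos_red x z), <- cos_Rabs in H. set (y := x - 2 * PI * IZR z) in *.
  assert (Hy : Rabs y <= PI / 3).
  { apply Rnot_lt_le. intro C. pose proof (Rabs_pos y).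
    assert (cos (Rabs y) < cos (PI / 3)) by (apply cos_decreasing_1; lra). rewrite cos_PI3 in *. lra. }
  destruct (mh_inner (2 * y)) as [-> ->]; [|lra].
  rewrite Rabs_mult, (Rabs_pos_eq 2); lra.
Qed.

Lemma mask_lo x : cos x <= - (1 / 2) -> m0 x = 0 /\ dm0 x = 0.
Proof.
  intro H. pose proof PI_RGT_0. unfold m0, dm0. destruct (red2pi_spec x) as [z [-> Hz]].
  rewrite <- (cos_red x z), <- cos_Rabs in H. set (y := x - 2 * PI * IZR z) in *.
  assert (Hy : 2 * PI / 3 <= Rabs y).
  { apply Rnot_lt_le. intro C. pose proof (Rabs_pos y).
    assert (cos (2 * (PI / 3)) < cos (Rabs y)) by (apply cos_decreasing_1; lra).
    rewrite cos_2a_cos, cos_PI3 in *. lra. }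
  destruct (mh_outer (2 * y)) as [-> ->]; [|lra].
  rewrite Rabs_mult, (Rabs_pos_eq 2); lra.
Qed.

Lemma mask_bound x : Rabs (m0 x) <= 1 /\ Rabs (dm0 x) <= 2 * M1.
Proof.
  unfold m0, dm0. split.
  - apply Rabs_le. pose proof (mh_range (2 * red2pi x)). lra.
  - rewrite Rabs_mult, (Rabs_pos_eq 2) by lra. apply Rmult_le_compat_l; [lra|apply dmh_bound].
Qed.

Lemma mask_inner w : Rabs w <= 4 * PI / 3 -> mh w = m0 (w / 2) /\ dmh w = / 2 * dm0 (w / 2).
Proof.
  intro H. pose proof PI_RGT_0. destruct (mask_local (w / 2) 0) as [-> ->].
  - rewrite Rmult_0_r, Rminus_0_r. unfold Rdiv. rewrite Rabs_mult, (Rabs_pos_eq (/ 2)); lra.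
  - rewrite Rmult_0_r, Rminus_0_r. replace (2 * (w / 2)) with w by field. split; [reflexivity|field].
Qed.
End Mask.

Lemma cos_half_pow x l : cos (x / 2) ^ (2 * l) = ((1 + cos x) / 2) ^ l.
Proof.
  rewrite pow_mult. f_equal. replace x with (2 * (x / 2)) at 2 by field. rewrite cos_2a_cos. field.
Qed.

(** * Division of the mask by the power of the cosine *)

Section Quotient.
Variables (m0 dm0 : R -> R) (l : nat).
Hypothesis Dm0 : forall x, is_derive m0 x (dm0 x).
Hypothesis Cdm0 : cont dm0.
Hypothesis m0_lo : forall x, cos x <= - (1 / 2) -> m0 x = 0 /\ dm0 x = 0.
Hypothesis m0_periodic : forall x, m0 (x + 2 * PI) = m0 x.

Definition low_pass (x : R) : R := ((1 + cos x) / 2) ^ l.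
Definition dlow_pass (x : R) : R := INR l * ((1 + cos x) / 2) ^ pred l * (- sin x / 2).
(* Where [low_pass] vanishes this is 0 by [/ 0 = 0], the right value because m0 vanishes nearby. *)
Definition dquotient (x : R) : R :=
  (dm0 x * low_pass x - m0 x * dlow_pass x) / low_pass x ^ 2.

Let q x := m0 x / cos (x / 2) ^ (2 * l).

Lemma low_pass_derive x : is_derive low_pass x (dlow_pass x).
Proof.
  unfold low_pass, dlow_pass. auto_derive; auto. unfold Rdiv. ring.
Qed.

Lemma low_pass_cont : cont low_pass.
Proof. apply is_derive_cont with dlow_pass, low_pass_derive. Qed.

Lemma dlow_pass_cont : cont dlow_pass.
Proof.
  unfold dlow_pass. auto 10 with cont.
Qed.

Lemma low_pass_nonzero x : cos x <> -1 -> low_pass x <> 0.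
Proof. intro H. apply pow_nonzero. lra. Qed.

(** The denominator can vanish only where cos x = -1, and a whole neighbourhood of such a point lies
    in the gap of the mask. Smoothness of the quotient thus never depends on the order of the
    zero. *)
Lemma quotient_cases x : (low_pass x <> 0 /\ cos x <> -1) \/
  (locally x (fun y => cos y <= - (1 / 2)) /\ cos x <= - (1 / 2)).
Proof.
  destruct (Req_dec (cos x) (-1)) as [E|E].
  - right. split; [|lra].
    apply (filter_imp (fun y => cos y < - (1 / 2))); [intros; lra|].
    apply (locally_Rlt cos); [apply continuous_cos|lra].
  - left. split; auto using low_pass_nonzero.
Qed.

Lemma quotient_lo y : cos y <= - (1 / 2) -> q y = 0 /\ dquotient y = 0.
Proof.
  intro H. unfold q, dquotient. destruct (m0_lo y H) as [-> ->]. unfold Rdiv. split; ring.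
Qed.

Lemma quotient_derive x : is_derive q x (dquotient x).
Proof.
  destruct (quotient_cases x) as [[H _]|[H1 H2]].
  - apply (is_derive_ext (fun x => m0 x / low_pass x)).
    { intro t. unfold q, low_pass. now rewrite cos_half_pow. }
    apply is_derive_div; auto. apply low_pass_derive.
  - rewrite (proj2 (quotient_lo x H2)).
    apply (is_derive_ext_loc (fun _ => 0)).
    + apply (filter_imp (fun y => cos y <= - (1 / 2))); auto. intros y Hy. symmetry. now apply quotient_lo.
    + apply (is_derive_const (V := R_NormedModule) 0 x).
Qed.

Lemma dquotient_cont : cont dquotient.
Proof.
  intro x. destruct (quotient_cases x) as [[H _]|[H1 H2]].
  - apply continuity_pt_filterlim, continuity_pt_div.
    + apply continuity_pt_filterlim. pose proof low_pass_cont. pose proof dlow_pass_cont.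
      assert (cont m0) by now apply is_derive_cont with dm0.
      exact (cont_minus _ _ (cont_mult _ _ Cdm0 low_pass_cont) (cont_mult _ _ H2 dlow_pass_cont) x).
    + apply continuity_pt_filterlim. apply (cont_pow low_pass 2 low_pass_cont).
    + now apply pow_nonzero.
  - apply (continuous_ext_loc _ (fun _ => 0)); [|apply continuous_const].
    apply (filter_imp (fun y => cos y <= - (1 / 2))); auto. intros y Hy. symmetry. now apply quotient_lo.
Qed.

Lemma quotient_mult x : low_pass x * q x = m0 x /\ dlow_pass x * q x + low_pass x * dquotient x = dm0 x.
Proof.
  destruct (quotient_cases x) as [[H _]|[H1 H2]].
  - unfold q, dquotient. rewrite cos_half_pow. fold (low_pass x). split; field; auto.
  - destruct (quotient_lo x H2) as [-> ->]. destruct (m0_lo x H2) as [-> ->]. split; ring.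
Qed.

Lemma quotient_periodic x : q (x + 2 * PI) = q x.
Proof. unfold q. now rewrite !cos_half_pow, m0_periodic, cos_add_2PI. Qed.

Lemma dquotient_periodic x : dquotient (x + 2 * PI) = dquotient x.
Proof.
  assert (D : is_derive q x (dquotient (x + 2 * PI))).
  { apply (is_derive_ext (fun x => q (x + 2 * PI))); [apply quotient_periodic|].
    replace (dquotient (x + 2 * PI)) with (1 * dquotient (x + 2 * PI)) by ring.
    apply (is_derive_comp q (fun x => x + 2 * PI)); [apply quotient_derive|]. auto_derive; auto; ring. }
  apply is_derive_unique in D. rewrite <- D. apply is_derive_unique, quotient_derive.
Qed.
End Quotient.

(** * Linear summation methods and differentiation *)

Section Fourier.
Variables (f df : R -> R).
Hypothesis Df : forall x, is_derive f x (df x).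
Hypothesis Cdf : cont df.
Hypothesis f_pi : f PI = 0 /\ f (- PI) = 0.

Let Cf : cont f.
Proof. now apply is_derive_cont with df. Qed.

Lemma RInt_parts_pi g dg : (forall x, is_derive g x (dg x)) -> cont dg ->
  RInt (fun x => df x * g x) (- PI) PI = - RInt (fun x => f x * dg x) (- PI) PI.
Proof.
  intros Dg Cdg. assert (Cg : cont g) by now apply is_derive_cont with dg.
  assert (E : RInt (fun x => df x * g x + f x * dg x) (- PI) PI = 0 :> R).
  { rewrite (RInt_FTC (fun x => f x * g x)); auto with cont.
    - destruct f_pi as [-> ->]. ring.
    - intro x. apply (is_derive_mult f g); auto. intros; apply Rmult_comm. }
  rewrite RInt_add in E by auto with cont. lra.
Qed.

Lemma four_a_derive k : four_a df k = INR k * four_b f k.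
Proof.
  unfold four_a, four_b.
  rewrite (RInt_parts_pi (fun x => cos (INR k * x)) (fun x => - (INR k * sin (INR k * x)))).
  - rewrite (RInt_eq _ (fun x => - INR k * (f x * sin (INR k * x)))) by (intro; ring).
    rewrite RInt_mull by auto with cont. ring.
  - intro x. auto_derive; [exact I|]. ring.
  - auto with cont.
Qed.

Lemma four_b_derive k : four_b df k = - INR k * four_a f k.
Proof.
  unfold four_a, four_b.
  rewrite (RInt_parts_pi (fun x => sin (INR k * x)) (fun x => INR k * cos (INR k * x))).
  - rewrite (RInt_eq _ (fun x => INR k * (f x * cos (INR k * x)))) by (intro; ring).
    rewrite RInt_mull by auto with cont. ring.
  - intro x. auto_derive; [exact I|]. ring.
  - auto with cont.
Qed.

(** The coefficients of df are k b_k and -k a_k, which is what differentiating cos(k w) and sin(k w)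
    produces; the weights [lam n k] are shared by the two terms of frequency k, and the constant
    term of df is 0. *)
Lemma lin_sum_derive lam n w : is_derive (lin_sum lam n f) w (lin_sum lam n df w).
Proof.
  unfold lin_sum. rewrite (four_a_derive 0). simpl (INR 0).
  replace (0 * four_b f 0 / 2) with 0 by field.
  apply (is_derive_plus (fun _ => four_a f 0 / 2)
    (fun w => sum_n_m (fun k => lam n k * (four_a f k * cos (INR k * w) + four_b f k * sin (INR k * w))) 1 n)).
  { apply (is_derive_const (V := R_NormedModule)). }
  assert (H : forall N, is_derive (fun w => sum_n_m (fun k => lam n k * (four_a f k * cos (INR k * w) + four_b f k * sin (INR k * w))) 1 N) w
    (sum_n_m (fun k => lam n k * (four_a df k * cos (INR k * w) + four_b df k * sin (INR k * w))) 1 N)).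
  { induction N.
    - rewrite sum_n_m_zero by lia.
      apply (is_derive_ext (fun _ => 0)); [intro; rewrite sum_n_m_zero by lia; reflexivity|].
      apply (is_derive_const (V := R_NormedModule) 0 w).
    - rewrite sum_n_Sm by lia.
      apply (is_derive_ext (fun w => sum_n_m (fun k => lam n k * (four_a f k * cos (INR k * w) + four_b f k * sin (INR k * w))) 1 N
         + lam n (S N) * (four_a f (S N) * cos (INR (S N) * w) + four_b f (S N) * sin (INR (S N) * w)))).
      { intro t. rewrite sum_n_Sm by lia. reflexivity. }
      apply (is_derive_plus
        (fun w => sum_n_m (fun k => lam n k * (four_a f k * cos (INR k * w) + four_b f k * sin (INR k * w))) 1 N)
        (fun w => lam n (S N) * (four_a f (S N) * cos (INR (S N) * w) + four_b f (S N) * sin (INR (S N) * w))));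
        [exact IHN|].
      rewrite four_a_derive, four_b_derive. generalize (S N); intro k. auto_derive; [exact I|]. ring. }
  apply H.
Qed.
End Fourier.

Lemma lin_sum_periodic lam n f w : lin_sum lam n f (w + 2 * PI) = lin_sum lam n f w.
Proof.
  unfold lin_sum. f_equal. apply sum_n_m_ext. intro k.
  replace (INR k * (w + 2 * PI)) with (INR k * w + 2 * INR k * PI) by ring.
  now rewrite cos_period, sin_period.
Qed.

(** [real] would send an infinite supremum to 0, so the supremum is first shown to be finite: it
    lies between |g x| and the maximum of |g| on the compact interval. *)
Lemma supC_bound g : cont g -> 0 <= supC g /\ forall x, Rabs x <= PI -> Rabs (g x) <= supC g.
Proof.
  intro Hg. pose proof PI_RGT_0 as HPI.
  destruct (continuity_ab_maj (fun x => Rabs (g x)) (- PI) PI) as [xm [Hm _]].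
  { lra. } { intros c _. apply continuity_pt_filterlim, (cont_abs g Hg). }
  assert (key : forall x, Rabs x <= PI -> Rabs (g x) <= supC g).
  { intros x Hx. unfold supC.
    destruct (Lub_Rbar_correct (fun y => exists x, - PI <= x <= PI /\ y = Rabs (g x))) as [U L].
    assert (Ux : Rbar_le (Rabs (g x)) (Lub_Rbar (fun y => exists x, - PI <= x <= PI /\ y = Rabs (g x)))).
    { apply U. exists x. split; auto. now apply Rabs_le_between. }
    assert (LM : Rbar_le (Lub_Rbar (fun y => exists x, - PI <= x <= PI /\ y = Rabs (g x))) (Rabs (g xm))).
    { apply L. intros y [z [Hz ->]]. simpl. now apply Hm. }
    destruct (Lub_Rbar _) as [r| |]; simpl in *; try contradiction. exact Ux. }
  split; auto. apply Rle_trans with (Rabs (g 0)); [apply Rabs_pos|]. apply key. rewrite Rabs_R0; lra.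
Qed.

Lemma supC_bound_periodic g x : cont g -> (forall x, g (x + 2 * PI) = g x) -> Rabs (g x) <= supC g.
Proof.
  intros Hg Hp. destruct (red2pi_spec x) as [z [_ Hz]].
  rewrite <- (periodic_Z g Hp (- z) x), opp_IZR.
  replace (x + 2 * PI * - IZR z) with (x - 2 * PI * IZR z) by ring.
  now apply supC_bound.
Qed.

(** * The perturbation estimate *)

Lemma lin_sum_cont lam n f : cont (lin_sum lam n f).
Proof.
  unfold lin_sum. apply cont_plus; [apply cont_const|].
  assert (H : forall N, cont (fun w => sum_n_m (fun k => lam n k * (four_a f k * cos (INR k * w) + four_b f k * sin (INR k * w))) 1 N)).
  { induction N; intro x.
    - apply (continuous_ext (fun _ => 0)); [intro; now rewrite sum_n_m_zero by lia|]. apply continuous_const.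
    - apply (continuous_ext (fun w => sum_n_m (fun k => lam n k * (four_a f k * cos (INR k * w) + four_b f k * sin (INR k * w))) 1 N
         + lam n (S N) * (four_a f (S N) * cos (INR (S N) * w) + four_b f (S N) * sin (INR (S N) * w)))).
      { intro t. rewrite (sum_n_Sm _ 1 N) by lia. reflexivity. }
      apply (cont_plus _ (fun w => lam n (S N) * (four_a f (S N) * cos (INR (S N) * w) + four_b f (S N) * sin (INR (S N) * w))) IHN).
      auto 10 with cont. }
  apply H.
Qed.

Lemma pow_antitone x n k : 0 <= x <= 1 -> (k <= n)%nat -> x ^ n <= x ^ k.
Proof.
  intros Hx Hk. replace n with (k + (n - k))%nat by lia. rewrite pow_add.
  assert (0 <= x ^ k) by (apply pow_le; lra).
  assert (x ^ (n - k) <= 1) by (rewrite <- (pow1 (n - k)); apply pow_incr; lra). nra.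
Qed.

Section Perturbation.
Variables (theta : R -> R) (w0 : R) (lam : nat -> nat -> R) (nl : nat -> nat).
Variables (dm0 : R -> R) (M0 : R).
Notation m0 := (meyer_mask theta w0).
Hypothesis Dm0 : forall x, is_derive m0 x (dm0 x).
Hypothesis Cdm0 : cont dm0.
Hypothesis m0_lo : forall x, cos x <= - (1 / 2) -> m0 x = 0 /\ dm0 x = 0.
Hypothesis m0_0 : m0 0 = 1.
Hypothesis m0_periodic : forall x, m0 (x + 2 * PI) = m0 x.
Hypothesis m0_bound : forall x, Rabs (m0 x) <= 1.
Hypothesis dm0_bound : forall x, Rabs (dm0 x) <= M0.
Variable l : nat.

Notation ml := (meyer_mask_l theta w0 l).
Notation dml := (dquotient m0 dm0 l).
Notation u := (u_l theta w0 lam nl l).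
Notation u1 := (u1_l theta w0 lam nl l).
Notation a := (alpha theta w0 lam nl l).
Notation g := (gamma theta w0 lam nl l).

Lemma ml_derive x : is_derive ml x (dml x).
Proof. apply quotient_derive; auto. Qed.

Lemma u1_lin_sum : u1 = lin_sum lam (nl l) dml.
Proof.
  unfold u1_l. f_equal. apply functional_extensionality; intro x.
  apply is_derive_unique, ml_derive.
Qed.

Lemma u_derive x : is_derive u x (u1 x).
Proof.
  rewrite u1_lin_sum. apply lin_sum_derive.
  - apply ml_derive.
  - apply dquotient_cont; auto.
  - assert (cos PI <= - (1 / 2)) by (rewrite cos_PI; lra).
    split; apply (quotient_lo m0 dm0 l m0_lo); [|rewrite cos_neg]; auto.
Qed.

Lemma u_close : 0 <= a /\ 0 <= g /\ (forall x, Rabs (u x - ml x) <= a) /\ (forall x, Rabs (u1 x - dml x) <= g).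
Proof.
  assert (cml : cont ml) by (apply is_derive_cont with dml, ml_derive).
  assert (cdml : cont dml) by (apply dquotient_cont; auto).
  assert (c1 : cont (fun x => u x - ml x)) by (apply cont_minus; auto; apply lin_sum_cont).
  assert (E : (fun x => u1 x - Derive ml x) = (fun x => u1 x - dml x)).
  { apply functional_extensionality; intro x. f_equal. f_equal.
    apply is_derive_unique, ml_derive. }
  assert (c2 : cont (fun x => u1 x - dml x)) by (apply cont_minus; auto; apply lin_sum_cont).
  unfold gamma. rewrite E.
  split; [apply (supC_bound _ c1)|]. split; [apply (supC_bound _ c2)|]. split; intro x.
  - apply (supC_bound_periodic (fun x => u x - ml x)); auto. intro y.
    apply (f_equal2 Rminus); [apply lin_sum_periodic|]. apply quotient_periodic; auto.
  - apply (supC_bound_periodic (fun x => u1 x - dml x)); auto. intro y.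
    apply (f_equal2 Rminus); [apply lin_sum_periodic|]. apply (dquotient_periodic m0 dm0 l); auto.
Qed.

(** Writing u = ml + (u - ml) splits m into m0 / u0 and an error that carries the whole low-pass
    factor, hence keeps the zero at pi. The normalization is harmless: ml 0 = 1 gives |1 - u0| <=
    alpha and 1 / u0 <= 2. In d, the part 2 * M0 * mu pays for normalizing dm0, and 4 * mu covers
    the normalization of m0 and the error terms. *)
Lemma m_l_perturbation : (4 <= l)%nat -> a <= 1 / 2 ->
  let m := m_l theta w0 lam nl l in
  let d := (4 + 2 * M0) * mu_l theta w0 lam nl l in
  0 <= mu_l theta w0 lam nl l /\
  exists dm, (forall x, is_derive m x (dm x)) /\ cont dm /\ m 0 = 1 /\
    (forall x, Rabs (m x - m0 x) <= d) /\ (forall x, Rabs (dm x - dm0 x) <= d) /\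
    (forall x, cos x <= - (1 / 2) -> Rabs (m x) <= d * sixth x) /\
    (forall x, cos x <= - (1 / 2) -> Rabs (dm x) <= d * sixth x).
Proof.
  intros Hl Ha m d. destruct u_close as [Pa [Pg [Cu Cu1]]].
  assert (PM0 : 0 <= M0) by (pose proof (dm0_bound 0); pose proof (Rabs_pos (dm0 0)); lra).
  assert (Hl1 : 4 <= INR l) by (apply le_INR in Hl; simpl in Hl; lra).
  set (mu := mu_l theta w0 lam nl l) in *.
  assert (Emu : mu = INR l * a + g) by reflexivity.
  assert (Pla : a <= INR l * a) by (rewrite <- (Rmult_1_l a) at 1; apply Rmult_le_compat_r; lra).
  assert (Pmu : 0 <= mu) by lra.
  set (u0 := u 0).
  assert (ml0 : ml 0 = 1).
  { unfold meyer_mask_l. rewrite m0_0, cos_half_pow, cos_0. replace ((1 + 1) / 2) with 1 by field. rewrite pow1. field. }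
  assert (Hu0 : Rabs (1 - u0) <= a) by (rewrite <- ml0, Rabs_minus_sym; apply Cu).
  assert (Hu0' : 1 / 2 <= u0) by (apply Rabs_le_between in Hu0; lra).
  assert (Hi : 0 < / u0 <= 2).
  { split; [apply Rinv_0_lt_compat; lra|]. replace 2 with (/ (1 / 2)) by field. apply Rinv_le_contravar; lra. }
  assert (E : forall x, m x = low_pass l x * u x / u0).
  { intro x. unfold m, m_l, low_pass. now rewrite cos_half_pow. }
  assert (s_range : forall x, 0 <= (1 + cos x) / 2 <= 1) by (intro x; pose proof (COS_bound x); lra).
  assert (lp : forall x, 0 <= low_pass l x <= sixth x).
  { intro x. split; [now apply pow_le, s_range|]. apply pow_antitone; auto; lia. }
  assert (six : forall x, 0 <= sixth x <= 1).
  { intro x. split; [apply sixth_pos|]. apply Rle_trans with (1 ^ 3); [apply pow_incr, s_range|rewrite pow1; lra]. }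
  (* This is where l >= 4 is used: the differentiated power has exponent [pred l] >= 3, so it is
     still at most [sixth x]. *)
  assert (dlp : forall x, Rabs (dlow_pass l x) <= INR l * sixth x).
  { intro x. unfold dlow_pass. rewrite !Rabs_mult.
    rewrite (Rabs_pos_eq (INR l)), (Rabs_pos_eq (((1 + cos x) / 2) ^ pred l)) by (try apply pow_le; try apply s_range; lra).
    rewrite <- (Rmult_1_r (INR l * sixth x)). apply Rmult_le_compat; auto using Rabs_pos.
    - apply Rmult_le_pos; [lra|]. apply pow_le, s_range.
    - apply Rmult_le_compat_l; [lra|]. apply pow_antitone; auto; lia.
    - apply Rabs_le. pose proof (SIN_bound x). lra. }
  set (dm := fun x => (dlow_pass l x * u x + low_pass l x * u1 x) / u0).
  assert (Em : forall x, m x = m0 x / u0 + low_pass l x * (u x - ml x) / u0).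
  { intro x. rewrite E, <- (proj1 (quotient_mult m0 dm0 l m0_lo x)).
    change (m0 x / cos (x / 2) ^ (2 * l)) with (ml x). field. lra. }
  assert (Edm : forall x, dm x = dm0 x / u0 + (dlow_pass l x * (u x - ml x) + low_pass l x * (u1 x - dml x)) / u0).
  { intro x. unfold dm. rewrite <- (proj2 (quotient_mult m0 dm0 l m0_lo x)).
    change (m0 x / cos (x / 2) ^ (2 * l)) with (ml x). field. lra. }
  assert (div2 : forall x y, Rabs x <= y -> Rabs (x / u0) <= 2 * y).
  { intros x y H. unfold Rdiv. rewrite Rabs_mult, (Rabs_pos_eq (/ u0)), (Rmult_comm 2) by lra.
    apply Rmult_le_compat; auto using Rabs_pos; lra. }
  assert (R1 : forall x, Rabs (low_pass l x * (u x - ml x) / u0) <= 2 * (a * sixth x)).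
  { intro x. apply div2. rewrite Rabs_mult, Rmult_comm. apply Rmult_le_compat; auto using Rabs_pos.
    rewrite Rabs_pos_eq; apply lp. }
  assert (R2 : forall x, Rabs ((dlow_pass l x * (u x - ml x) + low_pass l x * (u1 x - dml x)) / u0) <= 2 * (mu * sixth x)).
  { intro x. apply div2. apply Rle_trans with (1 := Rabs_triang _ _). rewrite !Rabs_mult.
    replace (mu * sixth x) with (INR l * sixth x * a + sixth x * g) by (rewrite Emu; ring).
    apply Rplus_le_compat; apply Rmult_le_compat; auto using Rabs_pos.
    rewrite Rabs_pos_eq; apply lp. }
  assert (Hd : d = 4 * mu + 2 * (M0 * mu)) by (unfold d; ring).
  assert (PMm : 0 <= M0 * mu) by now apply Rmult_le_pos.
  split; auto. exists dm. split; [|split; [|split; [|split; [|split; [|split]]]]].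
  - intro x. apply (is_derive_ext (fun x => (low_pass l x * u x) * / u0)); [intro; symmetry; apply E|].
    unfold dm, Rdiv. rewrite Rmult_comm.
    apply (is_derive_ext (fun x => / u0 * (low_pass l x * u x))); [intro; apply Rmult_comm|].
    apply (is_derive_scal (fun x => low_pass l x * u x)).
    apply (is_derive_mult (low_pass l) u); [apply low_pass_derive|apply u_derive|intros; apply Rmult_comm].
  - assert (cont u) by apply lin_sum_cont. assert (cont u1) by apply lin_sum_cont.
    apply cont_div_const, cont_plus; apply cont_mult; auto using low_pass_cont, dlow_pass_cont.
  - rewrite E. unfold low_pass. rewrite cos_0. replace ((1 + 1) / 2) with 1 by field. rewrite pow1. fold u0. field. lra.
  - intro x. rewrite Em.
    replace (m0 x / u0 + low_pass l x * (u x - ml x) / u0 - m0 x) with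
      (m0 x * (1 - u0) / u0 + low_pass l x * (u x - ml x) / u0) by (field; lra).
    apply Rle_trans with (1 := Rabs_triang _ _).
    assert (Rabs (m0 x * (1 - u0) / u0) <= 2 * (1 * a)).
    { apply div2. rewrite Rabs_mult. apply Rmult_le_compat; auto using Rabs_pos. }
    specialize (R1 x). specialize (six x). assert (a * sixth x <= a) by nra. lra.
  - intro x. rewrite Edm.
    match goal with |- Rabs (_ + ?z - _) <= _ => set (r := z) in * end.
    replace (dm0 x / u0 + r - dm0 x) with (dm0 x * (1 - u0) / u0 + r) by (field; lra).
    apply Rle_trans with (1 := Rabs_triang _ _).
    assert (Rabs (dm0 x * (1 - u0) / u0) <= 2 * (M0 * mu)).
    { apply div2. rewrite Rabs_mult. apply Rmult_le_compat; auto using Rabs_pos. lra. }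
    specialize (R2 x). specialize (six x). assert (mu * sixth x <= mu) by nra. fold r in R2. lra.
  - intros x Hx. rewrite Em, (proj1 (m0_lo x Hx)). unfold Rdiv at 1. rewrite Rmult_0_l, Rplus_0_l.
    apply Rle_trans with (1 := R1 x). rewrite <- Rmult_assoc. apply Rmult_le_compat_r; [apply six|]. lra.
  - intros x Hx. rewrite Edm, (proj2 (m0_lo x Hx)). unfold Rdiv at 1. rewrite Rmult_0_l, Rplus_0_l.
    apply Rle_trans with (1 := R2 x). rewrite <- Rmult_assoc. apply Rmult_le_compat_r; [apply six|]. lra.
Qed.
End Perturbation.

(** * Assembling the estimates *)

Lemma bounded_of_compact_support (f : R -> R) A : cont f -> 0 <= A -> (forall w, A <= Rabs w -> f w = 0) ->
  exists M, 0 <= M /\ forall w, Rabs (f w) <= M.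
Proof.
  intros Hf HA Ho.
  destruct (continuity_ab_maj (fun x => Rabs (f x)) (- A) A) as [xm [Hm _]].
  { lra. } { intros c _. apply continuity_pt_filterlim, (cont_abs f Hf). }
  exists (Rabs (f xm)). split; [apply Rabs_pos|]. intro w.
  destruct (Rle_dec (Rabs w) A) as [H|H].
  - apply Hm. now apply Rabs_le_between.
  - rewrite Ho by lra. rewrite Rabs_R0. apply Rabs_pos.
Qed.

Lemma decays_of_compact_support (f : R -> R) A M : (forall w, A <= Rabs w -> f w = 0) ->
  (forall w, Rabs (f w) <= M) -> decays (M * (1 + A ^ 2)) f.
Proof.
  intros Ho Hb w. pose proof (inv_one_plus_sqr w) as Hi. pose proof (one_plus_sqr_pos w) as Hp.
  pose proof (Rabs_pos (f 0)). pose proof (Hb 0).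
  destruct (Rle_dec (Rabs w) A) as [H1|H1].
  - apply Rle_trans with (1 := Hb w). rewrite Rmult_assoc. rewrite <- (Rmult_1_r M) at 1.
    apply Rmult_le_compat_l; [lra|]. apply Rle_trans with ((1 + w ^ 2) * / (1 + w ^ 2)); [rewrite Rinv_r; lra|].
    apply Rmult_le_compat_r; [lra|]. rewrite <- (pow2_abs w). pose proof (Rabs_pos w). nra.
  - rewrite Ho by lra. rewrite Rabs_R0. apply Rmult_le_pos; [|lra]. apply Rmult_le_pos; [lra|]. pose proof (pow2_ge_0 A); lra.
Qed.

(* Removes the restriction d > 0 of the AM-GM comparison. *)
Lemma le_of_le_perturbation x a d0 K : 0 <= K -> 0 <= a < d0 ->
  (forall d, 0 < d -> a <= d <= d0 -> x <= K * d) -> x <= K * a.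
Proof.
  intros HK Ha H. destruct (Rlt_le_dec 0 a) as [Hp|Hz]; [apply H; lra|].
  replace a with 0 in * by lra. rewrite Rmult_0_r. apply le_epsilon. intros eps He.
  set (d := Rmin d0 (eps / (K + 1))).
  assert (Hk : 0 < eps / (K + 1)) by (apply Rdiv_lt_0_compat; lra).
  assert (0 < d) by (apply Rmin_pos; lra).
  assert (d <= d0) by apply Rmin_l. assert (d <= eps / (K + 1)) by apply Rmin_r.
  apply Rle_trans with (K * d); [apply H; lra|].
  apply Rle_trans with ((K + 1) * (eps / (K + 1))); [|right; field; lra].
  apply Rmult_le_compat; lra.
Qed.

Theorem theorem6
  (theta : R -> R) (w0 : R) (lam : nat -> nat -> R) (nl : nat -> nat) (l0 : nat)
  (* theta odd, non-decreasing, C^2, theta = pi/4 on (pi/3, oo) *)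
  (Hodd : forall x, theta (- x) = - theta x)
  (Hmono : forall x y, x <= y -> theta x <= theta y)
  (Hd1 : forall x, ex_derive theta x)
  (Hd2 : forall x, ex_derive (Derive theta) x)
  (Hd2c : forall x, continuous (Derive_n theta 2) x)
  (Hconst : forall x, PI / 3 < x -> theta x = PI / 4)
  (Hw0 : PI / 3 <= w0 < PI / 2)
  (* alpha(l) = o(1/l), gamma(l) = o(1) *)
  (Halpha : is_lim_seq (fun l => INR l * alpha theta w0 lam nl l) 0)
  (Hgamma : is_lim_seq (gamma theta w0 lam nl) 0)
  (Hupi : forall l, (l0 <= l)%nat -> u_l theta w0 lam nl l PI <> 0)
  (Hc : 0 < c_inf theta w0 lam nl l0) :
  exists K : R, exists N : nat, forall l : nat, (N <= l)%nat ->
    Rabs (time_radius2 (orthonormalize (inf_prod (m_l theta w0 lam nl l)))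
          - time_radius2 (meyer_hat theta w0))
    <= K * Rmax (mu_l theta w0 lam nl l)
                (INR l * Rpower (C0 w0)
                   (- INR l + 2 * log2 ((1 + eps_l theta w0 lam nl l)
                                        / c_inf theta w0 lam nl l0))).
Proof.
  pose proof PI_RGT_0 as HPI. pose proof PI_4 as HPI4.
  set (mh := meyer_hat theta w0). set (dmh := dmeyer_hat theta w0).
  assert (Dmh : forall w, is_derive mh w (dmh w)) by (apply dmeyer_hat_derive; auto).
  assert (Cdmh : cont dmh) by (apply dmeyer_hat_cont; auto).
  assert (inner : forall w, Rabs w <= 2 * PI / 3 -> mh w = 1 /\ dmh w = 0) by (apply meyer_hat_inner; auto).
  assert (outer : forall w, 4 * PI / 3 <= Rabs w -> mh w = 0 /\ dmh w = 0) by (apply meyer_hat_outer; auto).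
  assert (range : forall w, 0 <= mh w <= 1) by (apply meyer_hat_range; auto).
  destruct (bounded_of_compact_support dmh (4 * PI / 3)) as [M1 [PM1 HM1]]; auto; [lra|apply outer|].
  (* 1 + M1 bounds both mh and dmh, so one decay constant serves for the pair. *)
  set (c := (1 + M1) * (1 + (4 * PI / 3) ^ 2)).
  assert (Nmh : nice c mh dmh).
  { split; [|split; [|split]]; auto; apply decays_of_compact_support; try apply outer; intro w.
    - apply Rabs_le. specialize (range w). lra.
    - specialize (HM1 w). lra. }
  assert (Cmh : cont mh) by now apply nice_cont in Nmh.
  assert (Pc : 0 <= c) by (destruct Nmh as [_ [_ [H _]]]; now apply decays_nonneg with mh).
  assert (Ppos : 0 < RInt_R (abs2_invFT mh)).
  { destruct Nmh as [_ [_ [Hdec _]]].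
    apply RInt_abs2_pos with c; auto.
    destruct (decays_RInt_R c mh Cmh Hdec) as [Hint _].
    (* mh equals 1 on [-1, 1], because 1 <= 2 pi / 3, so its integral is at least 2 and in
       particular nonzero. *)
    assert (G := is_RInt_R_ge mh _ 1 Cmh (fun x => proj1 (range x)) Hint).
    rewrite (RInt_ext mh (fun _ => 1)) in G.
    - rewrite RInt_const in G. change (scal (INR 1 - - INR 1) 1) with ((INR 1 - - INR 1) * 1) in G. simpl in G. lra.
    - intros x Hx. simpl in Hx. rewrite Rmin_left, Rmax_right in Hx by lra.
      apply inner. pose proof PI2_3_2. apply Rabs_le. lra. }
  destruct (square_nice _ _ _ Nmh) as [Q1 [Q2 [Q3 Q4]]].
  assert (Per : forall w, per (fun x => mh x ^ 2) w = 1).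
  { apply per_compact_square.
    - apply outer.
    - intros w Hw. now apply meyer_hat_squares.
    - apply (per_periodic (2 * c ^ 2)); auto. intro x. exact (proj1 (per_C1 _ _ _ Q1 Q2 Q3 Q4 x)). }
  set (m0 := meyer_mask theta w0). set (dm0 := fun x => 2 * dmh (2 * red2pi x)). set (M0 := 2 * M1).
  assert (m0_lo : forall x, cos x <= - (1 / 2) -> m0 x = 0 /\ dm0 x = 0) by (apply mask_lo; auto).
  assert (m0_hi : forall x, 1 / 2 <= cos x -> m0 x = 1 /\ dm0 x = 0) by (apply mask_hi; auto).
  assert (Dm0 : forall x, is_derive m0 x (dm0 x)) by (apply mask_derive; auto).
  assert (Cdm0 : cont dm0) by (apply dmask_cont with mh; auto).
  assert (m0_0 : m0 0 = 1) by (apply m0_hi; rewrite cos_0; lra).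
  assert (m0_per : forall x, m0 (x + 2 * PI) = m0 x) by (apply mask_periodic with dmh; auto).
  assert (m0_b : forall x, Rabs (m0 x) <= 1) by (intro x; eapply mask_bound; eauto).
  assert (dm0_b : forall x, Rabs (dm0 x) <= M0) by (intro x; eapply mask_bound; eauto).
  assert (ph_in : forall w, Rabs w <= 4 * PI / 3 -> mh w = m0 (w / 2) /\ dmh w = / 2 * dm0 (w / 2)) by (apply mask_inner; auto).
  destruct (time_radius2_stable c mh dmh Nmh Ppos) as [Ks [eta [PKs [Peta Hst]]]].
  set (K1 := 4 + 2 * M0).
  set (K2 := 30 * (8 + 3 * M0) + 32 * (64 * (M0 + 2)) ^ 3).
  set (K3 := 2 + 100 * (c + 1) * (2 * c + 1)).
  assert (PM0 : 0 <= M0) by (unfold M0; lra).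
  assert (PK2 : 0 < K2).
  { unfold K2. assert (0 <= (64 * (M0 + 2)) ^ 3) by (apply pow_le; lra). lra. }
  assert (PK3 : 0 < K3).
  { unfold K3. assert (0 <= 100 * (c + 1) * (2 * c + 1)) by (apply Rmult_le_pos; lra). lra. }
  (* The three entries serve in turn the decay estimate for the product, the orthonormalization with
     e = K2 * d, and the stability of the time radius with perturbation K2 * d * K3. *)
  set (d0 := Rmin (/ (64 * (M0 + 2))) (Rmin (/ (20 * (2 * c + 1)) / K2) (eta / (K2 * K3)))).
  assert (Pd0 : 0 < d0).
  { repeat apply Rmin_pos.
    - apply Rinv_0_lt_compat; lra.
    - apply Rdiv_lt_0_compat; auto. apply Rinv_0_lt_compat; lra.
    - apply Rdiv_lt_0_compat; auto. now apply Rmult_lt_0_compat. }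
  assert (PK1 : 0 < K1) by (unfold K1; lra).
  assert (Lmu : is_lim_seq (mu_l theta w0 lam nl) 0).
  { replace (Finite 0) with (Finite (0 + 0)) by (f_equal; ring).
    now apply (is_lim_seq_plus' (fun l => INR l * alpha theta w0 lam nl l)). }
  apply is_lim_seq_spec in Lmu. destruct (Lmu (mkposreal (d0 / K1) ltac:(now apply Rdiv_lt_0_compat))) as [N1 HN1]; simpl in HN1.
  apply is_lim_seq_spec in Halpha. destruct (Halpha (mkposreal (1 / 2) ltac:(lra))) as [N2 HN2]; simpl in HN2.
  (* The constant is the product of the losses from mu to d, to the scaling function, to its
     orthonormalization and to the radius. N1 ensures K1 * mu < d0 and N2 ensures alpha <= 1 / 2. *)
  exists (Ks * (K2 * K3) * K1), (max 4 (max N1 N2)). intros l Hl.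
  assert (Hl4 : (4 <= l)%nat) by lia.
  destruct (u_close theta w0 lam nl dm0 Dm0 Cdm0 m0_lo m0_per l) as [Pa _].
  assert (Ha : alpha theta w0 lam nl l <= 1 / 2).
  { specialize (HN2 l ltac:(lia)). rewrite Rminus_0_r in HN2. apply Rabs_def2 in HN2.
    apply le_INR in Hl4. simpl in Hl4. nra. }
  destruct (m_l_perturbation theta w0 lam nl dm0 M0 Dm0 Cdm0 m0_lo m0_0 m0_per m0_b dm0_b l Hl4 Ha)
    as [Pmu [dm [Dm [Cdm [Em0 [Hm [Hdm [Hmlo Hdmlo]]]]]]]].
  set (m := m_l theta w0 lam nl l) in *. set (mu := mu_l theta w0 lam nl l) in *. fold K1 in Hm, Hdm, Hmlo, Hdmlo.
  assert (Hmu : K1 * mu < d0).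
  { specialize (HN1 l ltac:(lia)). rewrite Rminus_0_r in HN1. apply Rabs_def2 in HN1. fold mu in HN1.
    apply Rlt_le_trans with (K1 * (d0 / K1)); [apply Rmult_lt_compat_l; lra|]. right; field; lra. }
  apply Rle_trans with (Ks * (K2 * K3) * K1 * mu).
  2:{ apply Rmult_le_compat_l; [|apply Rmax_l]. repeat apply Rmult_le_pos; lra. }
  rewrite Rmult_assoc.
  (* mu may be 0 while the stability estimate divides by d, so d is taken positive and at least K1 *
     mu. *)
  apply le_of_le_perturbation with d0.
  { apply Rmult_le_pos; auto. apply Rmult_le_pos; lra. }
  { split; auto. apply Rmult_le_pos; lra. }
  intros d Pd [Hd1' Hd0].
  assert (Hd64 : d <= / (64 * (M0 + 2))) by (apply Rle_trans with (1 := Hd0), Rmin_l).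
  assert (HdK2 : d <= / (20 * (2 * c + 1)) / K2).
  { apply Rle_trans with (1 := Hd0). apply Rle_trans with (1 := Rmin_r _ _), Rmin_l. }
  assert (HdK3 : d <= eta / (K2 * K3)).
  { apply Rle_trans with (1 := Hd0). apply Rle_trans with (1 := Rmin_r _ _), Rmin_r. }
  assert (Bdm : forall x, Rabs (dm x) <= M0 + K1 * mu).
  { intro x. replace (dm x) with (dm0 x + (dm x - dm0 x)) by ring. apply Rle_trans with (1 := Rabs_triang _ _).
    apply Rplus_le_compat; auto. }
  assert (six : forall x, 0 <= sixth x) by apply sixth_pos.
  set (ph := inf_prod m). set (dph := dinf_prod m dm).
  assert (Dph : forall w, is_derive ph w (dph w)) by (intro w; apply (inf_prod_C1 m dm _ Dm Cdm Bdm Em0)).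
  assert (Cdph : cont dph) by (intro w; apply (inf_prod_C1 m dm _ Dm Cdm Bdm Em0)).
  destruct (ph_close mh dmh m0 dm0 M0 m0_hi m0_b dm0_b ph_in outer m dm ph dph d) as [Cl1 Cl2]; auto.
  - intro x. apply Rle_trans with (1 := Hm x); auto.
  - intro x. apply Rle_trans with (1 := Hdm x); auto.
  - intros x Hx. apply Rle_trans with (1 := Hmlo x Hx). now apply Rmult_le_compat_r.
  - intros x Hx. apply Rle_trans with (1 := Hdmlo x Hx). now apply Rmult_le_compat_r.
  - apply inf_prod_0; auto.
  - intro w. apply (inf_prod_refinement m dm _ Dm Cdm Bdm Em0).
  - intro w. apply (dinf_prod_refinement m dm _ Dm Cdm Bdm Em0).
  - fold K2 in Cl1, Cl2.
    assert (He : 0 <= K2 * d <= / (20 * (2 * c + 1))).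
    { split; [apply Rmult_le_pos; lra|].
      apply Rle_trans with (K2 * (/ (20 * (2 * c + 1)) / K2)); [apply Rmult_le_compat_l; lra|]. right; field; lra. }
    destruct (orthonormalize_close c mh dmh Nmh Per (K2 * d) ph dph He Dph Cdph Cl1 Cl2) as [dg [Dg [Cdg [G1 G2]]]].
    fold K3 in G1, G2. replace (Ks * (K2 * K3) * d) with (Ks * (K2 * d * K3)) by ring.
    apply (Hst (K2 * d * K3) (orthonormalize ph) dg); auto.
    split; [repeat apply Rmult_lt_0_compat; auto|].
    apply Rle_trans with (K2 * K3 * (eta / (K2 * K3))).
    + replace (K2 * d * K3) with (K2 * K3 * d) by ring. apply Rmult_le_compat_l; auto. apply Rmult_le_pos; lra.
    + right; field; lra.
Qed.
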